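(* Let $D$ be a finite $p$-group and $A$ a Dade $D$-algebra over a finite field $E$ of characteristic $p$, let $\rho:D\to A^\times$ be the unique group homomorphism with $x^d=\rho(d)^{-1}x\rho(d)$ for all $d\in D$, $x\in A$, and put $D_1=\rho(D)$. Let $B=\bar A(D)$ with Brauer homomorphism $\mathrm{br}_D:A^D\to B$, $m=\sqrt{\dim_E A}$, $l=\sqrt{\dim_E B}$, $s=[E:\mathbb{F}_p]$, and fix unitary $\mathbb{F}_p$-algebra embeddings $\iota:A\to\mathfrak{E}_1:=\mathrm{M}_{ms}(\mathbb{F}_p)$ and $\iota':B\to\mathfrak{E}_2:=\mathrm{M}_{ls}(\mathbb{F}_p)$. Then there is a group homomorphism $\phi:\mathbf{N}_{\mathfrak{E}_1^\times}(\iota(D_1))\to\mathfrak{E}_2^\times$ such that $\phi(\iota(c))=\iota'(\mathrm{br}_D(c))$ for all $c\in(A^D)^\times$.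
   Context: A $D$-algebra over $E$ is an $E$-algebra with a homomorphism $D\to\mathrm{Aut}_E(A)$, $x\mapsto x^d$. $A^Q$ denotes $Q$-fixed points; $\mathrm{Tr}_Q^D:A^Q\to A^D$, $x\mapsto\sum x^d$ over representatives $d$ of right cosets of $Q$ in $D$, with image $A^D_Q$. $A$ is a Dade $D$-algebra if it is a full matrix algebra over $E$ and has a $D$-stable $E$-basis with at least one $D$-fixed element. Brauer quotient $\bar A(D)=A^D/\sum_{Q<D}A^D_Q$ with quotient map $\mathrm{br}_D$; it is a full matrix algebra over $E$. A unitary embedding is an injective identity-preserving algebra homomorphism; $\mathbf{N}_{\mathfrak{E}_1^\times}(\cdot)$ is the normalizer in the unit group. *)

(* Defs.v *)
From HB Require Import structures.
From mathcomp Require Import all_boot all_order all_algebra all_fingroup all_solvable all_field.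
Set Implicit Arguments.
Unset Strict Implicit.
Unset Printing Implicit Defensive.
Import GRing.Theory.
Local Open Scope ring_scope.

(* A D-algebra structure on A = 'M[E]_m is given by a function
   act : gT -> 'M[E]_m -> 'M[E]_m, with x^d := act d x (right action). *)

Section DadeDefs.
Variables (gT : finGroupType) (E : finFieldType) (m : nat).
Implicit Types (Q D : {group gT}) (act : gT -> 'M[E]_m -> 'M[E]_m).

Definition is_D_algebra act (D : {group gT}) : Prop :=
  [/\ (forall x, act 1%g x = x),
      (forall d e, d \in D -> e \in D -> forall x, act (d * e)%g x = act e (act d x)),
      (forall d, d \in D -> bijective (act d)) &
      (forall d, d \in D ->
         [/\ forall (a : E) x y, act d (a *: x + y) = a *: act d x + act d y,
             forall x y, act d (x *m y) = act d x *m act d y &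
             act d 1%:M = 1%:M])].

Definition fixpts act (Q : {group gT}) : {set 'M[E]_m} :=
  [set x | [forall d in Q, act d x == x]].

Definition rtrace act (Q D : {group gT}) (x : 'M[E]_m) : 'M[E]_m :=
  \sum_(C in rcosets Q D) act (repr C) x.

Definition brauer_ideal act (D : {group gT}) : {vspace 'M[E]_m} :=
  <<enum [set rtrace act Q D x | Q in [set Q : {group gT} | Q \proper D],
                                 x in fixpts act Q]>>%VS.

Definition is_Dade act (D : {group gT}) : Prop :=
  is_D_algebra act D /\
  exists X : seq 'M[E]_m,
    [/\ basis_of fullv X,
        (forall d b, d \in D -> b \in X -> act d b \in X) &
        exists2 b, b \in X & forall d, d \in D -> act d b = b].

(* br : A -> B restricts on A^D to the Brauer quotient map
   A^D -> A^D / sum_{Q<D} A^D_Q = B (B an E-algebra) *)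
Definition is_brauer_quotient act (D : {group gT}) (B : falgType E)
    (br : 'M[E]_m -> B) : Prop :=
  [/\ (forall (a : E) x y, x \in fixpts act D -> y \in fixpts act D ->
          br (a *: x + y) = a *: br x + br y),
      (forall x y, x \in fixpts act D -> y \in fixpts act D ->
          br (x *m y) = br x * br y),
      br 1%:M = 1,
      (forall b : B, exists2 x, x \in fixpts act D & br x = b) &
      (forall x, x \in fixpts act D -> (br x == 0) = (x \in brauer_ideal act D))].

End DadeDefs.

(* unitary (identity-preserving) injective ring homomorphism into 'M['F_p]_n;
   F_p-linearity is automatic from additivity. *)
Definition unitary_embedding (p : nat) (R : pzRingType) (n : nat)
    (f : R -> 'M['F_p]_n) : Prop :=
  [/\ forall x y, f (x + y) = f x + f y,
      forall x y, f (x * y) = f x *m f y,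
      f 1 = 1%:M & injective f].

Definition unit_normalizer (p n : nat) (S : {set 'M['F_p]_n}) : {set 'M['F_p]_n} :=
  [set u | (u \in unitmx) && ([set invmx u *m x *m u | x in S] == S)].

(* Main.v *)
Require Import Defs.
From HB Require Import structures.
From Stdlib Require Import Classical_Prop.
From mathcomp Require Import all_boot all_order all_algebra all_fingroup all_solvable all_field.
From mathcomp.multinomials Require Import mpoly.
Set Implicit Arguments.
Unset Strict Implicit.
Unset Printing Implicit Defensive.
Import GRing.Theory.
Local Open Scope ring_scope.

(** Write [A = M_m(E)] acting on [V = E^m] from the right. Restriction of scalars turns
    [iota] and [iota'] into the standard modules, so that [phi] becomes a homomorphism from
    the additive bijections of [V] normalising [rho(D)] to those of [E^l].

    It is built by descending along elementary abelian central subgroups [Z] of [rho(D)]: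
    one step replaces [A] by the Brauer quotient [A(Z)], on which [rho(D)] acts through a
    smaller group. For a single step, list [rho(Z)] as [r_1, ..., r_n], let
    [xi = sum_i x_i (r_i - 1)] over [R = E[x_1, ..., x_n]], and consider the lattice
    [ker xi] in [R^m]. Over the fraction field, [ker xi / im xi^(p-1)] is a module of
    dimension [l] for the Brauer quotient: genericity of [xi] makes every relative trace
    from a proper subgroup of [Z] a sum [sum_j xi^j b xi^(p-1-j)]. An additive bijection
    [u] normalising [rho(Z)] permutes the [r_i]; permuting the [x_i] accordingly, [u] lifts
    to [R^m] commuting with [xi], hence acts on the image of [ker xi] in
    [ker xi / im xi^(p-1)]. This image is [I^l] for an ideal [I] of [R], and as [R] is
    factorial it may be scaled to have gcd 1; the action then extends to the reflexive hull
    [R^l], and [phi(u)] is its value at [x = 0]. Frobenius twists enter because [u] is only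
    additive: [u(v) = sum_i v^(p^i) U_i]. *)

(** * Traces and orbits of p-groups *)

(** A normalising [u] can permute the [r_i], so in general it commutes with no single [r_i - 1].
    Hence [Z] collects everything in the group whose image is central of order dividing p: its image
    is preserved by every such [u], which a cyclic subgroup need not be. Hence also the
    indeterminates as coefficients: permuting them absorbs what [u] does to the [r_i], and x = 0 is
    a point that all these permutations and Frobenius twists respect. But [xi] itself vanishes
    there, so nothing can be read off from its kernel at that point; the free module R^l has a fibre
    of dimension l, which I^l need not have. That ker xi / im xi^(p-1) realises the whole Brauer
    quotient rests on two facts: the centraliser of [xi] is A^Z plus sums of the same shape as the
    traces, and a trace argument forces all Jordan blocks of [xi] shorter than p to have one common
    size. Since the lifts involve choices, each step produces the graph of [phi]: total on the
    normaliser, single-valued and closed under composition. *)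

Section RestrictedTrace.
Variables (k : fieldType) (m : nat).
Implicit Types (a xi : 'M[k]_m).

Definition rproj q (U : 'M[k]_(q, m)) : 'M[k]_m := pinvmx U *m U.
(** If the row space of [U] is stable under [a], this is the trace of the restriction of [a] to
    it. *)
Definition rtr q (U : 'M[k]_(q, m)) a : k := \tr (rproj U *m a).

Lemma rproj_sub q (U : 'M[k]_(q, m)) : (rproj U <= U)%MS.
Proof. exact: submxMl. Qed.

Lemma rproj_id q r (U : 'M[k]_(q, m)) (v : 'M[k]_(r, m)) :
  (v <= U)%MS -> v *m rproj U = v.
Proof. by move=> vU; rewrite mulmxA mulmxKpV. Qed.

Lemma rtr_sub q q' (U : 'M[k]_(q, m)) (U' : 'M[k]_(q', m)) a :
  (U *m a <= U')%MS -> (U' <= U)%MS -> rtr U a = rtr U' a.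
Proof.
move=> UaU' U'U; rewrite /rtr.
have h : (rproj U *m a <= U')%MS.
  by apply: submx_trans UaU'; rewrite submxMr // rproj_sub.
rewrite -(rproj_id h) mxtrace_mulC mulmxA rproj_id //.
exact: submx_trans (rproj_sub _) U'U.
Qed.

(** Traces add along the exact sequence with kernel [U :&: kermx xi], middle term [U] and image
    [U *m xi]; [a] acts on it because it commutes with [xi]. *)
Lemma rtr_ker_im q (U : 'M[k]_(q, m)) xi a :
  a *m xi = xi *m a -> (U *m a <= U)%MS ->
  rtr U a = rtr (U :&: kermx xi)%MS a + rtr (U *m xi) a.
Proof.
move=> com Ua; rewrite /rtr.
set p0 := rproj (U :&: kermx xi)%MS; set p1 := rproj (U *m xi).
(* A section of [xi] over [U *m xi]; [ka] below projects [U] onto its kernel part along it. *)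
pose sg := pinvmx (U *m xi) *m U.
have sg_sub : (sg <= U)%MS by exact: submxMl.
have sgK r (y : 'M[k]_(r, m)) : (y <= U *m xi)%MS -> y *m sg *m xi = y.
  by move=> yU; rewrite /sg mulmxA -mulmxA mulmxKpV.
set pU := rproj U.
pose ka := pU *m (1%:M - xi *m sg).
have pUxi : (pU *m xi <= U *m xi)%MS by rewrite submxMr // rproj_sub.
have ka0 : (ka <= U :&: kermx xi)%MS.
  rewrite sub_capmx; apply/andP; split.
    rewrite /ka mulmxBr mulmx1 addmx_sub ?rproj_sub // eqmx_opp.
    by rewrite mulmxA; apply: submx_trans sg_sub; apply: submxMl.
  apply/sub_kermxP; rewrite /ka mulmxBr mulmx1 mulmxBl mulmxA sgK //.
  by rewrite subrr.
have -> : pU = ka + pU *m xi *m sg by rewrite /ka mulmxBr mulmx1 mulmxA subrK.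
rewrite mulmxDl raddfD /=; congr (_ + _).
  have kaa : (ka *m a <= U :&: kermx xi)%MS.
    rewrite sub_capmx; apply/andP; split.
      apply: submx_trans Ua; apply: submxMr; apply: submx_trans ka0 _.
      exact: capmxSl.
    apply/sub_kermxP; rewrite -mulmxA com mulmxA.
    have /sub_kermxP -> : (ka <= kermx xi)%MS := submx_trans ka0 (capmxSr _ _).
    by rewrite mul0mx.
  rewrite -[LHS]/(\tr (ka *m a)) -(rproj_id kaa) mxtrace_mulC mulmxA.
  congr (\tr (_ *m _)).
  rewrite /ka mulmxA rproj_id; last exact: submx_trans (rproj_sub _) (capmxSl _ _).
  rewrite mulmxBr mulmx1 mulmxA.
  have /sub_kermxP -> : (rproj (U :&: kermx xi)%MS <= kermx xi)%MS.
    exact: submx_trans (rproj_sub _) (capmxSr _ _).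
  by rewrite mul0mx subr0.
have h : (p1 *m (sg *m a) <= U)%MS.
  rewrite mulmxA; apply: submx_trans Ua; apply: submxMr.
  by apply: submx_trans sg_sub; apply: submxMl.
rewrite -(rproj_id pUxi) -/p1.
have -> : pU *m xi *m p1 *m sg *m a = (pU *m xi) *m (p1 *m (sg *m a)).
  by rewrite !mulmxA.
rewrite mxtrace_mulC (mulmxA _ pU xi) (rproj_id h) -(mulmxA p1) -(mulmxA sg) com (mulmxA sg).
rewrite (mulmxA p1) (mulmxA p1) sgK //.
exact: rproj_sub.
Qed.

End RestrictedTrace.

Section Layers.
Variables (p : nat) (k : fieldType) (m : nat) (xi : 'M[k]_m).
Hypotheses (pk : p \in [pchar k]) (xip : xi ^+ p = 0).

Lemma comm_mxX n (a : 'M[k]_m) : a *m xi = xi *m a -> a *m xi ^+ n = xi ^+ n *m a.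
Proof. by move=> h; rewrite !mulmxE; apply: commrX. Qed.

(** Splitting repeatedly into kernel and image, the trace is the sum over i < p of the traces on the
    layers [xi ^+ i :&: kermx xi]. The hypothesis pushes each layer into the next, so consecutive
    layers contribute equally and the sum is p times one value. *)
Lemma trace_layers_zero (c : 'M[k]_m) :
  c *m xi = xi *m c ->
  (forall i, (i.+1 < p)%N ->
     ((xi ^+ i :&: kermx xi) *m c <= xi ^+ i.+1)%MS) ->
  \tr c = 0.
Proof.
move=> com lay.
pose t i := rtr (xi ^+ i :&: kermx xi)%MS c.
have stab i : (xi ^+ i *m c <= xi ^+ i)%MS by rewrite -comm_mxX // submxMl.
have S (i : nat) : rtr (xi ^+ i) c = t i + rtr (xi ^+ i.+1) c.
  by rewrite (@rtr_ker_im _ _ _ _ xi) // exprSr.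
have tS i : (i.+1 < p)%N -> t i = t i.+1.
  move=> ip; apply: rtr_sub.
    rewrite sub_capmx lay //=; apply/sub_kermxP.
    by rewrite -mulmxA com mulmxA; have /sub_kermxP -> := capmxSr (xi ^+ i) (kermx xi);
       rewrite mul0mx.
  by rewrite capmxS // exprS submxMl.
have p0 : (0 < p)%N by case/andP: pk => /prime_gt0.
have t0 i : (i < p)%N -> t i = t 0%N.
  by elim: i => // i IH ip; rewrite -tS // IH // ltnW.
have sum n : (n <= p)%N -> rtr (xi ^+ 0) c = t 0%N *+ n + rtr (xi ^+ n) c.
  elim: n => [|n IH] np; first by rewrite mulr0n add0r.
  by rewrite IH ?(ltnW np) // S t0 // mulrSr addrA.
have := sum p (leqnn p); rewrite xip.
have -> : t 0%N *+ p = 0 by rewrite -mulr_natr pcharf0 ?mulr0.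
rewrite add0r /rtr -[rproj (xi ^+ 0)]mul1mx rproj_id // mul1mx => ->.
by rewrite /rproj mulmx0 mul0mx raddf0.
Qed.

End Layers.

Section PGroupOrbits.
Local Open Scope group_scope.
Variables (p : nat) (gT : finGroupType).

Lemma maximal_coset (G H : {group gT}) (g : gT) :
  p.-group G -> maximal H G -> g \in G -> g \notin H ->
  [/\ prime p, H <| G, forall j, (g ^+ j \in H) = (p %| j)%N &
      forall z, z \in G -> exists2 j, (j < p)%N & z * g ^- j \in H].
Proof.
move=> pG maxH gG gH.
have nHG := p_maximal_normal pG maxH.
have iHG := p_maximal_index pG maxH.
have /normalP [sHG _] := nHG; have nH := normal_norm nHG.
have Gn1 : G :!=: 1.
  apply/eqP => G1; case/negP: gH.
  by move: gG; rewrite G1 => /set1P->; exact: group1.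
have [p_pr _ _] := pgroup_pdiv pG Gn1.
have gN : g \in 'N(H) := subsetP nH _ gG.
have oG : #|G / H| = p by rewrite card_quotient.
have gHn1 : coset H g != 1.
  by apply: contra gH => /eqP; apply: coset_idr.
have ord : #[coset H g] = p.
  have : (#[coset H g] %| p)%N by rewrite -oG order_dvdG // mem_quotient.
  by case/primeP: p_pr => _ h /h /orP[|/eqP//]; rewrite order_eq1 (negPf gHn1).
split=> //.
  move=> j; rewrite -ord order_dvdn -morphX //; apply/idP/eqP => [|/coset_idr->//].
    exact: coset_id.
  exact: groupX.
move=> z zG; have zN : z \in 'N(H) := subsetP nH _ zG.
have : coset H z \in <[coset H g]>.
  have /eqP <- : G / H == <[coset H g]>.
    by rewrite eq_sym eqEcard cycle_subG mem_quotient //= -orderE ord oG.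
  exact: mem_quotient.
case/cyclePmin=> j; rewrite ord => jp e; exists j => //.
apply: coset_idr; first by rewrite groupM // groupV groupX.
by rewrite morphM ?morphV ?morphX ?groupV ?groupX //= e mulgV.
Qed.

Variables (I : finType) (f : gT -> I -> I) (G : {group gT}).
Hypotheses (pG : p.-group G) (f1 : forall i, f 1 i = i)
  (fM : forall x y i, x \in G -> y \in G -> f (x * y) i = f y (f x i)).

Definition fixed_index (i : I) := [forall g in G, f g i == i].

(** A non-trivial orbit is induced from a maximal subgroup H containing a point stabiliser: the
    H-orbit Y of the point and its translates by the p powers of [g] tile the orbit. Each triple (H,
    g, Y) accounts for one orbit. *)
Lemma orbit_partition (S : {set I}) :
  (forall i, i \in S -> ~~ fixed_index i) ->
  (forall g i, g \in G -> i \in S -> f g i \in S) ->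
  exists T : seq ({group gT} * gT * {set I}),
    (forall t, t \in T -> [/\ maximal t.1.1 G, t.1.2 \in G, t.1.2 \notin t.1.1 &
       forall h i, h \in t.1.1 -> i \in t.2 -> f h i \in t.2]) /\
    (forall i, (\sum_(t <- T) \sum_(j < p) (f (t.1.2 ^- j) i \in t.2) = (i \in S))%N).
Proof.
have [n] := ubnP #|S|; elim: n S => // n IH S ltSn nfix stab.
have [->|/set0Pn [x xS]] := eqVneq S set0.
  by exists [::]; split=> // i; rewrite big_nil inE.
have stG : group_set [set g in G | f g x == x].
  apply/group_setP; split=> [|g h]; first by rewrite inE group1 f1 eqxx.
  rewrite !inE => /andP[gG /eqP gx] /andP[hG /eqP hx].
  by rewrite groupM //= fM // gx hx eqxx.
pose St := Group stG.
have StG : St \proper G.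
  rewrite properE; apply/andP; split; first by apply/subsetP => g; rewrite inE => /andP[].
  apply: contra (nfix _ xS) => /subsetP h; apply/forall_inP => g gG.
  by have := h _ gG; rewrite inE gG.
have [H maxH StH] : {H : {group gT} | maximal H G & St \subset H}.
  by have [H maxH sH] := @maxgroup_exists _ (fun K : {group gT} => K \proper G) St StG;
     exists H.
have [g gG gH] : exists2 g, g \in G & g \notin H.
  by have /properP[_ [g gG gH]] := maxgroupp maxH; exists g.
have [p_pr nHG ordg cosg] := maximal_coset pG maxH gG gH.
have sHG := subsetP (normal_sub nHG).
pose O := [set f z x | z in G]; pose Y := [set f h x | h in H].
have OS : O \subset S by apply/subsetP => _ /imsetP[z zG ->]; apply: stab.
have xO : x \in O by apply/imsetP; exists 1; rewrite ?group1 ?f1.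
have Ostab z i : z \in G -> (f z i \in O) = (i \in O).
  move=> zG; apply/imsetP/imsetP => [[w wG e]|[w wG ->]].
    exists (w * z^-1); rewrite ?groupM ?groupV //.
    by rewrite fM ?groupV // -e -fM ?groupV // mulgV f1.
  by exists (w * z); rewrite ?groupM // fM.
have YO : Y \subset O.
  by apply/subsetP => _ /imsetP[h hH ->]; apply: imset_f; apply: sHG.
have Ymem w : w \in G -> (f w x \in Y) = (w \in H).
  move=> wG; apply/imsetP/idP => [[h hH e]|wH]; last by exists w.
  have hG := sHG _ hH.
  have : w * h^-1 \in H.
    apply: (subsetP StH); rewrite inE groupM ?groupV //=.
    by rewrite fM ?groupV // e -fM ?groupV // mulgV f1.
  by rewrite groupMr // groupV.
have [||| T [T1 T2]] := IH (S :\: O).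
- rewrite -ltnS; apply: leq_trans ltSn; rewrite ltnS; apply: proper_card.
  by apply/properP; split; [apply: subsetDl | exists x; rewrite // inE xO].
- by move=> i; rewrite inE => /andP[_ /nfix].
- by move=> z i zG; rewrite !inE Ostab // => /andP[-> /(stab _ _ zG)].
exists ((H, g, Y) :: T); split.
  move=> t; rewrite inE => /orP[/eqP->/=|/T1//]; split=> // h _ hH /imsetP[h' h'H ->].
  by rewrite -fM ?sHG // Ymem ?groupM ?sHG.
move=> i; rewrite big_cons T2 inE /=.
have [iO|iO] := boolP (i \in O); last first.
  rewrite big1 ?add0n // => j _; apply/eqP; rewrite eqb0; apply: contra iO => iY.
  by rewrite -(@Ostab (g ^- j)) ?groupV ?groupX // (subsetP YO).
rewrite addn0 (subsetP OS _ iO).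
case/imsetP: iO => z zG ->; have [j0 j0p zH] := cosg z zG.
have gjG j : z * g ^- j \in G by rewrite groupM ?groupV ?groupX.
have gVG j : g ^- j \in G by rewrite groupV groupX.
rewrite (bigD1 (Ordinal j0p)) //= -fM // Ymem //.
rewrite zH big1 // => j ne; apply/eqP; rewrite eqb0.
rewrite -fM // Ymem //.
apply: contra ne => zjH.
have : (z * g ^- j)^-1 * (z * g ^- j0) \in H by rewrite groupM // groupV.
have : (z * g ^- j0)^-1 * (z * g ^- j) \in H by rewrite groupM // groupV.
rewrite !invMg !invgK !mulgA !mulgKV.
wlog le : j0 j j0p zH zjH / (j0 <= j)%N.
  move=> W h1 h2; case/orP: (leq_total j0 j) => le.
    exact: (W j0 j).
  by have := W j (Ordinal j0p) (ltn_ord j) zjH zH le h2 h1; rewrite /= -!val_eqE /= eq_sym.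
move=> _; have -> : g ^+ j = g ^+ (j - j0) * g ^+ j0 by rewrite -expgD subnK.
rewrite mulgK ordg => dv.
rewrite -val_eqE /= eqn_leq le andbT; move: dv.
have : (j - j0 < p)%N by apply: leq_ltn_trans (ltn_ord j); apply: leq_subr.
by case: (posnP (j - j0)%N) => [/eqP|/dvdn_leq h lt /h]; [rewrite subn_eq0 | rewrite leqNgt lt].
Qed.

End PGroupOrbits.

(** * Representations and relative traces *)

Section Representations.
Variables (p : nat) (gT : finGroupType) (k : fieldType) (m : nat).
Implicit Types (rho : gT -> 'M[k]_m) (a b : 'M[k]_m) (G H : {group gT}).

Definition is_rep G rho :=
  rho 1%g = 1%:M /\ {in G &, forall x y, rho (x * y)%g = rho x *m rho y}.

Definition centmx rho (H : {set gT}) a :=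
  forall h, h \in H -> rho h *m a = a *m rho h.

Definition rconj rho g a := rho g^-1%g *m a *m rho g.

(* For a maximal subgroup H of a p-group G and g in G \ H, this is the relative trace
   Tr_H^G on A^H, the powers of g being coset representatives. *)
Definition gtr rho g a := \sum_(j < p) rconj rho (g ^+ j)%g a.

(** [Y] is dual to the basis [X] under the trace form. Coordinates are thereby traces, which
    [trace_layers_zero] can show to vanish. *)
Definition dual_bases (I : finType) (X Y : I -> 'M[k]_m) :=
  (forall i j, \tr (X i *m Y j) = (i == j)%:R) /\
  (forall a, a = \sum_i \tr (a *m Y i) *: X i).

Definition perm_fam (I : finType) G rho (X : I -> 'M[k]_m) :=
  forall g i, g \in G -> exists j, rconj rho g (X i) = X j.

Definition fixb (I : finType) G rho (X : I -> 'M[k]_m) : pred I :=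
  fun i => [forall g in G, rconj rho g (X i) == X i].

Lemma rconjZ rho g c a : rconj rho g (c *: a) = c *: rconj rho g a.
Proof. by rewrite /rconj -scalemxAr -scalemxAl. Qed.

Lemma rconj_sum rho g (J : Type) (r : seq J) (P : pred J) (F : J -> 'M[k]_m) :
  rconj rho g (\sum_(j <- r | P j) F j) = \sum_(j <- r | P j) rconj rho g (F j).
Proof. by rewrite /rconj mulmx_sumr mulmx_suml. Qed.

Section Rep.
Variables (G : {group gT}) (rho : gT -> 'M[k]_m).
Hypothesis rhoP : is_rep G rho.

Lemma repV g : g \in G -> rho g^-1%g *m rho g = 1%:M.
Proof. by move=> gG; rewrite -(proj2 rhoP) ?groupV // mulVg (proj1 rhoP). Qed.

Lemma rep_V g : g \in G -> rho g *m rho g^-1%g = 1%:M.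
Proof. by move=> gG; rewrite -(proj2 rhoP) ?groupV // mulgV (proj1 rhoP). Qed.

Lemma repX g j : g \in G -> rho (g ^+ j)%g = rho g ^+ j.
Proof.
move=> gG; elim: j => [|j IH]; first by rewrite expg0 (proj1 rhoP).
by rewrite expgS (proj2 rhoP) ?groupX // IH exprS.
Qed.

Lemma rconjM x y a : x \in G -> y \in G ->
  rconj rho (x * y)%g a = rconj rho y (rconj rho x a).
Proof.
by move=> xG yG; rewrite /rconj invMg !(proj2 rhoP) ?groupV // !mulmxA.
Qed.

Lemma rconj1 a : rconj rho 1%g a = a.
Proof. by rewrite /rconj invg1 (proj1 rhoP) mul1mx mulmx1. Qed.

Lemma rconj_mul g a b : g \in G ->
  rconj rho g (a *m b) = rconj rho g a *m rconj rho g b.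
Proof.
move=> gG; rewrite /rconj -!mulmxA; congr (_ *m (_ *m _)).
by rewrite (mulmxA (rho g)) rep_V // mul1mx.
Qed.

Lemma tr_rconj g a : g \in G -> \tr (rconj rho g a) = \tr a.
Proof. by move=> gG; rewrite /rconj mxtrace_mulC mulmxA rep_V // mul1mx. Qed.

Lemma rconj_fix g a : g \in G -> rconj rho g a = a <-> rho g *m a = a *m rho g.
Proof.
move=> gG; rewrite /rconj; split=> [e|e].
  by rewrite -{1}e !mulmxA rep_V // mul1mx.
by rewrite -mulmxA -e mulmxA repV // mul1mx.
Qed.

Lemma centP a : centmx rho G a <-> forall g, g \in G -> rconj rho g a = a.
Proof. by split=> h g gG; [apply/rconj_fix => //; apply: h | apply/rconj_fix => //; apply: h]. Qed.

Lemma cent_sub (H K : {set gT}) a : H \subset K -> centmx rho K a -> centmx rho H a.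
Proof. by move=> /subsetP HK h x /HK; apply: h. Qed.

End Rep.

Section CentAlgebra.
Variables (rho : gT -> 'M[k]_m) (H : {set gT}).

Lemma cent1 : centmx rho H 1%:M.
Proof. by move=> h _; rewrite mulmx1 mul1mx. Qed.

Lemma centM a b : centmx rho H a -> centmx rho H b -> centmx rho H (a *m b).
Proof. by move=> ca cb h hH; rewrite mulmxA ca // -mulmxA cb // mulmxA. Qed.

Lemma centD a b : centmx rho H a -> centmx rho H b -> centmx rho H (a + b).
Proof. by move=> ca cb h hH; rewrite mulmxDr ca // cb // mulmxDl. Qed.

Lemma centZ c a : centmx rho H a -> centmx rho H (c *: a).
Proof. by move=> ca h hH; rewrite -scalemxAr ca // scalemxAl. Qed.

Lemma cent0 : centmx rho H 0.
Proof. by move=> h _; rewrite mulmx0 mul0mx. Qed.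

Lemma cent_sum (J : Type) (r : seq J) (P : pred J) (F : J -> 'M[k]_m) :
  (forall j, P j -> centmx rho H (F j)) -> centmx rho H (\sum_(j <- r | P j) F j).
Proof. by move=> hF; elim/big_ind: _ => //; [apply: cent0 | apply: centD]. Qed.

End CentAlgebra.

Section FixedDecomposition.
Variables (G : {group gT}) (rho : gT -> 'M[k]_m) (I : finType) (X Y : I -> 'M[k]_m).
Hypotheses (pG : (p.-group G)%g) (rhoP : is_rep G rho)
  (XY : dual_bases X Y) (permX : perm_fam G rho X).

Lemma dual_bases_inj : injective X.
Proof.
move=> i j e; have := proj1 XY i i; rewrite eqxx e (proj1 XY) eq_sym.
by case: eqP => // _ /esym/eqP; rewrite oner_eq0.
Qed.

Definition pidx g i := odflt i [pick j | rconj rho g (X i) == X j].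

Lemma pidxE g i : g \in G -> rconj rho g (X i) = X (pidx g i).
Proof.
move=> gG; rewrite /pidx; case: pickP => [j /eqP //|h].
by have [j e] := permX i gG; have := h j; rewrite e eqxx.
Qed.

Lemma pidx1 i : pidx 1%g i = i.
Proof. by apply: dual_bases_inj; rewrite -pidxE // (rconj1 rhoP). Qed.

Lemma pidxM x y i : x \in G -> y \in G -> pidx (x * y)%g i = pidx y (pidx x i).
Proof.
move=> xG yG; apply: dual_bases_inj.
by rewrite -!pidxE ?groupM // (rconjM rhoP) // pidxE.
Qed.

Lemma pidxK g : g \in G -> cancel (pidx g) (pidx g^-1%g).
Proof. by move=> gG i; rewrite -pidxM ?groupV // mulgV pidx1. Qed.

Lemma pidxVK g : g \in G -> cancel (pidx g^-1%g) (pidx g).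
Proof. by move=> gG i; rewrite -pidxM ?groupV // mulVg pidx1. Qed.

Lemma fixed_pidx i : fixed_index pidx G i = fixb G rho X i.
Proof.
apply: eq_forallb => g; case gG: (g \in G) => //=.
by rewrite pidxE // (inj_eq dual_bases_inj).
Qed.

Lemma coord_pidx g i a : g \in G ->
  \tr (rconj rho g a *m Y (pidx g i)) = \tr (a *m Y i).
Proof.
move=> gG; rewrite {1 2}(proj2 XY a) rconj_sum !mulmx_suml !raddf_sum /=.
apply: eq_bigr => j _; rewrite rconjZ -!scalemxAl !mxtraceZ pidxE //.
by rewrite !(proj1 XY) (inj_eq (can_inj (pidxK gG))).
Qed.

(** The coordinates of an invariant are constant on orbits of the basis, so each non-trivial orbit
    contributes a relative trace from a maximal subgroup, supplied by [orbit_partition]. *)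
Lemma fixed_decomp a : centmx rho G a ->
  exists T : seq (gT * 'M[k]_m),
    (forall t, t \in T -> exists H : {group gT},
       [/\ maximal H G, t.1 \in G, t.1 \notin H & centmx rho H t.2]) /\
    a = \sum_(i | fixb G rho X i) \tr (a *m Y i) *: X i + \sum_(t <- T) gtr rho t.1 t.2.
Proof.
move=> ca.
have cE g i : g \in G -> \tr (a *m Y (pidx g i)) = \tr (a *m Y i).
  move=> gG; rewrite -[RHS](coord_pidx i a gG).
  by move/(centP rhoP): ca => ->.
have [||T [T1 T2]] := @orbit_partition p gT I pidx G pG pidx1 pidxM
   [set i | ~~ fixb G rho X i].
- by move=> i; rewrite inE fixed_pidx.
- move=> g i gG; rewrite !inE -!fixed_pidx; apply: contra => /forall_inP h.
  have E x : x \in G -> pidx x i = pidx g i.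
    move=> xG; have /eqP <- := h (g^-1 * x)%g (groupM (groupVr gG) xG).
    by rewrite -pidxM ?groupM ?groupV // mulKVg.
  by apply/forall_inP => x xG; rewrite E // -(E 1%g) // pidx1.
pose proj (S : {set I}) := \sum_(i in S) \tr (a *m Y i) *: X i.
exists [seq (t.1.2, proj t.2) | t <- T]; split.
  move=> _ /mapP[t /T1[mt gG gH stab] ->]; exists t.1.1; split=> //=.
  have sHG := subsetP (normal_sub (p_maximal_normal pG mt)).
  have rhoH : is_rep t.1.1 rho.
    by split; [case: rhoP | move=> x y /sHG xG /sHG yG; apply: (proj2 rhoP)].
  apply/(centP rhoH) => h hH; have hG := sHG _ hH.
  rewrite rconj_sum (reindex_onto (pidx h^-1%g) (pidx h)) /=; last first.
    by move=> i _; apply: pidxK.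
  apply: eq_big => [i|i /andP[_ _]].
    rewrite pidxVK // eqxx andbT; apply/idP/idP => [|iS].
      by move=> /(stab h _ hH); rewrite pidxVK.
    by apply: stab; rewrite ?groupV.
  by rewrite rconjZ pidxE // pidxVK // cE ?groupV.
rewrite {1}(proj2 XY a) (bigID (fixb G rho X)) /=; congr (_ + _).
rewrite big_map /=.
have -> : \sum_(t <- T) gtr rho t.1.2 (proj t.2) =
   \sum_(t <- T) \sum_i \sum_(j < p)
      \tr (a *m Y i) *: X i *+ (pidx (t.1.2 ^- j)%g i \in t.2).
  rewrite big_seq [RHS]big_seq; apply: eq_bigr => t /T1[_ gG _ _].
  rewrite [RHS]exchange_big /=.
  apply: eq_bigr => j _; have gj : (t.1.2 ^+ j)%g \in G by rewrite groupX.
  rewrite rconj_sum (reindex_onto (pidx (t.1.2 ^- j)%g) (pidx (t.1.2 ^+ j)%g)) /=; last first.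
    by move=> i _; apply: pidxK.
  rewrite big_mkcond; apply: eq_bigr => i _.
  rewrite pidxVK // eqxx andbT mulrb; case: ifP => // _.
  by rewrite rconjZ pidxE // pidxVK // cE ?groupV.
rewrite exchange_big big_mkcond; apply: eq_bigr => i _ /=.
rewrite (eq_bigr (fun t : {group gT} * gT * {set I} => \tr (a *m Y i) *: X i *+
   (\sum_(j < p) (pidx (t.1.2 ^- j)%g i \in t.2))%N)); last by move=> t _; rewrite sumrMnr.
by rewrite sumrMnr T2 inE mulrb; case: ifP.
Qed.

End FixedDecomposition.
End Representations.

Lemma trace_nondeg (k : fieldType) (m : nat) (b : 'M[k]_m) :
  (forall a, \tr (a *m b) = 0) -> b = 0.
Proof.
move=> h; apply/matrixP => i j; have := h (delta_mx j i).
rewrite /mxtrace (bigD1 j) //= big1 ?addr0 => [|x ne].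
  rewrite mxE (bigD1 i) //= big1 => [|y ne]; last by rewrite mxE (negPf ne) andbF mul0r.
  by rewrite !mxE !eqxx mul1r addr0.
by rewrite mxE big1 // => y _; rewrite mxE (negPf ne) mul0r.
Qed.

Lemma mulmx_exprS (R : pzRingType) m (x : 'M[R]_m) n : x *m x ^+ n = x ^+ n.+1.
Proof. by rewrite mulmxE -exprS. Qed.

Lemma mulmx_exprSr (R : pzRingType) m (x : 'M[R]_m) n : x ^+ n *m x = x ^+ n.+1.
Proof. by rewrite mulmxE -exprSr. Qed.

(** * Brauer homomorphisms from nilpotent elements *)

Section Tate.
Variables (p : nat) (k : fieldType) (m : nat).
Implicit Types (xi : 'M[k]_m).

(** The shape that relative traces take in terms of [xi]; in characteristic p it is the (p-1)-fold
    commutator with [xi] ([casimir_admx]). *)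
Definition casimir xi b := \sum_(j < p) xi ^+ j *m b *m xi ^+ (p.-1 - j).

(* The rows of R represent a basis of ker xi / im xi^(p-1), and P computes coordinates. *)
Definition tate_basis xi l (R : 'M[k]_(l, m)) (P : 'M[k]_(m, l)) :=
  [/\ R *m xi = 0, R *m P = 1%:M, xi ^+ p.-1 *m P = 0 &
      forall r (v : 'M[k]_(r, m)), v *m xi = 0 -> (v - v *m P *m R <= xi ^+ p.-1)%MS].

Lemma tate_basis_exists xi : (0 < p)%N -> xi ^+ p = 0 ->
  exists l (R : 'M[k]_(l, m)) P, tate_basis xi R P.
Proof.
move=> p0 xip; pose K := kermx xi; pose J := xi ^+ p.-1.
have JK : (J <= K)%MS by apply/sub_kermxP; rewrite mulmxE -exprSr prednK.
pose C := (K :\: J)%MS.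
have CJ : (C :&: J)%MS = 0 by apply: capmx_diff.
have CK : (C <= K)%MS by apply: diffmxSl.
pose R := row_base C; exists (\rank C), R, (proj_mx C J *m pinvmx R).
have RC : (R <= C)%MS by rewrite eq_row_base.
have freeR : row_free R by apply: row_base_free.
split.
- by apply/sub_kermxP; apply: submx_trans RC CK.
- by apply: (row_free_inj freeR); rewrite /= mulmxA proj_mx_id // mul1mx mulmxKpV.
- by rewrite mulmxA proj_mx_0 // mul0mx.
move=> r v vxi; have vK : (v <= K)%MS by apply/sub_kermxP.
have vCJ : (v <= C + J)%MS.
  apply: submx_trans vK _; rewrite -(addsmx_diff_cap_eq K J).
  by apply: addsmxS => //; apply: capmxSr.
rewrite mulmxA mulmxKpV; last by rewrite eq_row_base proj_mx_sub.
rewrite -{1}(add_proj_mx CJ vCJ) addrC addKr; exact: proj_mx_sub.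
Qed.

End Tate.

Section BrauerMap.
Variables (p : nat) (gT : finGroupType) (k : fieldType) (m : nat).

(* A Brauer homomorphism A^G -> M_l(k). Killing the traces from maximal subgroups suffices,
   by transitivity of the trace; the last clause makes the kernel exactly the trace ideal. *)
Definition brauer_map (G : {group gT}) (rho : gT -> 'M[k]_m) (I : finType)
    (X : I -> 'M[k]_m) l (beta : 'M[k]_m -> 'M[k]_l) :=
  [/\ forall c a b, beta (c *: a + b) = c *: beta a + beta b,
      beta 1%:M = 1%:M,
      forall a b, centmx rho G a -> centmx rho G b -> beta (a *m b) = beta a *m beta b,
      forall (H : {group gT}) g a, maximal H G -> g \in G -> g \notin H -> centmx rho H a ->
        beta (gtr p rho g a) = 0 &
      (forall c : I -> k, \sum_(i | fixb G rho X i) c i *: beta (X i) = 0 ->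
         forall i, fixb G rho X i -> c i = 0) /\
      (forall b, exists c : I -> k, b = \sum_(i | fixb G rho X i) c i *: beta (X i))].

Lemma brauer_map_sum G rho (I : finType) (X : I -> 'M[k]_m) l (beta : 'M[k]_m -> 'M[k]_l)
    (J : Type) (r : seq J) (P : pred J) (c : J -> k) (F : J -> 'M[k]_m) :
  brauer_map G rho X beta ->
  beta (\sum_(j <- r | P j) c j *: F j) = \sum_(j <- r | P j) c j *: beta (F j).
Proof.
case=> lin _ _ _ _.
have b0 : beta 0 = 0.
  have := lin 1 0 0; rewrite scale1r addr0 scale1r => h.
  by apply: (@addrI _ (beta 0)); rewrite -h addr0.
elim: r => [|x r IH]; first by rewrite !big_nil b0.
by rewrite !big_cons; case: (P x); rewrite ?lin IH.
Qed.

Variables (G : {group gT}) (rho : gT -> 'M[k]_m) (I : finType) (X Y : I -> 'M[k]_m).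
Hypotheses (pG : (p.-group G)%g) (rhoP : is_rep G rho)
  (XY : dual_bases X Y) (permX : perm_fam G rho X).

(** Conjugation preserves the trace form, so it permutes the dual basis in the same way as the
    basis. *)
Lemma dual_fixed i : fixb G rho X i -> centmx rho G (Y i).
Proof.
move=> fi; apply/(centP rhoP) => g gG; apply/eqP; rewrite -subr_eq0; apply/eqP.
apply: trace_nondeg => a.
have -> : a = rconj rho g (rconj rho g^-1%g a).
  by rewrite -(rconjM rhoP) ?groupV // mulVg (rconj1 rhoP).
have e : pidx rho X g i = i.
  apply: (dual_bases_inj XY); rewrite -(pidxE permX) //.
  by move/forall_inP: fi => /(_ g gG)/eqP.
have := coord_pidx rhoP XY permX i (rconj rho g^-1%g a) gG; rewrite e => h.
rewrite mulmxBr raddfB /= h -(rconj_mul rhoP) // (tr_rconj rhoP) //.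
by rewrite subrr.
Qed.

Section Step.
Variable xi : 'M[k]_m.
Hypotheses (pk : p \in [pchar k]) (xip : xi ^+ p = 0)
  (xiC : forall a, centmx rho G a -> a *m xi = xi *m a)
  (trC : forall (H : {group gT}) g a, maximal H G -> g \in G -> g \notin H ->
     centmx rho H a -> exists b, gtr p rho g a = casimir p xi b)
  (centC : forall a, a *m xi = xi *m a ->
     exists a0 a1, centmx rho G a0 /\ a = a0 + casimir p xi a1).

Let p_pr : prime p. Proof. by case/andP: pk. Qed.
Let p_gt0 : (0 < p)%N. Proof. exact: prime_gt0. Qed.

Variables (l : nat) (R : 'M[k]_(l, m)) (P : 'M[k]_(m, l)).
Hypothesis RP : tate_basis p xi R P.
Let beta a := R *m a *m P.

(** [R] and [P] identify ker xi / im xi^(p-1) with row vectors; there a matrix commuting with [xi]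
    acts through [beta]. *)
Lemma tate_act r (v : 'M[k]_(r, m)) a : v *m xi = 0 -> a *m xi = xi *m a ->
  v *m a *m P = v *m P *m beta a.
Proof.
case: RP => [Rxi _ JP vR] vxi com.
have /submxP [D e] := vR _ v vxi.
rewrite -{1}[v](subrK (v *m P *m R)) e !mulmxDl -(mulmxA D) -(comm_mxX _ com).
by rewrite (mulmxA D) -(mulmxA (D *m a)) JP mulmx0 add0r /beta !mulmxA.
Qed.

Lemma tate_mul a b : a *m xi = xi *m a -> b *m xi = xi *m b ->
  beta (a *m b) = beta a *m beta b.
Proof.
case: RP => [Rxi _ _ _] ca cb; rewrite /beta mulmxA tate_act //.
by rewrite -mulmxA ca mulmxA Rxi mul0mx.
Qed.

(** On ker xi only the summand j = 0 survives, and its values lie in im xi^(p-1). *)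
Lemma tate_casimir b : beta (casimir p xi b) = 0.
Proof.
case: RP => [Rxi _ JP _]; rewrite /beta /casimir -(prednK p_gt0) /= big_ord_recl /=.
rewrite subn0 expr0 -[1]/(1%:M) mul1mx mulmxDr mulmxDl mulmxA -mulmxA JP mulmx0 add0r.
rewrite mulmx_sumr mulmx_suml big1 // => j _.
by rewrite /bump add1n exprS -[_ * _]/(_ *m _) !mulmxA Rxi !mul0mx.
Qed.

Lemma tr_casimir b : \tr (casimir p xi b) = 0.
Proof.
rewrite raddf_sum /= (eq_bigr (fun=> \tr (xi ^+ p.-1 *m b))) => [|j _].
  by rewrite sumr_const card_ord -mulr_natr pcharf0 ?mulr0.
rewrite mxtrace_mulC mulmxA.
have jp : (j <= p.-1)%N by rewrite -ltnS prednK.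
by rewrite (_ : xi ^+ (p.-1 - j) *m xi ^+ j = xi ^+ p.-1) // mulmxE -exprD subnK.
Qed.

Lemma casimir_mulr a b : b *m xi = xi *m b ->
  casimir p xi a *m b = casimir p xi (a *m b).
Proof.
move=> cb; rewrite mulmx_suml; apply: eq_bigr => j _.
by rewrite -mulmxA -(comm_mxX _ cb) !mulmxA.
Qed.

Lemma cent_of_trace0 a : centmx rho G a ->
  (forall b, centmx rho G b -> \tr (a *m b) = 0) -> beta a = 0.
Proof.
move=> ca h; have [T [T1 ->]] := fixed_decomp pG rhoP XY permX ca.
rewrite big1 => [|i fi]; last by rewrite h ?scale0r //; apply: dual_fixed.
rewrite add0r /beta mulmx_sumr mulmx_suml big_seq big1 // => t /T1[H [mH tG tH ct]].
by have [b ->] := trC mH tG tH ct; apply: tate_casimir.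
Qed.

(** Sums [casimir p xi b] are orthogonal to the centraliser of [xi] and die under [beta]. Modulo
    them [a] lies in A^G, where the coordinates that [beta] can see are traces against the invariant
    [Y i]. *)
Lemma form_nondeg a : a *m xi = xi *m a ->
  (forall b, b *m xi = xi *m b -> \tr (a *m b) = 0) -> beta a = 0.
Proof.
move=> ca h; have [a0 [a1 [ca0 e]]] := centC ca.
rewrite e /beta mulmxDr mulmxDl -/(beta _) -/(beta _) tate_casimir addr0.
apply: cent_of_trace0 => // b cb; have cbx := xiC cb.
have := h b cbx; rewrite e mulmxDl raddfD /= casimir_mulr // tr_casimir addr0.
by [].
Qed.

Lemma pow_sub i j : (i <= j)%N -> (xi ^+ j <= xi ^+ i)%MS.
Proof. by move=> ij; rewrite -(subnK ij) exprD submxMl. Qed.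

(** The difference of the two products telescopes to its extreme terms, which the hypotheses
    kill. *)
Lemma ladder_comm (th : 'M[k]_m) b : th *m xi ^+ b = 0 -> xi ^+ b *m th = 0 ->
  let c := \sum_(i < b) xi ^+ i *m th *m xi ^+ (b.-1 - i) in c *m xi = xi *m c.
Proof.
case: b => [|b] h1 h2 /=; first by rewrite big_ord0 mulmx0 mul0mx.
rewrite mulmx_suml mulmx_sumr big_ord_recl [RHS]big_ord_recr /=.
rewrite subnn subn0 expr0 -[1]/(1%:M) mul1mx mulmx1 mulmxA mulmx_exprS h2.
rewrite -mulmxA mulmx_exprSr h1 add0r addr0.
apply: eq_bigr => i _; rewrite /bump add1n !mulmxA mulmx_exprS.
by rewrite -!mulmxA mulmx_exprSr subnSK.
Qed.

Lemma ladder_ker r (v : 'M[k]_(r, m)) (th : 'M[k]_m) b : v *m xi = 0 ->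
  v *m (\sum_(i < b.+1) xi ^+ i *m th *m xi ^+ (b - i)) = v *m th *m xi ^+ b.
Proof.
move=> vx; rewrite big_ord_recl mulmxDr expr0 -[1]/(1%:M) mul1mx subn0 mulmxA.
by rewrite mulmx_sumr big1 ?addr0 // => i _; rewrite lift0 exprS -mulmxE !mulmxA vx !mul0mx.
Qed.

(** This says that [xi] has no Jordan block of size exactly i + 1. *)
Let L i := (xi ^+ i :&: kermx xi <= xi ^+ i.+1)%MS.

Lemma separate q (A : 'M[k]_(q, m)) (w : 'rV[k]_m) : ~~ (w <= A)%MS ->
  exists f : 'cV[k]_m, A *m f = 0 /\ w *m f = 1%:M.
Proof.
rewrite submxE => /matrix0Pn [i [j nzj]]; rewrite ord1 in nzj.
exists (cokermx A *m (((w *m cokermx A) 0 j)^-1 *: delta_mx j 0)).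
set q0 := _ *: _; rewrite (mulmxA A) (mulmxA w) mulmx_coker mul0mx; split=> //; rewrite /q0.
rewrite -scalemxAr -colE; apply/matrixP => x y; rewrite !ord1.
by rewrite mxE [X in _ * X]mxE mulVf // mxE.
Qed.

(** Given blocks of sizes i + 1 and j + 1, a ladder map [c] sends the socle vector [w'] of the
    shorter to the socle vector [w] of the longer. Composed with any element of the centraliser, [c]
    raises or kills every layer, so all traces vanish and [form_nondeg] gives [beta c = 0]. Then [w]
    would lie in im xi^(p-1), which it does not. *)
Lemma one_layer i j : (i < j)%N -> (j.+1 < p)%N -> L i || L j.
Proof.
move=> ij jp; apply: contraT; rewrite negb_or => /andP[nLi nLj].
have /row_subPn [i' ni'] := nLi; have /row_subPn [j' nj'] := nLj.
set w' := row i' _ in ni'; set w := row j' _ in nj'.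
have : (w' <= xi ^+ i :&: kermx xi)%MS by apply: row_sub.
rewrite sub_capmx => /andP[w'i /sub_kermxP w'K].
have : (w <= xi ^+ j :&: kermx xi)%MS by apply: row_sub.
rewrite sub_capmx => /andP[/submxP[w0 ew] /sub_kermxP wK].
have [f [xf w'f]] : exists f : 'cV[k]_m, xi ^+ j *m f = 0 /\ w' *m f = 1%:M.
  by apply: separate; apply: contra ni' => h; apply: submx_trans h (pow_sub ij).
pose c := \sum_(i < j.+1) xi ^+ i *m (f *m w0) *m xi ^+ (j - i).
have cc : c *m xi = xi *m c.
  apply: (@ladder_comm (f *m w0) j.+1); first by rewrite -mulmxA -mulmx_exprSr (mulmxA w0) -ew wK mulmx0.
  by rewrite -mulmx_exprS mulmxA -(mulmxA xi) xf mulmx0 mul0mx.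
have vc r (v : 'M[k]_(r, m)) : v *m xi = 0 -> v *m c = v *m f *m w.
  by move=> vx; rewrite /c ladder_ker // !mulmxA -mulmxA -ew.
have bc : beta c = 0.
  apply: form_nondeg => // d cd; apply: (trace_layers_zero pk xip).
    by rewrite -mulmxA cd mulmxA cc mulmxA.
  move=> t tp; set U := (_ :&: _)%MS.
  have /sub_kermxP UK : (U <= kermx xi)%MS by apply: capmxSr.
  rewrite mulmxA vc //; have [tj|jt] := ltnP t j.
    rewrite -mulmxA ew -!mulmxA -(comm_mxX _ cd) !mulmxA.
    exact: submx_trans (submxMl _ _) (pow_sub tj).
  have /submxP [V ->] : (U <= xi ^+ j)%MS by apply: submx_trans (capmxSl _ _) (pow_sub jt).
  by rewrite -(mulmxA V) xf mulmx0 !mul0mx sub0mx.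
case: RP => [_ _ _ vR].
have := tate_act w'K cc; rewrite vc // w'f mul1mx bc mulmx0 => wP.
have := vR _ w wK; rewrite wP mul0mx subr0 => wJ.
case/negP: nj'; apply: submx_trans wJ (pow_sub _).
by rewrite -ltnS prednK.
Qed.

(** By [one_layer] the blocks shorter than p share one size j + 1. Their socle vectors are divisible
    by xi^j, and no non-trivial combination is divisible by xi^(j+1); so [M] lifts to a ladder map
    built from [W0], which divides [R] by xi^j, and from [B0], which inverts [R] modulo xi^(j+1).
    Without such blocks the quotient is zero. *)
Lemma tate_onto M : exists2 a, a *m xi = xi *m a & beta a = M.
Proof.
case: (RP) => [Rxi RP1 JP vR].
have [/existsP [j0 /andP[j0p nL]]|] := boolP [exists j : 'I_p, (j.+1 < p)%N && ~~ L j]; last first.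
  rewrite negb_exists => /forallP aL.
  have KJ i : (i < p)%N -> (kermx xi <= xi ^+ i)%MS.
    elim: i => [|i IH] ip; first by rewrite expr0 submx1.
    have := aL (Ordinal (ltnW ip)); rewrite /= ip /= negbK; apply: submx_trans.
    by rewrite sub_capmx IH ?(ltnW ip) /=.
  exists 0; first by rewrite mulmx0 mul0mx.
  have /submxP [D eD] : (R <= xi ^+ p.-1)%MS.
    apply: submx_trans (KJ _ _); first by apply/sub_kermxP.
    by rewrite prednK.
  have e1 : 1%:M = 0 :> 'M[k]_l by rewrite -RP1 eD -mulmxA JP mulmx0.
  by rewrite -[M]mul1mx e1 mul0mx /beta mulmx0 mul0mx.
have exL : exists j, (j.+1 < p)%N && ~~ L j by exists j0; rewrite j0p.
case: (ex_minnP exL) => j /andP[jp nLj] jmin.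
have Kj i : (i <= j)%N -> (kermx xi <= xi ^+ i)%MS.
  elim: i => [|i IH] ij; first by rewrite expr0 submx1.
  have : L i.
    apply: contraT => nLi; have ip : (i.+1 < p)%N by apply: leq_ltn_trans jp; apply: ltnW.
    by have := jmin i; rewrite ip nLi => /(_ isT); rewrite leqNgt ij.
  by apply: submx_trans; rewrite sub_capmx IH ?(ltnW ij) /=.
have Kj' i : (j < i < p)%N -> (kermx xi :&: xi ^+ j.+1 <= xi ^+ i)%MS.
  elim: i => [|i IH] // /andP[]; rewrite ltnS leq_eqVlt => /orP[/eqP <- _|ji ip].
    exact: capmxSr.
  have := one_layer ji ip; rewrite (negPf nLj) /=; apply: submx_trans.
  by rewrite sub_capmx IH ?ji ?(ltnW ip) //= capmxSl.
have RK : (R <= kermx xi)%MS by apply/sub_kermxP.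
have [W0 eW] := submxP (submx_trans RK (Kj j (leqnn j))).
have [B eB] : exists B, R *m cokermx (xi ^+ j.+1) *m B = 1%:M.
  apply/row_freeP; rewrite -kermx_eq0; apply/rowV0P => D /sub_kermxP.
  rewrite mulmxA => /eqP; rewrite -submxE => DR.
  have : (D *m R <= xi ^+ p.-1)%MS.
    apply: submx_trans (Kj' p.-1 _); last by rewrite -ltnS prednK // jp leqnn.
    by rewrite sub_capmx DR andbT; apply: submx_trans RK; apply: submxMl.
  by case/submxP => V eV; rewrite -[D]mulmx1 -RP1 mulmxA eV -mulmxA JP mulmx0.
have [B0 [xB0 RB0]] : exists B0, xi ^+ j.+1 *m B0 = 0 /\ R *m B0 = 1%:M.
  by exists (cokermx (xi ^+ j.+1) *m B); rewrite (mulmxA R) (mulmxA (xi ^+ _)) mulmx_coker mul0mx.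
pose c := \sum_(i < j.+1) xi ^+ i *m (B0 *m M *m W0) *m xi ^+ (j - i).
exists c.
  apply: (@ladder_comm _ j.+1); last by rewrite !mulmxA xB0 !mul0mx.
  by rewrite -mulmxA -mulmx_exprSr (mulmxA W0) -eW Rxi mulmx0.
rewrite /beta ladder_ker // !mulmxA -(mulmxA _ W0) -eW RB0 mul1mx.
by rewrite -mulmxA RP1 mulmx1.
Qed.

Lemma step_brauer_map : brauer_map G rho X beta.
Proof.
case: (RP) => [Rxi RP1 JP vR].
split.
- by move=> c a b; rewrite /beta mulmxDr mulmxDl -scalemxAr -scalemxAl.
- by rewrite /beta mulmx1.
- by move=> a b ca cb; apply: tate_mul; apply: xiC.
- by move=> H g a mH gG gH ca; have [b ->] := trC mH gG gH ca; apply: tate_casimir.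
split=> [c e i fi|M].
  pose a := \sum_(i | fixb G rho X i) c i *: X i.
  have ca : centmx rho G a.
    apply: cent_sum => j fj; apply: centZ; apply/(centP rhoP) => g gG.
    by move/forall_inP: fj => /(_ g gG)/eqP.
  have ba : beta a = 0.
    rewrite -[RHS]e /beta mulmx_sumr mulmx_suml; apply: eq_bigr => j _.
    by rewrite -scalemxAr -scalemxAl.
  have tra : \tr (a *m Y i) = c i.
    rewrite mulmx_suml raddf_sum (bigD1 i) //= -scalemxAl mxtraceZ (proj1 XY) eqxx mulr1.
    rewrite big1 ?addr0 // => j /andP[_ ne].
    by rewrite -scalemxAl mxtraceZ (proj1 XY) (negPf ne) mulr0.
  (* [beta a = 0] means that [a] maps ker xi into im xi^(p-1). It therefore raises every layer, and
     the trace that reads off [c i] vanishes. *)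
  rewrite -tra; apply: (trace_layers_zero pk xip).
    by apply: xiC; apply: centM => //; apply: dual_fixed.
  have cax := xiC ca; have cYx := xiC (dual_fixed fi).
  move=> t tp; set U := (_ :&: _)%MS.
  have /sub_kermxP UK : (U <= kermx xi)%MS by apply: capmxSr.
  have Uaxi : U *m a *m xi = 0 by rewrite -mulmxA cax mulmxA UK mul0mx.
  have := vR _ _ Uaxi; rewrite tate_act // ba mulmx0 mul0mx subr0 => /submxP[V eV].
  rewrite mulmxA eV -mulmxA -(comm_mxX _ cYx) mulmxA.
  by apply: submx_trans (submxMl _ _) (pow_sub _); rewrite -ltnS prednK.
have [a ca <-] := tate_onto M; have [a0 [a1 [ca0 ->]]] := centC ca.
exists (fun i => \tr (a0 *m Y i)).
rewrite /beta mulmxDr mulmxDl -/(beta _) -/(beta _) tate_casimir addr0.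
have [T [T1 {1}->]] := fixed_decomp pG rhoP XY permX ca0.
rewrite /beta mulmxDr mulmxDl !mulmx_sumr !mulmx_suml.
rewrite [X in _ + X]big_seq [X in _ + X]big1 ?addr0 => [|t /T1[H [mH tG tH ct]]].
  by apply: eq_bigr => i _; rewrite -scalemxAr -scalemxAl.
by have [b ->] := trC mH tG tH ct; apply: tate_casimir.
Qed.

End Step.
End BrauerMap.

(** * p-th powers of commuting sums and iterated commutators *)

Section FrobeniusComm.
Variables (R : pzRingType) (p : nat).
Hypotheses (p_pr : prime p) (pR : p%:R = 0 :> R).

Lemma exprDp_comm (x y : R) : GRing.comm x y -> (x + y) ^+ p = x ^+ p + y ^+ p.
Proof.
move=> xy; rewrite exprDn_comm //.
case: p p_pr pR => // q q_pr qR; rewrite big_ord_recl big_ord_recr /=.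
rewrite bin0 binn !mulr1n subn0 subnn !expr0 mulr1 mul1r big1 ?add0r // => i _.
rewrite /bump /= add1n -mulr_natr.
have /dvdnP [c ->] : (q.+1 %| 'C(q.+1, i.+1))%N by rewrite prime_dvd_bin //= ltnS.
by rewrite natrM qR !mulr0.
Qed.

Lemma expr_sump_comm (I : Type) (r : seq I) (F : I -> R) :
  (forall i j, GRing.comm (F i) (F j)) ->
  (\sum_(i <- r) F i) ^+ p = \sum_(i <- r) F i ^+ p.
Proof.
move=> cF; elim: r => [|i r IH]; first by rewrite !big_nil expr0n eqn0Ngt prime_gt0.
rewrite !big_cons exprDp_comm ?IH //.
by apply: commr_sum => j _; apply: cF.
Qed.

End FrobeniusComm.

Lemma signed_bin (R : pzRingType) p i : prime p -> p%:R = 0 :> R -> (i < p)%N ->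
  (-1) ^+ i * 'C(p.-1, i)%:R = 1 :> R.
Proof.
move=> p_pr pR; elim: i => [|i IH] ip; first by rewrite bin0 mulr1.
have /dvdnP [c e] : (p %| 'C(p, i.+1))%N by rewrite prime_dvd_bin.
have : 'C(p.-1, i.+1)%:R = - 'C(p.-1, i)%:R :> R.
  apply/eqP; rewrite -addr_eq0 -natrD -binS prednK ?prime_gt0 // e natrM pR mulr0.
  by [].
by move=> ->; rewrite exprS mulN1r mulrN mulNr opprK IH // ltnW.
Qed.

Definition admx (k : pzRingType) m (x b : 'M[k]_m) := x *m b - b *m x.

Section Casimir.
Variables (p : nat) (k : fieldType) (m : nat).
Hypothesis pk : p \in [pchar k].
Let p_pr : prime p. Proof. by case/andP: pk. Qed.

Lemma iter_admx (x b : 'M[k]_m) n : iter n (admx x) b =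
  \sum_(i < n.+1) ((-1) ^+ i * 'C(n, i)%:R) *: (x ^+ (n - i) *m b *m x ^+ i).
Proof.
elim: n => [|n IH].
  by rewrite big_ord1 /= bin0 mulr1 scale1r subn0 expr0 -[1]/(1%:M) mul1mx mulmx1.
rewrite iterS IH /admx mulmx_sumr mulmx_suml.
rewrite [X in X - _]big_ord_recl [X in _ - X]big_ord_recr [RHS]big_ord_recl [in RHS]big_ord_recr /=.
rewrite !bin0 !binn !subnn !subn0 !expr0 !mulr1 !scale1r -[1]/(1%:M) !mul1mx !mulmx1.
rewrite -addrA; congr (_ + _); first by rewrite mulmxA mulmx_exprS.
rewrite opprD addrA; congr (_ + _); last first.
  by rewrite /bump /= add1n -scalemxAl -mulmxA mulmx_exprSr [(-1) ^+ n.+1]exprS mulN1r scaleNr.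
rewrite -sumrB; apply: eq_bigr => i _.
rewrite /bump /= !add1n binS natrD mulrDr scalerDl.
rewrite -scalemxAr -scalemxAl !mulmxA mulmx_exprS -!mulmxA mulmx_exprSr.
rewrite subSS subnSK //; congr (_ + _).
by rewrite [(-1) ^+ i.+1]exprS mulN1r mulNr scaleNr.
Qed.

(** The signed binomial coefficients of the iterated commutator are all 1 modulo p. *)
Lemma casimir_admx (x b : 'M[k]_m) : casimir p x b = iter p.-1 (admx x) b.
Proof.
rewrite iter_admx /casimir prednK ?prime_gt0 //.
rewrite (reindex_inj rev_ord_inj) /=; apply: eq_bigr => i _.
rewrite signed_bin ?(pcharf0 pk) // scale1r; congr (_ ^+ _ *m _ *m _ ^+ _).
  by rewrite -{1}(prednK (prime_gt0 p_pr)) subSS.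
by rewrite -{2}(prednK (prime_gt0 p_pr)) subSS subKn // -ltnS prednK ?prime_gt0.
Qed.

(** Only commutators enter, so a unipotent element may be replaced by its nilpotent part. *)
Lemma casimir_sub1 (x b : 'M[k]_m) : casimir p (x - 1%:M) b = casimir p x b.
Proof.
rewrite !casimir_admx; apply: eq_iter => c.
by rewrite /admx mulmxBl mulmxBr mul1mx mulmx1 opprB addrA addrNK.
Qed.

End Casimir.

Section GroupTrace.
Variables (p : nat) (gT : finGroupType) (k : fieldType) (m : nat).
Variables (G : {group gT}) (rho : gT -> 'M[k]_m).
Hypotheses (pG : (p.-group G)%g) (rhoP : is_rep G rho).

Lemma gtr_rcosets (H : {group gT}) g a : maximal H G -> g \in G -> g \notin H ->
  centmx rho H a ->
  gtr p rho g a = \sum_(C in rcosets H G) rconj rho (repr C) a.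
Proof.
move=> mH gG gH ca; have [p_pr nHG ordg cosg] := maximal_coset pG mH gG gH.
have sHG := subsetP (normal_sub nHG).
have -> : rcosets H G = [set (H :* (g ^+ j))%g | j : 'I_p].
  apply/setP => C; apply/rcosetsP/imsetP => [[x xG ->]|[j _ ->]]; last by exists (g ^+ j)%g; rewrite ?groupX.
  have [j jp xj] := cosg x xG; exists (Ordinal jp) => //=; apply/rcoset_eqP.
  by rewrite mem_rcoset.
rewrite big_imset /=; last first.
  move=> i j _ _ e.
  have := rcoset_refl H (g ^+ i)%g; rewrite e mem_rcoset => ij.
  have := rcoset_refl H (g ^+ j)%g; rewrite -e mem_rcoset => ji.
  wlog le : i j {e} ij ji / (i <= j)%N.
    by move=> W; case/orP: (leq_total i j) => le; [apply: W | apply/esym; apply: W].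
  move: ji; rewrite -{1}(subnK le) expgD mulgK ordg => dv; apply: val_inj => /=.
  apply/eqP; rewrite eqn_leq le /= -subn_eq0; move: dv.
  have : (j - i < p)%N by apply: leq_ltn_trans (ltn_ord j); apply: leq_subr.
  by case: (posnP (j - i)%N) => [->//|/dvdn_leq h lt /h]; rewrite leqNgt lt.
apply: eq_bigr => j _.
have := mem_repr_rcoset H (g ^+ j)%g => /rcosetP [h hH ->].
have hG := sHG _ hH; have gjG : (g ^+ j)%g \in G by rewrite groupX.
have ha : rconj rho h a = a by apply/(rconj_fix rhoP) => //; apply: ca.
by rewrite (rconjM rhoP) // ha.
Qed.

Lemma gtr_indep (H : {group gT}) g g' a : maximal H G ->
  g \in G -> g \notin H -> g' \in G -> g' \notin H -> centmx rho H a ->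
  gtr p rho g a = gtr p rho g' a.
Proof. by move=> *; rewrite !(@gtr_rcosets H). Qed.

End GroupTrace.

Lemma dual_exists (k : fieldType) (l : nat) (I : finType) (X : I -> 'M[k]_l) :
  (forall c : I -> k, \sum_i c i *: X i = 0 -> forall i, c i = 0) ->
  (forall b, exists c : I -> k, b = \sum_i c i *: X i) ->
  exists Y, dual_bases X Y.
Proof.
move=> indep span.
have [c cP] := fin_all_exists (fun ab : 'I_l * 'I_l => span (delta_mx ab.1 ab.2)).
(* [Y j] represents the j-th coordinate functional under the trace form. *)
pose Y j := \matrix_(b, a) c (a, b) j; exists Y.
have E (a : 'M[k]_l) : a = \sum_i \tr (a *m Y i) *: X i.
  rewrite {1}(matrix_sum_delta a) pair_bigA /=.
  rewrite (eq_bigr (fun i => \sum_(ab : 'I_l * 'I_l) (a ab.1 ab.2 * c ab i) *: X i)) => [|i _]; last first.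
    rewrite -scaler_suml; congr (_ *: _); rewrite /mxtrace (eq_bigr (fun x => \sum_y a x y * c (x, y) i)).
      by rewrite pair_bigA /=; apply: eq_bigr => -[x y].
    by move=> x _; rewrite mxE; apply: eq_bigr => y _; rewrite mxE.
  rewrite exchange_big; apply: eq_bigr => ab _; rewrite {1}cP scaler_sumr.
  by apply: eq_bigr => i _; rewrite scalerA.
split=> // i j; apply/eqP; rewrite -subr_eq0; apply/eqP.
apply: (indep (fun j => \tr (X i *m Y j) - (i == j)%:R)).
under eq_bigr do rewrite scalerBl.
rewrite sumrB -E (bigD1 i) //= eqxx scale1r big1 ?addr0 ?subrr // => x ne.
by rewrite eq_sym (negPf ne) scale0r.
Qed.

(** * Transitivity of the Brauer construction *)

Section Compose.
Variables (p : nat) (gT : finGroupType) (k : fieldType) (m : nat).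
Variables (G Z : {group gT}) (rho : gT -> 'M[k]_m) (I : finType) (X Y : I -> 'M[k]_m).
Hypotheses (pG : (p.-group G)%g) (rhoP : is_rep G rho)
  (XY : dual_bases X Y) (permX : perm_fam G rho X) (ZG : Z \subset G)
  (ZC : forall g, g \in G -> centmx rho Z (rho g)).
Variables (l : nat) (beta1 : 'M[k]_m -> 'M[k]_l).
Hypothesis b1P : brauer_map p Z rho X beta1.

Definition rho1 g := beta1 (rho g).
Definition X1 (i : {i | fixb Z rho X i}) := beta1 (X (val i)).

Lemma rep_sub : is_rep Z rho.
Proof. by split; [case: rhoP | move=> x y xZ yZ; apply: (proj2 rhoP); apply: (subsetP ZG)]. Qed.

Lemma beta1_0 : beta1 0 = 0.
Proof.
case: b1P => lin _ _ _ _; have := lin 1 0 0; rewrite scale1r addr0 scale1r => h.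
by apply: (@addrI _ (beta1 0)); rewrite -h addr0.
Qed.

Lemma beta1D a b : beta1 (a + b) = beta1 a + beta1 b.
Proof. by case: b1P => lin _ _ _ _; have := lin 1 a b; rewrite !scale1r. Qed.

Lemma beta1_sum (J : Type) (r : seq J) (P : pred J) (F : J -> 'M[k]_m) :
  beta1 (\sum_(j <- r | P j) F j) = \sum_(j <- r | P j) beta1 (F j).
Proof. by elim/big_rec2: _ => [|j x y _ <-]; rewrite ?beta1_0 ?beta1D. Qed.

Lemma fixb_cent i : fixb Z rho X i -> centmx rho Z (X i).
Proof.
move=> /forall_inP fi; apply/(centP rep_sub) => g gZ.
by have /eqP := fi _ gZ.
Qed.

Lemma cent_rconj g a : g \in G -> centmx rho Z a -> centmx rho Z (rconj rho g a).
Proof. by move=> gG ca; apply: centM; [apply: centM => // |]; apply: ZC; rewrite ?groupV. Qed.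

Lemma is_rep1 : is_rep G rho1.
Proof.
case: b1P => _ b1 bM _ _; split; first by rewrite /rho1 (proj1 rhoP).
by move=> x y xG yG; rewrite /rho1 (proj2 rhoP) // bM //; apply: ZC.
Qed.

Lemma rconj1E g a : g \in G -> centmx rho Z a ->
  rconj rho1 g (beta1 a) = beta1 (rconj rho g a).
Proof.
case: b1P => _ _ bM _ _ gG ca.
have gVG : (g^-1)%g \in G by rewrite groupV.
have cg := ZC gG; have cgV := ZC gVG.
by rewrite /rconj /rho1 !bM //; apply: centM.
Qed.

Lemma fixb_rconj g i j : g \in G -> rconj rho g (X i) = X j ->
  fixb Z rho X i -> fixb Z rho X j.
Proof.
move=> gG e fi; apply/forall_inP => z zZ; rewrite -e.
by have /(centP rep_sub) -> := cent_rconj gG (fixb_cent fi).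
Qed.

Lemma perm_fam1 : perm_fam G rho1 X1.
Proof.
move=> g [i fi] gG; have [j e] := permX i gG.
exists (Sub j (fixb_rconj gG e fi)).
by rewrite /X1 /= rconj1E ?e //; apply: fixb_cent.
Qed.

Lemma beta1_inj : {in fixb Z rho X &, forall i j, beta1 (X i) = beta1 (X j) -> i = j}.
Proof.
case: b1P => _ _ _ _ [indep _] i j fi fj e; apply/eqP; apply: contraT => ne.
have : \sum_(x | fixb Z rho X x) ((x == i)%:R - (x == j)%:R) *: beta1 (X x) = 0.
  under eq_bigr do rewrite scalerBl.
  rewrite sumrB (bigD1 i) //= eqxx scale1r [X in _ - X](bigD1 j) //= eqxx scale1r.
  rewrite big1 => [|x /andP[_ /negPf->]]; last by rewrite scale0r.
  rewrite big1 => [|x /andP[_ /negPf->]]; last by rewrite scale0r.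
  by rewrite e subrr.
move/indep => /(_ i fi); rewrite eqxx (negPf ne) subr0 => /eqP.
by rewrite oner_eq0.
Qed.

Lemma fixb1 (i : {i | fixb Z rho X i}) : fixb G rho1 X1 i = fixb G rho X (val i).
Proof.
case: i => i fi; apply: eq_forallb => g /=; case gG: (g \in G) => //=.
have [j e] := permX i gG; have fj := fixb_rconj gG e fi.
rewrite /X1 /= rconj1E ?e //; last exact: fixb_cent.
apply/eqP/eqP => [h|->//]; by rewrite (beta1_inj fj fi h).
Qed.

Lemma fixb_sub i : fixb G rho X i -> fixb Z rho X i.
Proof.
by move=> /forall_inP h; apply/forall_inP => z zZ; apply: h; apply: (subsetP ZG).
Qed.

Lemma sum_fixb1 (c : I -> k) (F : I -> 'M[k]_m) n (f : 'M[k]_m -> 'M[k]_n) :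
  \sum_(i | fixb G rho X i) c i *: f (F i) =
  \sum_(i | fixb G rho1 X1 i) c (val i) *: f (F (val i)).
Proof.
rewrite (eq_bigl (fun i => (i \in fixb Z rho X) && fixb G rho X i)) => [|i].
  by rewrite big_sub_cond; apply: eq_bigl => i; rewrite fixb1.
by apply/idP/andP => [fi|[]//]; split=> //; apply: fixb_sub.
Qed.

Lemma sum_fixZ (c : I -> k) :
  \sum_(i | fixb Z rho X i) c i *: beta1 (X i) = \sum_i c (val i) *: X1 i.
Proof. by rewrite (big_sub (fixb Z rho X)). Qed.

Lemma ext_sub (c : {i | fixb Z rho X i} -> k) :
  exists c' : I -> k, forall i, c' (val i) = c i.
Proof.
exists (fun i => if insub i is Some j then c j else 0) => i.
by rewrite valK.
Qed.

Lemma dual_bases1 : exists Y1, dual_bases X1 Y1.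
Proof.
case: b1P => _ _ _ _ [indep span]; apply: dual_exists => [c h i|b].
  have [c' c'E] := ext_sub c; rewrite -c'E; apply: indep (valP i).
  by rewrite sum_fixZ -[RHS]h; apply: eq_bigr => j _; rewrite c'E.
by have [c ->] := span b; rewrite sum_fixZ; exists (fun i => c (val i)).
Qed.

(** The images of the Z-fixed basis elements span the quotient, so [rho1 z] is central, hence a
    scalar; a scalar with p-th power 1 in characteristic p is 1. This shrinks the acting group at
    every step of the descent. *)
Lemma rho1_trivial z : p \in [pchar k] -> z \in Z -> rho z ^+ p = 1 -> rho1 z = 1%:M.
Proof.
move=> pk zZ zp; case: (b1P) => _ b1 bM _ [_ span].
have cz : centmx rho Z (rho z) by apply: ZC; apply: (subsetP ZG).
have com M : rho1 z *m M = M *m rho1 z.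
  have [c ->] := span M; rewrite mulmx_sumr mulmx_suml; apply: eq_bigr => i fi.
  rewrite -scalemxAr -scalemxAl /rho1 -!bM //; try exact: fixb_cent.
  by rewrite (fixb_cent fi zZ).
have [la e] : exists la, rho1 z = la%:M.
  case: (posnP l) => [l0|l0].
    by exists 0; apply/matrixP => i; have := ltn_ord i; rewrite {2}l0.
  pose i0 := Ordinal l0; exists (rho1 z i0 i0).
  have E i j : (rho1 z *m delta_mx i j) i j = (delta_mx i j *m rho1 z) i j by rewrite com.
  have colE' i j x y : (rho1 z *m delta_mx i j) x y = rho1 z x i * (y == j)%:R.
    rewrite mxE (bigD1 i) //= big1 ?addr0 => [|u /negPf ne]; last by rewrite mxE ne mulr0.
    by rewrite mxE eqxx.
  have rowE' i j x y : (delta_mx i j *m rho1 z) x y = (x == i)%:R * rho1 z j y.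
    rewrite mxE (bigD1 j) //= big1 ?addr0 => [|u /negPf ne]; last by rewrite mxE ne andbF mul0r.
    by rewrite mxE eqxx andbT.
  have F i j x y : rho1 z x i * (y == j)%:R = (x == i)%:R * rho1 z j y.
    by rewrite -colE' -rowE' com.
  apply/matrixP => x y; rewrite mxE; have := F y i0 x i0; rewrite eqxx mulr1 => ->.
  by rewrite mulr_natl.
have rp : rho1 z ^+ p = 1.
  have zG : z \in G by apply: (subsetP ZG).
  rewrite -(repX is_rep1) // /rho1 (repX rhoP) // zp; exact: b1.
move: rp; rewrite e -[la%:M]/(scalar_mx la).
case: (posnP l) => [l0 _|l0].
  by apply/matrixP => i; have := ltn_ord i; rewrite {2}l0.
have pw n : (la%:M : 'M[k]_l) ^+ n = (la ^+ n)%:M.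
  by elim: n => [|n IH]; rewrite ?expr0 // !exprS IH -mulmxE -scalar_mxM.
rewrite pw => /matrixP /(_ (Ordinal l0) (Ordinal l0)); rewrite !mxE eqxx !mulr1n => lap.
have : (la - 1) ^+ p = 0.
  have p_pr : prime p by case/andP: pk.
  have := @exprDp_comm k p p_pr (pcharf0 pk) (la - 1) 1 (commr1 _).
  rewrite subrK lap expr1n => /eqP; rewrite eq_sym -subr_eq0 addrK => /eqP->.
  by [].
by move/eqP; rewrite expf_eq0 subr_eq0 => /andP[_ /eqP->].
Qed.

Lemma maximal_cap (M : {group gT}) : maximal M G -> ~~ (Z \subset M) ->
  maximal (Z :&: M) Z.
Proof.
move=> mM /subsetPn [g gZ gM]; have gG := subsetP ZG _ gZ.
have [p_pr nMG ordg cosg] := maximal_coset pG mM gG gM.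
apply: p_index_maximal; first exact: subsetIl.
have -> : #|Z : Z :&: M|%g = #|G : M|%g.
  rewrite indexgI /indexg; suff -> : rcosets M Z = rcosets M G by [].
  apply/setP => C; apply/rcosetsP/rcosetsP => -[x xG ->].
    by exists x => //; apply: (subsetP ZG).
  have [j jp xj] := cosg x xG; exists (g ^+ j)%g; first by rewrite groupX.
  by apply/rcoset_eqP; rewrite mem_rcoset.
by rewrite (p_maximal_index pG mM).
Qed.

Lemma compose_brauer_map l2 (beta2 : 'M[k]_l -> 'M[k]_l2) :
  brauer_map p G rho1 X1 beta2 -> brauer_map p G rho X (beta2 \o beta1).
Proof.
case=> lin2 one2 mul2 tr2 [ind2 span2]; case: (b1P) => lin1 one1 mul1 tr1 [ind1 span1].
have cG (H : {set gT}) a : H \subset G -> centmx rho Z a -> centmx rho H a -> centmx rho1 H (beta1 a).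
  move=> sH cZ ca h hH; have hG := subsetP sH _ hH.
  by rewrite /rho1 -!mul1 ?ca //; apply: ZC.
split.
- by move=> c a b /=; rewrite lin1 lin2.
- by rewrite /= one1 one2.
- move=> a b ca cb /=.
  have ca' := cent_sub ZG ca; have cb' := cent_sub ZG cb.
  by rewrite mul1 // mul2 //; apply: cG.
- move=> M g a mM gG gM ca /=.
  have nMG := p_maximal_normal pG mM; have sMG := normal_sub nMG.
  (* If Z lies in M, the trace from M commutes with [beta1] and dies under [beta2]. Otherwise coset
     representatives can be taken in Z, so it is a trace from [Z :&: M] and already dies under
     [beta1]. *)
  have [ZM|nZM] := boolP (Z \subset M).
    have ca' := cent_sub ZM ca.
    have -> : beta1 (gtr p rho g a) = gtr p rho1 g (beta1 a).
      rewrite /gtr beta1_sum; apply: eq_bigr => j _.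
      by rewrite rconj1E ?groupX.
    exact: (tr2 M _ _ mM gG gM (cG _ _ sMG ca' ca)).
  have /subsetPn [z zZ zM] := nZM; have zG := subsetP ZG _ zZ.
  rewrite (gtr_indep pG rhoP mM gG gM zG zM ca).
  rewrite (tr1 (Z :&: M)%G z a) //.
  + have := lin2 1 0 0; rewrite scale1r addr0 scale1r => h.
    by apply: (@addrI _ (beta2 0)); rewrite -h addr0.
  + exact: maximal_cap.
  + by rewrite inE negb_and zM orbT.
  + by apply: cent_sub ca; apply: subsetIr.
split=> [c|b].
  rewrite (sum_fixb1 c X (beta2 \o beta1)) => h i fi.
  have := ind2 (fun i => c (val i)) h (Sub i (fixb_sub fi)).
  by rewrite fixb1 /= => /(_ fi).
have [c ->] := span2 b; have [c' c'E] := ext_sub c; exists c'.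
by rewrite (sum_fixb1 c' X (beta2 \o beta1)); apply: eq_bigr => i _; rewrite c'E.
Qed.

End Compose.

(** * Brauer homomorphisms by descent along central elements *)

Section Chain.
Variables (p : nat) (gT : finGroupType) (k : fieldType).
Hypothesis pk : p \in [pchar k].
Let p_pr : prime p. Proof. by case/andP: pk. Qed.

Definition rep_ker (G : {group gT}) m (rho : gT -> 'M[k]_m) := [set g in G | rho g == 1%:M].

(** The element is lifted from one of order p in the centre of the p-group G / ker rho. *)
Lemma central_elt (G : {group gT}) m (rho : gT -> 'M[k]_m) :
  (p.-group G)%g -> is_rep G rho -> rep_ker G rho != G ->
  exists z, [/\ z \in G, rho z != 1%:M, rho z ^+ p = 1 &
     forall g, g \in G -> rho g *m rho z = rho z *m rho g].
Proof.
move=> pG rhoP KG; pose K0 := rep_ker G rho.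
have KP g : (g \in K0) = (g \in G) && (rho g == 1%:M) by rewrite inE.
have gK : group_set K0.
  apply/group_setP; split=> [|x y]; first by rewrite KP group1 (proj1 rhoP) /=.
  rewrite !KP => /andP[xG /eqP x1] /andP[yG /eqP y1].
  by rewrite groupM //= (proj2 rhoP) // x1 y1 mul1mx.
pose K := Group gK.
have sKG : K \subset G by apply/subsetP => x; rewrite KP => /andP[].
have nKG : (K <| G)%g.
  rewrite /normal sKG; apply/subsetP => x xG; rewrite inE.
  apply/subsetP => t /imsetP [y yK ->]; move: yK; rewrite /= KP => /andP[yG /eqP y1].
  rewrite KP groupJ //= /conjg !(proj2 rhoP) ?groupM ?groupV // y1 mul1mx.
  by rewrite (repV rhoP).
have GK1 : (G / K)%g != 1%g.
  apply: contra KG => /eqP e; rewrite eqEsubset sKG /= -(quotient_sub1 (normal_norm nKG)).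
  by rewrite e.
have pQ : (p.-group (G / K))%g by apply: quotient_pgroup.
have Z1 : 'Z(G / K)%g != 1%g by rewrite center_nil_eq1 // (pgroup_nil pQ).
have pZ : (p.-group ('Z(G / K)))%g by apply: pgroupS pQ; apply: center_sub.
have [_ dvp _] := pgroup_pdiv pZ Z1.
have [x xZ ox] := Cauchy p_pr dvp.
have /centerP [xQ xC] := xZ.
have [z zN zG ex] := morphimP xQ.
have mem g : g \in G -> g \in 'N(K)%g := fun gG => subsetP (normal_norm nKG) _ gG.
exists z; split=> //.
- apply/eqP => z1; have zK : z \in K by rewrite KP zG z1 eqxx.
  have : #[x]%g = 1%N by rewrite ex /= coset_id // order1.
  by rewrite ox => p1; move: p_pr; rewrite p1.
- have : (z ^+ p)%g \in K.
    apply: coset_idr; first by rewrite groupX.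
    by rewrite morphX //= -[coset K z]ex -ox expg_order.
  by rewrite KP => /andP[_ /eqP]; rewrite (repX rhoP).
move=> g gG; have gQ : coset K g \in (G / K)%g by apply: mem_quotient.
have cgz : [~ g, z]%g \in K.
  apply: coset_idr; first by rewrite groupR ?mem.
  rewrite morphR ?mem //= -[coset K z]ex; apply/eqP/commgP.
  by apply/commute_sym; apply: xC.
have e : (g * z = z * g * [~ g, z])%g by rewrite -commgC.
have cG := subsetP sKG _ cgz; have zgG := groupM zG gG.
rewrite -(proj2 rhoP g z gG zG) e (proj2 rhoP _ _ zgG cG) (proj2 rhoP z g zG gG).
by move: cgz; rewrite KP => /andP[_ /eqP->]; rewrite mulmx1.
Qed.

Lemma id_brauer_map (G : {group gT}) m (rho : gT -> 'M[k]_m) (I : finType)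
    (X Y : I -> 'M[k]_m) :
  is_rep G rho -> dual_bases X Y -> (forall g, g \in G -> rho g = 1%:M) ->
  brauer_map p G rho X id.
Proof.
move=> rhoP XY r1.
have rc g a : g \in G -> rconj rho g a = a.
  by move=> gG; rewrite /rconj !r1 ?groupV // mul1mx mulmx1.
have fx i : fixb G rho X i by apply/forall_inP => g gG; rewrite rc.
split=> //.
- move=> H g a _ gG _ _; rewrite /gtr (eq_bigr (fun=> a)) => [|j _]; last by rewrite rc ?groupX.
  by rewrite sumr_const card_ord -scaler_nat pcharf0 // scale0r.
split=> [c h i _|b].
  have := congr1 (fun M => \tr (M *m Y i)) h; rewrite mul0mx raddf0 mulmx_suml raddf_sum /=.
  rewrite (bigD1 i) //= -scalemxAl mxtraceZ (proj1 XY) eqxx mulr1 big1 ?addr0 // => j /andP[_ ne].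
  by rewrite -scalemxAl mxtraceZ (proj1 XY) (negPf ne) mulr0.
exists (fun i => \tr (b *m Y i)); rewrite {1}(proj2 XY b); apply: eq_bigl => i.
by rewrite fx.
Qed.

(** Inverse powers become positive by z^p = 1; the factor [rho z] in front of [a] corrects the
    exponents, which then add up to p instead of p - 1. *)
Lemma gtr_casimir (G : {group gT}) m (rho : gT -> 'M[k]_m) z a :
  is_rep G rho -> z \in G -> rho z ^+ p = 1 ->
  gtr p rho z a = casimir p (rho z) (rho z *m a).
Proof.
move=> rhoP zG zp; rewrite /gtr /casimir (reindex_inj rev_ord_inj) /=.
apply: eq_bigr => j _; rewrite /rconj (repX rhoP) //.
have jp := ltn_ord j.
have -> : (p - j.+1 = p.-1 - j)%N by rewrite -subn1 subnAC subn1 -subnS.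
congr (_ *m _); rewrite mulmxA; congr (_ *m _).
have jp' : (j <= p.-1)%N by rewrite -ltnS prednK ?prime_gt0.
have e : rho (z ^+ (p.-1 - j))%g^-1%g *m rho (z ^+ (p.-1 - j))%g = 1%:M.
  by rewrite (repV rhoP) ?groupX.
have e3 : rho (z ^+ (p.-1 - j))%g *m rho z ^+ j.+1 = 1%:M.
  by rewrite (repX rhoP) // mulmxE -exprD addnS subnK // prednK ?prime_gt0.
by rewrite mulmx_exprSr -[LHS]mulmx1 -e3 mulmxA e mul1mx.
Qed.

(** For a cyclic group [rho z - 1] can play the part of [xi] over the base field: its centraliser is
    exactly the commutant of the group, so the casimir summand in that condition is taken to be
    0. *)
Lemma cyclic_brauer_map (G : {group gT}) m (rho : gT -> 'M[k]_m) (I : finType)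
    (X Y : I -> 'M[k]_m) z :
  (p.-group G)%g -> is_rep G rho -> dual_bases X Y -> perm_fam G rho X ->
  z \in G -> rho z ^+ p = 1 ->
  exists l (beta : 'M[k]_m -> 'M[k]_l), brauer_map p <[z]>%G rho X beta.
Proof.
move=> pG rhoP XY permX zG zp; pose xi := rho z - 1%:M.
have sZ : (<[z]> \subset G)%g by rewrite cycle_subG.
have rhoZ : is_rep <[z]>%G rho.
  by split; [case: rhoP | move=> x y xZ yZ; apply: (proj2 rhoP); apply: (subsetP sZ)].
have permZ : perm_fam <[z]>%G rho X by move=> g i gZ; apply: permX; apply: (subsetP sZ).
have pR : p%:R = 0 :> 'M[k]_m by rewrite -scaler_nat pcharf0 // scale0r.
have xip : xi ^+ p = 0.
  have com : GRing.comm xi 1 by apply: commr1.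
  have := exprDp_comm p_pr pR com; rewrite subrK zp expr1n => /eqP.
  by rewrite eq_sym -subr_eq0 addrK => /eqP.
have [l [R [P RP]]] := tate_basis_exists (prime_gt0 p_pr) xip.
exists l, (fun a => R *m a *m P).
apply: (step_brauer_map (pgroupS sZ pG) rhoZ XY permZ pk xip _ _ _ RP).
- move=> a ca; rewrite /xi mulmxBr mulmxBl mulmx1 mul1mx ca //; exact: cycle_id.
- move=> H g a mH gZ gH ca; exists (rho z *m a).
  have zH : z \notin H.
    apply: contra gH => zH; apply: subsetP gZ; by rewrite cycle_subG.
  rewrite (gtr_indep (pgroupS sZ pG) rhoZ mH gZ gH (cycle_id z) zH ca).
  by rewrite /xi casimir_sub1 // (gtr_casimir _ rhoP).
move=> a ca; exists a, 0; split; last first.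
  by rewrite /casimir big1 ?addr0 // => j _; rewrite mulmx0 mul0mx.
have cz : rho z *m a = a *m rho z.
  move: ca; rewrite /xi mulmxBr mulmxBl mulmx1 mul1mx => /addIr. exact/esym.
move=> _ /cycleP [j ->]; rewrite (repX rhoP) //.
by rewrite !mulmxE; apply/commr_sym/commrX/commr_sym.
Qed.

(** This yields the Brauer homomorphism with constant coefficients, to which the generic one is
    compared in [generic_lattice]. Cyclic central subgroups suffice here because no normaliser has
    to act. *)
Theorem brauer_map_exists (G : {group gT}) m (rho : gT -> 'M[k]_m) (I : finType)
    (X Y : I -> 'M[k]_m) :
  (p.-group G)%g -> is_rep G rho -> dual_bases X Y -> perm_fam G rho X ->
  exists l (beta : 'M[k]_m -> 'M[k]_l), brauer_map p G rho X beta.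
Proof.
move=> pG; have [n] := ubnP (#|G| - #|rep_ker G rho|).
elim: n m rho I X Y => // n IH m rho I X Y lt rhoP XY permX.
have [kG|kG] := eqVneq (rep_ker G rho) G.
  exists m, id; apply: (id_brauer_map rhoP XY) => g.
  by rewrite -kG inE => /andP[_ /eqP].
have [z [zG z1 zp zC]] := central_elt pG rhoP kG.
have [l [b1 b1P]] := cyclic_brauer_map pG rhoP XY permX zG zp.
have sZ : (<[z]> \subset G)%g by rewrite cycle_subG.
have ZC g : g \in G -> centmx rho <[z]>%g (rho g).
  move=> gG _ /cycleP [j ->]; rewrite (repX rhoP) // !mulmxE.
  by apply/commr_sym/commrX; rewrite /GRing.comm -!mulmxE zC.
have [Y1 XY1] := dual_bases1 b1P.
have [||||l2 [b2 b2P]] := IH _ (rho1 rho b1) _ (X1 b1) Y1.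
- rewrite -ltnS; apply: leq_trans lt; rewrite ltnS ltn_sub2l //.
    rewrite ltn_neqAle subset_leq_card ?andbT; last by apply/subsetP => x; rewrite inE => /andP[].
    apply: contra kG => /eqP e; rewrite eqEcard e leqnn andbT.
    by apply/subsetP => x; rewrite inE => /andP[].
  apply: proper_card; apply/properP; split.
    apply/subsetP => x; rewrite !inE => /andP[-> /eqP x1] /=.
    by rewrite /rho1 x1; case: b1P => _ ->.
  exists z; rewrite !inE zG ?(negPf z1) //=.
  by rewrite (rho1_trivial rhoP sZ ZC b1P) ?cycle_id.
- exact: (is_rep1 rhoP ZC b1P).
- by [].
- exact: (perm_fam1 rhoP permX sZ ZC b1P).
exists l2, (b2 \o b1); exact: (compose_brauer_map pG rhoP permX sZ ZC b1P b2P).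
Qed.

End Chain.

Lemma exprZmx (k : comPzRingType) m (t : k) (M : 'M[k]_m) s : (t *: M) ^+ s = t ^+ s *: M ^+ s.
Proof.
elim: s => [|s IH]; first by rewrite !expr0 scale1r.
by rewrite !exprS IH -!mulmxE -scalemxAl -scalemxAr scalerA.
Qed.

(** * Generic elements *)

Section GenericCasimir.
Variables (p : nat) (k : fieldType) (m n : nat).
Hypothesis pk : p \in [pchar k].
Let p_pr : prime p. Proof. by case/andP: pk. Qed.
Variables (x : 'I_n -> k) (h : 'I_n -> 'M[k]_m) (g : 'M[k]_m) (chi : 'I_n -> nat).
Hypotheses (hp : forall i, h i ^+ p = 1) (gp : g ^+ p = 1)
  (hg : forall i, h i *m g = g *m h i) (hh : forall i j, h i *m h j = h j *m h i).
Let xi := \sum_i x i *: (h i *m g ^+ chi i - 1%:M).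
Let c := \sum_i x i * (chi i)%:R.
Hypothesis c_neq0 : c != 0.

Let inC (b : 'M[k]_m) := forall i, h i *m b = b *m h i.

(** [ps s] is the divided difference of the s-th power: the commutator with g^s is [ps s] applied to
    the commutator with [g] ([psE]). Hence, on matrices commuting with all [h i], ad xi is [U] after
    ad g ([ad_xiE]). *)
Let ps n (b : 'M[k]_m) := \sum_(j < n) g ^+ j *m b *m g ^+ (n.-1 - j).
Let U (b : 'M[k]_m) := \sum_i x i *: (h i *m ps (chi i) b).

Lemma hgX i j : h i *m g ^+ j = g ^+ j *m h i.
Proof. by rewrite !mulmxE; apply: commrX; apply: hg. Qed.

Lemma inC_g b j j' : inC b -> inC (g ^+ j *m b *m g ^+ j').
Proof.
move=> cb i; rewrite !mulmxA hgX -(mulmxA _ (h i) b) cb !mulmxA -(mulmxA _ (h i)) hgX.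
by rewrite !mulmxA.
Qed.

Lemma inC_sum (J : Type) (r : seq J) (F : J -> 'M[k]_m) :
  (forall j, inC (F j)) -> inC (\sum_(j <- r) F j).
Proof.
move=> cF i; rewrite mulmx_sumr mulmx_suml; apply: eq_bigr => j _; exact: cF.
Qed.

Lemma inC_ad b : inC b -> inC (admx g b).
Proof.
move=> cb i; have := inC_g 1 0 cb i; have := inC_g 0 1 cb i.
rewrite !expr1 !expr0 -[1]/(1%:M) !mul1mx !mulmx1 => e1 e2.
by rewrite /admx mulmxBr mulmxBl e1 e2.
Qed.

Lemma inC_U b : inC b -> inC (U b).
Proof.
move=> cb; apply: inC_sum => i j; rewrite -scalemxAr -scalemxAl; congr (_ *: _).
rewrite mulmxA hh -!mulmxA; congr (_ *m _); apply: inC_sum => t; exact: inC_g.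
Qed.

Lemma psE s b : g ^+ s *m b - b *m g ^+ s = ps s (admx g b).
Proof.
rewrite /ps; elim: s b => [|s IH] b; first by rewrite big_ord0 expr0 -[1]/(1%:M) mul1mx mulmx1 subrr.
have -> : g ^+ s.+1 *m b - b *m g ^+ s.+1 =
   (g ^+ s *m (g *m b) - g *m b *m g ^+ s) + admx g b *m g ^+ s.
  rewrite /admx mulmxBl mulmxA mulmx_exprSr -(mulmxA b) mulmx_exprS addrA.
  by rewrite addrNK.
rewrite IH big_ord_recl /= expr0 -[1]/(1%:M) mul1mx subn0 addrC; congr (_ + _).
case: s IH => [|s] IH; first by rewrite !big_ord0.
apply: eq_bigr => i _; rewrite /bump /= add1n.
have -> : admx g (g *m b) = g *m admx g b by rewrite /admx mulmxBr !mulmxA.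
by rewrite mulmxA mulmx_exprSr subSS.
Qed.

Lemma ad_xiE b : inC b -> admx xi b = U (admx g b).
Proof.
move=> cb; rewrite /admx /xi /U mulmx_suml mulmx_sumr -sumrB; apply: eq_bigr => i _.
rewrite -scalemxAl -scalemxAr -scalerBr; congr (_ *: _).
rewrite mulmxBl mulmxBr mul1mx mulmx1 opprB addrA addrNK -psE mulmxBr.
by rewrite !mulmxA cb.
Qed.

Lemma U_ad b : U (admx g b) = admx g (U b).
Proof.
rewrite /U /admx mulmx_suml mulmx_sumr -sumrB; apply: eq_bigr => i _.
rewrite -scalemxAl -scalemxAr -scalerBr; congr (_ *: _).
rewrite mulmxA -hg -(mulmxA (h i) g) -(mulmxA (h i) _ g) -mulmxBr; congr (_ *m _).
rewrite /ps mulmx_suml mulmx_sumr -sumrB; apply: eq_bigr => j _.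
rewrite mulmxBr mulmxBl !mulmxA mulmx_exprSr mulmx_exprS -!mulmxA.
by rewrite mulmx_exprSr mulmx_exprS.
Qed.

Let Lm (a : 'M[k]_m) : 'M[k]_(m * m) := lin_mulmx a.
Let Rm (a : 'M[k]_m) : 'M[k]_(m * m) := lin_mulmxr a.

Lemma Lm_mul a b : Lm a * Lm b = Lm (b *m a).
Proof.
apply/row_matrixP => i; rewrite !rowE -[delta_mx _ _]vec_mxK -mulmxE mulmxA.
by rewrite !mul_vec_lin /= mulmxA.
Qed.

Lemma Rm_mul a b : Rm a * Rm b = Rm (a *m b).
Proof.
apply/row_matrixP => i; rewrite !rowE -[delta_mx _ _]vec_mxK -mulmxE mulmxA.
by rewrite !mul_vec_lin /= mulmxA.
Qed.

Lemma LRm_comm a b : Lm a * Rm b = Rm b * Lm a.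
Proof.
apply/row_matrixP => i; rewrite !rowE -[delta_mx _ _]vec_mxK -mulmxE !mulmxA.
by rewrite !mul_vec_lin /= mulmxA.
Qed.

Lemma Lm1 : Lm 1 = 1.
Proof.
apply/row_matrixP => i; rewrite !rowE -[delta_mx _ _]vec_mxK mul_vec_lin /=.
by rewrite mul1mx mulmx1.
Qed.

Lemma Rm1 : Rm 1 = 1.
Proof.
apply/row_matrixP => i; rewrite !rowE -[delta_mx _ _]vec_mxK mul_vec_lin /=.
by rewrite !mulmx1.
Qed.

Lemma LmX a s : Lm a ^+ s = Lm (a ^+ s).
Proof. by elim: s => [|s IH]; rewrite ?expr0 ?Lm1 // exprS IH Lm_mul exprSr. Qed.

Lemma RmX a s : Rm a ^+ s = Rm (a ^+ s).
Proof. by elim: s => [|s IH]; rewrite ?expr0 ?Rm1 // exprS IH Rm_mul exprS. Qed.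

Let UU : 'M[k]_(m * m) :=
  \sum_i x i *: (\sum_(j < chi i) Lm (g ^+ j) * Rm (g ^+ ((chi i).-1 - j)) * Lm (h i)).

Lemma mul_UU b : mxvec b *m UU = mxvec (U b).
Proof.
rewrite /UU /U mulmx_sumr linear_sum /=; apply: eq_bigr => i _.
rewrite -scalemxAr [RHS]linearZ /=; congr (_ *: _).
rewrite mulmx_sumr /ps mulmx_sumr linear_sum /=; apply: eq_bigr => j _.
by rewrite -!mulmxE (mulmxA (mxvec b)) (mulmxA (mxvec b)) !mul_vec_lin.
Qed.

(** The summands of [UU] are products of commuting multiplication operators with p-th power 1, so
    Frobenius leaves the sum of the x_i^p chi_i. This is c^p because Frobenius fixes the
    integers. *)
Lemma UUp : UU ^+ p = (c ^+ p)%:M.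
Proof.
have pR : p%:R = 0 :> 'M[k]_(m * m) by rewrite -scaler_nat pcharf0 // scale0r.
pose F i j := Lm (g ^+ j) * Rm (g ^+ ((chi i).-1 - j)) * Lm (h i).
have comF i j i' j' : GRing.comm (F i j) (F i' j').
  have LL a b : a *m b = b *m a -> GRing.comm (Lm a) (Lm b).
    by move=> ab; rewrite /GRing.comm !Lm_mul ab.
  have gg s t : g ^+ s *m g ^+ t = g ^+ t *m g ^+ s by rewrite !mulmxE -!exprD addnC.
  have RR a b : a *m b = b *m a -> GRing.comm (Rm a) (Rm b).
    by move=> ab; rewrite /GRing.comm !Rm_mul ab.
  have LR a b : GRing.comm (Lm a) (Rm b) by rewrite /GRing.comm LRm_comm.
  apply: commrM; [apply: commrM|]; apply/commr_sym; (apply: commrM; [apply: commrM|]).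
  - exact/LL/gg.
  - exact: LR.
  - exact/LL/esym/hgX.
  - exact/commr_sym/LR.
  - exact/RR/gg.
  - exact/commr_sym/LR.
  - exact/LL/hgX.
  - exact: LR.
  exact/LL/hh.
have Fp i j : F i j ^+ p = 1.
  rewrite /F !exprMn_comm.
  - by rewrite !LmX RmX -!exprM ![(_ * p)%N]mulnC !exprM gp hp !expr1n Lm1 Rm1 !mulr1.
  - by rewrite /GRing.comm LRm_comm.
  - apply/commr_sym/commrM; first by rewrite /GRing.comm !Lm_mul hgX.
    by rewrite /GRing.comm LRm_comm.
rewrite /UU expr_sump_comm //; last first.
  move=> i i'; rewrite /GRing.comm -!mulmxE -!scalemxAl -!scalemxAr !scalerA [x i * _]mulrC.
  rewrite !mulmxE; congr (_ *: _); apply: commr_sum => j' _; apply/commr_sym; apply: commr_sum => j _.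
  exact: comF.
rewrite (eq_bigr (fun i => (x i ^+ p * (chi i)%:R)%:M)) => [|i _]; last first.
  rewrite exprZmx expr_sump_comm //; last by move=> j j'; apply: comF.
  rewrite (eq_bigr (fun=> 1)) => [|j _]; last exact: Fp.
  by rewrite sumr_const card_ord -[1]/(1%:M) -raddfMn /= scale_scalar_mx.
rewrite -raddf_sum /=; congr (_%:M).
rewrite /c (@expr_sump_comm _ p p_pr (pcharf0 pk)); last by move=> i j; apply: mulrC.
apply: eq_bigr => i _; rewrite exprMn; congr (_ * _).
have -> : (chi i)%:R = \sum_(j < chi i) 1 :> k by rewrite sumr_const card_ord.
rewrite (@expr_sump_comm _ p p_pr (pcharf0 pk)) //.
by apply: eq_bigr => j _; rewrite expr1n.
Qed.

Lemma iterU_p b : iter p U b = c ^+ p *: b.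
Proof.
have E s : mxvec (iter s U b) = mxvec b *m UU ^+ s.
  elim: s => [|s IH]; first by rewrite expr0 mulmx1.
  by rewrite iterS -mul_UU IH exprSr mulmxA.
have := E p; rewrite UUp mul_mx_scalar => /(congr1 vec_mx).
by rewrite linearZ /= !mxvecK.
Qed.

Lemma admxZ y t b : admx y (t *: b) = t *: admx y b :> 'M[k]_m.
Proof. by rewrite /admx -scalemxAr -scalemxAl scalerBr. Qed.

(** On the commutant of the [h i] one has ad xi = U ad g with commuting factors, and U^p is the
    nonzero scalar c^p. Thus (ad g)^(p-1) equals (ad xi)^(p-1) applied after U^-(p-1), and
    [casimir_admx] translates both sides. *)
Lemma casimir_generic a : inC a -> exists b, casimir p g a = casimir p xi b.
Proof.
move=> ca; pose b s := iter s U a.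
have cb s : inC (b s) by elim: s => // s IH; apply: inC_U.
have E s t : iter s (admx xi) (b t) = iter s (admx g) (b (s + t)%N).
  have G r q : inC (iter r (admx g) (b q)).
    by elim: r => [|r IH] /=; [apply: cb | apply: inC_ad].
  have UG r q : U (iter r (admx g) (b q)) = iter r (admx g) (b q.+1).
    by elim: r => // r IH; rewrite !iterS U_ad IH.
  elim: s => // s IH; rewrite !iterS IH ad_xiE // U_ad UG.
  by [].
have bp q : b (p * q)%N = c ^+ (p * q) *: a.
  elim: q => [|q IH]; first by rewrite muln0 scale1r.
  by rewrite mulnS /b iterD -/(b _) iterU_p IH scalerA -exprD.
(* This is U^-(p-1) applied to [a]: multiplying by U^(p-1) gives U^(p(p-1)), which is the scalar
   c^(p(p-1)). *)
exists ((c ^+ (p * p.-1))^-1 *: b (p.-1 * p.-1)%N).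
have Z s (y : 'M[k]_m) (t : k) (d : 'M[k]_m) : iter s (admx y) (t *: d) = t *: iter s (admx y) d.
  by elim: s => // s IH; rewrite !iterS IH admxZ.
rewrite !casimir_admx // Z E.
have -> : (p.-1 + p.-1 * p.-1 = p * p.-1)%N by rewrite -mulSn prednK ?prime_gt0.
by rewrite bp Z scalerA mulVf ?scale1r // expf_neq0.
Qed.

End GenericCasimir.

Lemma casimir_ker p (k : fieldType) m (xi C : 'M[k]_m) r (v : 'M[k]_(r, m)) :
  (0 < p)%N -> v *m xi = 0 -> v *m casimir p xi C = v *m C *m xi ^+ p.-1.
Proof.
case: p => // q _ vx; rewrite /casimir big_ord_recl mulmxDr expr0 -[1]/(1%:M) mul1mx subn0.
rewrite mulmx_sumr big1 ?addr0 ?mulmxA // => j _.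
by rewrite lift0 -mulmx_exprS !mulmxA vx !mul0mx.
Qed.

Section GenericTrace.
Variables (p : nat) (gT : finGroupType) (k : fieldType) (n : nat).
Hypothesis pk : p \in [pchar k].
Variables (Z : {group gT}) (x : 'I_n -> k) (zz : 'I_n -> gT).
Hypotheses (pZ : (p.-group Z)%g) (zzZ : forall i, zz i \in Z)
  (x_indep : forall chi : 'I_n -> nat, (exists i, ~~ (p %| chi i)%N) ->
     \sum_i x i * (chi i)%:R != 0).
Let p_pr : prime p. Proof. by case/andP: pk. Qed.

(** One fixed list [zz] serves [rho], its base change and the conjugation action on matrices, so
    that [generic_trace] applies to each of them with the same coefficients. It lists images only,
    since [rho] may have a kernel. *)
Definition elem_rep m (rho : gT -> 'M[k]_m) :=
  [/\ is_rep Z rho, forall z, z \in Z -> rho z ^+ p = 1,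
      {in Z &, forall y z, rho y *m rho z = rho z *m rho y} &
      forall z, z \in Z -> exists i, rho z = rho (zz i)].

Definition generic_elt m (rho : gT -> 'M[k]_m) := \sum_i x i *: (rho (zz i) - 1%:M).

Lemma generic_elt_comm m (rho : gT -> 'M[k]_m) a :
  centmx rho Z a -> a *m generic_elt rho = generic_elt rho *m a.
Proof.
move=> ca; rewrite mulmx_sumr mulmx_suml; apply: eq_bigr => i _.
by rewrite -scalemxAr -scalemxAl mulmxBr mulmxBl mulmx1 mul1mx ca.
Qed.

Lemma generic_elt_p m (rho : gT -> 'M[k]_m) : elem_rep rho -> generic_elt rho ^+ p = 0.
Proof.
case=> rhoP zp comm _.
have pR : p%:R = 0 :> 'M[k]_m by rewrite -scaler_nat pcharf0 // scale0r.
rewrite /generic_elt expr_sump_comm // => [|i j]; last first.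
  rewrite /GRing.comm -!mulmxE -!scalemxAl -!scalemxAr !scalerA [x i * _]mulrC; congr (_ *: _).
  by rewrite !(mulmxBl, mulmxBr, mulmx1, mul1mx) comm //; rewrite !opprB addrACA [X in _ + X]addrC addrACA.
rewrite big1 // => i _; rewrite exprZmx.
have com : GRing.comm (rho (zz i) - 1%:M) 1 by apply: commr1.
have := exprDp_comm p_pr pR com; rewrite subrK zp // expr1n => /eqP.
by rewrite eq_sym -subr_eq0 addrK => /eqP ->; rewrite scaler0.
Qed.

Lemma generic_trace m (rho : gT -> 'M[k]_m) (H : {group gT}) g a :
  elem_rep rho -> maximal H Z -> g \in Z -> g \notin H -> centmx rho H a ->
  exists b, gtr p rho g a = casimir p (generic_elt rho) b.
Proof.
case=> rhoP zp comm surj mH gZ gH ca.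
have [_ nHZ ordg cosg] := maximal_coset pZ mH gZ gH.
have sHZ := subsetP (normal_sub nHZ).
(* Modulo H each [zz i] is the power chi i of [g]. If some exponent is nonzero modulo p,
   independence of the x_i makes the scalar in [casimir_generic] nonzero. Otherwise all [zz i] lie
   in H, so [rho g] commutes with [a] and the trace is p times [a]. *)
have [chi chilt chiH] := fin_all_exists2 (fun i => cosg _ (zzZ i)).
have gjZ j : (g ^- j)%g \in Z by rewrite groupV groupX.
pose h i := (zz i * g ^- chi i)%g.
have hZ i : h i \in Z by rewrite groupM.
rewrite (gtr_casimir _ _ rhoP) ?zp //.
case: (boolP [exists i, ~~ (p %| chi i)%N]) => [/existsP ex|].
  have E : generic_elt rho = \sum_i x i *: (rho (h i) *m rho g ^+ chi i - 1%:M).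
    apply: eq_bigr => i _; congr (_ *: (_ - _)).
    by rewrite -(repX rhoP) // -(proj2 rhoP) ?groupX // /h mulgKV.
  rewrite E. apply: (@casimir_generic p k m n pk x (fun i => rho (h i)) (rho g) chi).
  - by move=> i; apply: zp.
  - exact: zp.
  - by move=> i; apply: comm.
  - by move=> i j; apply: comm.
  - exact: x_indep.
  move=> i; rewrite mulmxA comm // -!mulmxA; congr (_ *m _); apply: ca; exact: chiH.
rewrite negb_exists => /forallP ap; exists 0.
have allH i : zz i \in H.
  have := ap i; rewrite negbK => dv; have := chiH i.
  have -> : chi i = 0%N; last by rewrite expg0 invg1 mulg1.
  by case: (posnP (chi i)) dv (chilt i) => // pos /(dvdn_leq pos); rewrite leqNgt => /negPf->.
have [i e] := surj g gZ.
have rga : rho g *m a = a *m rho g by rewrite e ca.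
rewrite /casimir [RHS]big1 => [|j _]; last by rewrite mulmx0 mul0mx.
rewrite (eq_bigr (fun=> a)) => [|j _].
  by rewrite sumr_const card_ord -scaler_nat pcharf0 // scale0r.
have jp' : (j <= p.-1)%N by rewrite -ltnS prednK ?prime_gt0.
have rX t : rho g ^+ t *m a = a *m rho g ^+ t by rewrite !mulmxE; apply/commr_sym/commrX/commr_sym.
rewrite (mulmxA (_ ^+ j)) mulmx_exprSr rX -mulmxA mulmxE -exprD addSn subnKC //.
by rewrite prednK ?prime_gt0 // zp // mulr1.
Qed.

Lemma lin_mx_exists m (f : 'M[k]_m -> 'M[k]_m) :
  (forall c a b, f (c *: a + b) = c *: f a + f b) ->
  exists M : 'M[k]_(m * m), forall b, mxvec b *m M = mxvec (f b).
Proof.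
move=> lin.
pose F : {linear 'M[k]_m -> 'M[k]_m} :=
  HB.pack f (GRing.isLinear.Build k 'M[k]_m 'M[k]_m *:%R f lin).
by exists (lin_mx F) => b; rewrite mul_vec_lin.
Qed.

Lemma mxvec_ext m (M N : 'M[k]_(m * m)) :
  (forall b : 'M[k]_m, mxvec b *m M = mxvec b *m N) -> M = N.
Proof.
by move=> h; apply/row_matrixP => i; rewrite !rowE -[delta_mx _ _]vec_mxK h.
Qed.

Definition generic_op m (rho : gT -> 'M[k]_m) b := \sum_i x i *: (rconj rho (zz i) b - b).

Section PermutationModule.
Variables (m : nat) (rho : gT -> 'M[k]_m) (I : finType) (X Y : I -> 'M[k]_m).
Hypotheses (rhoE : elem_rep rho) (XY : dual_bases X Y) (permX : perm_fam Z rho X).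
Let rhoP : is_rep Z rho. Proof. by case: rhoE. Qed.

Definition conj_rep (g : gT) : 'M[k]_(m * m) :=
  locked (lin_mulmx (rho g^-1%g) *m lin_mulmxr (rho g)).

Lemma conj_repE g b : mxvec b *m conj_rep g = mxvec (rconj rho g b).
Proof. by rewrite /conj_rep -lock mulmxA !mul_vec_lin. Qed.

Lemma conj_rep_elem : elem_rep conj_rep.
Proof.
case: rhoE => _ zp comm surj.
have rep : is_rep Z conj_rep.
  split=> [|y z yZ zZ]; apply: mxvec_ext => b.
    by rewrite conj_repE (rconj1 rhoP) mulmx1.
  by rewrite mulmxA !conj_repE (rconjM rhoP).
split=> //.
- move=> z zZ; rewrite -(repX rep) //; apply: mxvec_ext => b.
  have e : rho (z ^+ p)%g = 1%:M by rewrite (repX rhoP) ?zp.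
  have e' : rho (z ^+ p)^-1%g = 1%:M by rewrite -[LHS]mulmx1 -e (repV rhoP) ?groupX.
  by rewrite conj_repE /rconj e e' mul1mx !mulmx1.
- move=> y z yZ zZ; apply: mxvec_ext => b; rewrite !mulmxA !conj_repE; congr mxvec.
  have yV : (y^-1)%g \in Z by rewrite groupV.
  have zV : (z^-1)%g \in Z by rewrite groupV.
  by rewrite /rconj !mulmxA (comm (z^-1)%g) // -!mulmxA (comm y).
move=> z zZ; have [i e] := surj z zZ; exists i; apply: mxvec_ext => b.
rewrite !conj_repE /rconj e; congr (mxvec (_ *m _ *m _)).
have zi := zzZ i.
by rewrite -[LHS]mulmx1 -(rep_V rhoP zi) mulmxA -e (repV rhoP) // mul1mx.
Qed.

Lemma generic_opE b : mxvec b *m generic_elt conj_rep = mxvec (generic_op rho b).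
Proof.
rewrite mulmx_sumr /generic_op linear_sum /=; apply: eq_bigr => i _.
by rewrite -scalemxAr [RHS]linearZ /= mulmxBr mulmx1 conj_repE; congr (_ *: _); rewrite linearB.
Qed.

(** The projection onto the non-fixed basis elements is a sum of traces from maximal subgroups for
    the conjugation action, hence a casimir of some [C] by [generic_trace]. On a vector killed by
    the operator, such a casimir acts as [C] followed by the (p-1)-th power of the operator. *)
Lemma generic_op_kernel b : generic_op rho b = 0 ->
  exists b0 b1, centmx rho Z b0 /\ b = b0 + iter p.-1 (generic_op rho) b1.
Proof.
move=> ub; pose Pi (S : {set I}) (b : 'M[k]_m) := \sum_(i in S) \tr (b *m Y i) *: X i.
have pid1 := pidx1 rhoP XY permX; have pidM := pidxM rhoP XY permX.
have pidK := pidxK rhoP XY permX; have pidVK := pidxVK rhoP XY permX.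
have [||T [T1 T2]] := @orbit_partition p gT I (pidx rho X) Z pZ pid1 pidM
   [set i | ~~ fixb Z rho X i].
- by move=> i; rewrite inE (fixed_pidx XY permX).
- move=> g i gG; rewrite !inE -!(fixed_pidx XY permX); apply: contra => /forall_inP h.
  have E y : y \in Z -> pidx rho X y i = pidx rho X g i.
    move=> yZ; have /eqP <- := h (g^-1 * y)%g (groupM (groupVr gG) yZ).
    by rewrite -pidM ?groupM ?groupV // mulKVg.
  by apply/forall_inP => y yZ; rewrite E // -(E 1%g) // pid1.
have PiL (S : {set I}) c a d : Pi S (c *: a + d) = c *: Pi S a + Pi S d.
  rewrite /Pi scaler_sumr -big_split; apply: eq_bigr => i _ /=.
  by rewrite mulmxDl raddfD /= -scalemxAl mxtraceZ scalerDl scalerA.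
have [Q QP] : exists Q, forall t, t \in T -> forall d, mxvec d *m Q t = mxvec (Pi t.2 d).
  have ex S := lin_mx_exists (PiL S).
  have [Q QP] := fin_all_exists ex.
  by exists (fun t => Q t.2) => t _ d; rewrite QP.
have QH t : t \in T -> centmx conj_rep t.1.1 (Q t).
  move=> tT h hH; have [mt gZ gH stab] := T1 _ tT.
  have hZ : h \in Z by apply: (subsetP (normal_sub (p_maximal_normal pZ mt))).
  apply: mxvec_ext => d; rewrite !mulmxA conj_repE !QP // conj_repE; congr mxvec.
  rewrite /Pi rconj_sum (reindex_onto (pidx rho X h) (pidx rho X h^-1%g)) /=; last first.
    by move=> i _; apply: pidVK.
  apply: eq_big => [i|i /andP[_ _]].
    rewrite pidK // eqxx andbT; apply/idP/idP => [|iS]; last exact: stab.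
    by move=> /(stab h^-1%g _ (groupVr hH)); rewrite pidK.
  by rewrite rconjZ (coord_pidx rhoP XY permX) // -(pidxE permX).
have QT t : t \in T -> exists c, gtr p conj_rep t.1.2 (Q t) = casimir p (generic_elt conj_rep) c.
  move=> tT; have [mt gZ gH _] := T1 _ tT.
  exact: (generic_trace conj_rep_elem mt gZ gH (QH t tT)).
have [C CP] : exists C, \sum_(t <- T) gtr p conj_rep t.1.2 (Q t) = casimir p (generic_elt conj_rep) C.
  have : {subset T <= T} by [].
  elim: {1 3}T => [|t s IH] sub.
    exists 0; rewrite big_nil /casimir big1 // => j _; by rewrite mulmx0 mul0mx.
  have [|C eC] := IH; first by move=> y ys; apply: sub; rewrite inE ys orbT.
  have [c ec] := QT t (sub _ (mem_head _ _)).
  exists (c + C); rewrite big_cons ec eC /casimir -big_split; apply: eq_bigr => j _ /=.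
  by rewrite mulmxDr mulmxDl.
exists (\sum_(i | fixb Z rho X i) \tr (b *m Y i) *: X i), (vec_mx (mxvec b *m C)); split.
  apply: cent_sum => i /forall_inP fi; apply: centZ; apply/(centP rhoP) => g gZ.
  by have /eqP := fi _ gZ.
rewrite {1}(proj2 XY b) (bigID (fixb Z rho X)) /=; congr (_ + _).
apply: (can_inj mxvecK).
have itE j d : mxvec (iter j (generic_op rho) d) = mxvec d *m generic_elt conj_rep ^+ j.
  elim: j => [|j IH]; first by rewrite expr0 mulmx1.
  by rewrite iterS -generic_opE IH -mulmxA mulmx_exprSr.
rewrite itE vec_mxK.
have -> : mxvec b *m C *m generic_elt conj_rep ^+ p.-1 = mxvec b *m casimir p (generic_elt conj_rep) C.
  have bu : mxvec b *m generic_elt conj_rep = 0 by rewrite generic_opE ub linear0.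
  by rewrite casimir_ker // prime_gt0.
rewrite -CP mulmx_sumr.
have -> : \sum_(t <- T) mxvec b *m gtr p conj_rep t.1.2 (Q t) =
   mxvec (\sum_(t <- T) \sum_i \sum_(j < p) \tr (b *m Y i) *: X i *+ (pidx rho X (t.1.2 ^- j)%g i \in t.2)).
  rewrite linear_sum /= big_seq [RHS]big_seq; apply: eq_bigr => t tT.
  have [mt gZ gH _] := T1 _ tT.
  rewrite exchange_big /gtr mulmx_sumr linear_sum /=; apply: eq_bigr => j _.
  have gj : (t.1.2 ^+ j)%g \in Z by rewrite groupX.
  rewrite {1}/rconj !mulmxA conj_repE QP // conj_repE; congr mxvec.
  rewrite /Pi rconj_sum (reindex_onto (pidx rho X (t.1.2 ^- j)%g) (pidx rho X (t.1.2 ^+ j)%g)) /=; last first.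
    by move=> i _; apply: pidK.
  rewrite big_mkcond; apply: eq_bigr => i _.
  rewrite pidVK // eqxx andbT mulrb; case: ifP => // _.
  have gjV : (t.1.2 ^- j)%g \in Z by rewrite groupV.
  by rewrite rconjZ (coord_pidx rhoP XY permX) // (pidxE permX) // pidVK.
congr mxvec; rewrite exchange_big big_mkcond; apply: eq_bigr => i _ /=.
rewrite (eq_bigr (fun t : {group gT} * gT * {set I} => \tr (b *m Y i) *: X i *+
   (\sum_(j < p) (pidx rho X (t.1.2 ^- j)%g i \in t.2))%N)); last by move=> t _; rewrite sumrMnr.
by rewrite sumrMnr T2 inE mulrb; case: ifP.
Qed.

End PermutationModule.

End GenericTrace.

(** * Factoriality of polynomial rings *)

Section Factorial.
Variable R : idomainType.
Implicit Types (a b c d h : R).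

Definition divides a b := exists c, b = c * a.

Definition prime_elt (q : R) :=
  [/\ q != 0, q \isn't a GRing.unit &
      forall a b, divides q (a * b) -> divides q a \/ divides q b].

(** The factors are prime and not merely irreducible, so existence of factorisations already
    includes uniqueness. *)
Definition factorial := forall a, a != 0 ->
  exists (u : R) (s : seq R), [/\ u \is a GRing.unit,
    forall q, q \in s -> prime_elt q & a = u * \prod_(q <- s) q].

Lemma divides_refl a : divides a a.
Proof. by exists 1; rewrite mul1r. Qed.

Lemma divides_mull a b c : divides a b -> divides a (c * b).
Proof. by case=> d ->; exists (c * d); rewrite mulrA. Qed.

Lemma divides_mulr a b c : divides a b -> divides a (b * c).
Proof. by rewrite mulrC; apply: divides_mull. Qed.

Lemma divides_trans a b c : divides a b -> divides b c -> divides a c.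
Proof. by case=> d -> [e ->]; exists (e * d); rewrite mulrA. Qed.

Lemma divides_mul2l a b c : c != 0 -> divides (c * a) (c * b) -> divides a b.
Proof.
move=> c0 [d e]; exists d; apply: (mulfI c0); by rewrite e mulrCA.
Qed.

Lemma divides_mul2 a b c : divides a b -> divides (c * a) (c * b).
Proof. by case=> d ->; exists d; rewrite mulrCA. Qed.

Lemma prime_divides_assoc q q' : prime_elt q -> prime_elt q' -> divides q q' -> divides q' q.
Proof.
move=> [q0 qu _] [q'0 q'u pr] [c e].
case: (pr c q) => [|[d ed]|//]; first by rewrite -e; apply: divides_refl.
case/negP: qu; apply/unitrPr; exists d; apply: (mulfI q'0).
by rewrite mulr1 [in RHS]e ed mulrA mulrC mulrA.
Qed.

Lemma prime_divides_prod q (s : seq R) u : prime_elt q -> u \is a GRing.unit ->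
  divides q (u * \prod_(r <- s) r) -> exists2 r, r \in s & divides q r.
Proof.
move=> qP uu; elim: s => [|r s IH].
  rewrite big_nil mulr1 => -[c e]; case: qP => _ /negP[]; move: uu.
  by rewrite e unitrM => /andP[].
rewrite big_cons mulrCA; case: (qP) => _ _ pr /pr [qr|/IH [r' r's qr']].
  by exists r; rewrite ?mem_head.
by exists r'; rewrite // inE r's orbT.
Qed.

Hypothesis RF : factorial.

(** The colon ideal (a) : b is treated one prime factor of [a] at a time: a prime either divides [b]
    and cancels, or it passes into the generator [w]. *)
Lemma colon_principal a b : a != 0 -> exists w, forall c, divides a (c * b) <-> divides w c.
Proof.
move=> a0; have [u [s [uu sP ->]]] := RF a0.
elim: s b sP {a a0} => [|q s IH] b sP.
  exists 1 => c; rewrite big_nil mulr1; split=> _; first by exists c; rewrite mulr1.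
  by exists (c * b * u^-1); rewrite mulrVK.
have qP : prime_elt q by apply: sP; rewrite mem_head.
have sP' : forall r, r \in s -> prime_elt r by move=> r rs; apply: sP; rewrite inE rs orbT.
case: (qP) => q0 _ pr; rewrite big_cons mulrCA.
case: (classic (divides q b)) => [[b' eb]|nqb].
  have [w wP] := IH b' sP'; exists w => c; rewrite -wP eb.
  have -> : c * (b' * q) = q * (c * b') by rewrite [b' * q]mulrC mulrCA.
  by split; [apply: divides_mul2l | apply: divides_mul2].
have [w wP] := IH b sP'; exists (q * w) => c; split.
  move=> dv; have : divides q (c * b) by apply: divides_trans dv; exists (u * \prod_(j <- s) j); rewrite mulrC.
  case/pr => // -[c' ec]; move: dv; rewrite ec [c' * q]mulrC -mulrA => /(divides_mul2l q0) /wP.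
  exact: divides_mul2.
case=> t ->; have -> : t * (q * w) * b = q * (t * w * b) by rewrite !mulrA [t * q]mulrC.
by apply: divides_mul2; apply/wP; exists t.
Qed.

(** Here [d] is a / w, where [w] generates (a) : b. The extra factor [c] makes the gcd compatible
    with scaling, which is how it is applied to the hull. *)
Lemma strong_gcd a b : a != 0 -> exists d,
  [/\ divides d a, divides d b & forall h c, divides h (c * a) -> divides h (c * b) -> divides h (c * d)].
Proof.
move=> a0; have [w wP] := colon_principal b a0.
have [d ed] : divides w a by apply/wP; exists b; rewrite mulrC.
have w0 : w != 0 by apply: contraNneq a0 => w0; rewrite ed w0 mulr0.
exists d; split; first by exists w; rewrite mulrC.
  apply: (divides_mul2l w0); rewrite [w * d]mulrC -ed; apply/wP; exact: divides_refl.
move=> h c ha hb; have [h0|h0] := eqVneq h 0.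
  case: ha => t; rewrite h0 mulr0 => /eqP; rewrite mulf_eq0 (negPf a0) orbF => /eqP->.
  by exists 0; rewrite !mul0r.
have [v vP] := colon_principal c h0.
have : divides v a by apply/vP; rewrite mulrC.
have : divides v b by apply/vP; rewrite mulrC.
case=> b' eb [a' ea].
have v0 : v != 0 by apply: contraNneq a0 => v0; rewrite ea v0 mulr0.
rewrite mulrC; apply/vP.
have [d' ed'] : divides w a'.
  by apply/wP; rewrite ea eb; exists b'; rewrite mulrCA.
exists d'; apply: (mulIf w0); rewrite -ed ea ed'.
by rewrite mulrAC.
Qed.

End Factorial.

Section FactorialPoly.
Variable R : idomainType.
Implicit Types (f g : {poly R}).

Lemma divides_polyC (q : R) f : divides q%:P f <-> forall i, divides q f`_i.
Proof.
split=> [[g ->] i|h]; first by exists g`_i; rewrite coefMC.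
have [c cP] := fin_all_exists (fun i : 'I_(size f) => h i).
exists (\poly_(i < size f) (if insub i is Some j then c j else 0)).
apply/polyP => i; rewrite coefMC coef_poly; case: ltnP => [lt|le].
  by rewrite insubT -cP.
by rewrite mul0r nth_default.
Qed.

(** Gauss: compare the lowest coefficients of [f] and [g] that [q] does not divide. *)
Lemma prime_polyC (q : R) : prime_elt q -> prime_elt q%:P.
Proof.
case=> q0 qu pr; split; [by rewrite polyC_eq0 | by rewrite poly_unitE size_polyC q0 coefC |].
move=> f g /divides_polyC dv; apply: NNPP => /not_or_and [nf ng].
have ex f' : ~ divides q%:P f' -> exists2 i, ~ divides q f'`_i & forall j, (j < i)%N -> divides q f'`_j.
  move=> nd; have [i ni] : exists i, ~ divides q f'`_i.
    by apply: NNPP => h; apply: nd; apply/divides_polyC => i; apply: NNPP => h'; apply: h; exists i.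
  elim/ltn_ind: i ni => i IH ni.
  case: (classic (exists2 j, (j < i)%N & ~ divides q f'`_j)) => [[j ji nj]|no]; first exact: IH nj.
  by exists i => // j ji; apply: NNPP => nj; apply: no; exists j.
have [i ni li] := ex f nf; have [j nj lj] := ex g ng.
have : divides q (f`_i * g`_j).
  have := dv (i + j)%N; rewrite coefM (bigD1 (inord i)) //= inordK ?ltnS ?leq_addr //.
  rewrite addKn => -[t et].
  have [t' et'] : divides q (\sum_(x < (i + j).+1 | x != inord i) f`_x * g`_(i + j - x)).
    elim/big_ind: _ => [|y z [c ->] [d ->]|x ne]; first by exists 0; rewrite mul0r.
      by exists (c + d); rewrite mulrDl.
    have [xi|xi] := ltnP x i; first by apply: divides_mulr; apply: li.
    have {}xi : (i < x)%N.
      rewrite ltn_neqAle xi andbT; apply: contra ne => /eqP e.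
      by apply/eqP/val_inj; rewrite /= inordK ?ltnS ?leq_addr.
    apply: divides_mull; apply: lj; rewrite ltn_subLR; last by rewrite -ltnS.
    by rewrite ltn_add2r.
  by exists (t - t'); rewrite mulrBl -et -et' addrK.
by case/pr.
Qed.

Hypothesis RF : factorial R.

Definition primitive_elt f := forall q : R, prime_elt q -> ~ divides q%:P f.

Lemma primitive_part f : f != 0 -> exists (c : R) g, [/\ c != 0, f = c *: g & primitive_elt g].
Proof.
move=> f0; have lf0 : lead_coef f != 0 by rewrite lead_coef_eq0.
have [u [s [uu sP]]] := RF lf0.
have [n] := ubnP (size s); elim: n s u f f0 {lf0} uu sP => // n IH s u f f0 uu sP lt e.
case: (classic (primitive_elt f)) => [pf|npf]; first by exists 1, f; rewrite oner_neq0 scale1r.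
have [q qP [g eg]] : exists2 q : R, prime_elt q & divides q%:P f.
  by apply: NNPP => h; apply: npf => q qP dv; apply: h; exists q.
have q0 : q != 0 by case: qP.
have g0 : g != 0 by apply: contraNneq f0 => g0; rewrite eg g0 mul0r.
have elead : lead_coef f = lead_coef g * q by rewrite eg lead_coefM lead_coefC.
have [r rs qr] : exists2 r, r \in s & divides q r.
  by apply: (prime_divides_prod qP uu); rewrite -e elead; exists (lead_coef g).
have rP := sP _ rs; have r0 : r != 0 by case: rP.
have [v' ev'] := prime_divides_assoc qP rP qr; case: qr => v ev.
have vu : v \is a GRing.unit.
  apply/unitrPr; exists v'; apply: (mulIf r0); rewrite mul1r -mulrA -ev'.
  by rewrite -ev.
have [||||c [g1 [c0 eg1 pg1]]] := IH (rem r s) (u * v) g g0.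
- by rewrite unitrM uu.
- by move=> x /mem_rem; apply: sP.
- by rewrite -ltnS; apply: leq_trans lt; rewrite ltnS size_rem // prednK //; case: (s) rs.
- apply: (mulIf q0); rewrite -elead e (big_rem r) //= {1}ev.
  by rewrite -!mulrA; congr (_ * (_ * _)); rewrite mulrC.
exists (q * c), g1; rewrite mulf_neq0 //; split=> //.
by rewrite eg eg1 -scalerA mulrC mul_polyC.
Qed.

Lemma primitive_divides g (r : R) f : primitive_elt g -> r != 0 ->
  divides g (r *: f) -> divides g f.
Proof.
move=> pg r0; have [u [s [uu sP ->]]] := RF r0 => {r0}.
elim: s sP => [|q s IH] sP.
  rewrite big_nil mulr1 => -[t et]; exists (u^-1 *: t).
  by rewrite -scalerAl -et scalerA mulVr // scale1r.
rewrite big_cons mulrCA -scalerA => -[t et].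
have qP : prime_elt q by apply: sP; rewrite mem_head.
have [_ _ pr] := prime_polyC qP.
have dvt : divides q%:P (t * g).
  by exists ((u * \prod_(j <- s) j) *: f); rewrite -et -mul_polyC mulrC.
case: (pr t g dvt) => [[t' et']|dg]; last by case: (pg q qP dg).
apply: IH; first by move=> y ys; apply: sP; rewrite inE ys orbT.
exists t'; have q0 : q%:P != 0 by case: (prime_polyC qP).
by apply: (mulfI q0); rewrite mul_polyC et et' mulrA [q%:P * t']mulrC.
Qed.

Lemma primitive_dvdp g f : primitive_elt g -> (g %| f)%R -> divides g f.
Proof.
move=> pg /Pdiv.Idomain.dvdpP [[c q] /= c0 e]; apply: (primitive_divides pg c0).
by exists q.
Qed.

Lemma factorial_poly : factorial {poly R}.
Proof.
move=> f; have [n] := ubnP (size f); elim: n f => // n IH f lt f0.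
have [sf|sf] := leqP (size f) 1.
  have [a0 ef] : exists a, f = a%:P by exists f`_0; apply: size1_polyC.
  have a00 : a0 != 0 by move: f0; rewrite ef polyC_eq0.
  have [u [s [uu sP e]]] := RF a00.
  exists u%:P, [seq q%:P | q <- s]; split.
    have u0 : u != 0 by apply: contraTneq uu => ->; rewrite unitr0.
    by rewrite poly_unitE size_polyC u0 coefC.
    by move=> _ /mapP [q qs ->]; apply: prime_polyC; apply: sP.
  by rewrite big_map ef e polyCM rmorph_prod.
(* Here [%|] is divisibility up to a nonzero constant, so a non-constant divisor of least size is
   irreducible over the fraction field, and its primitive part is prime. *)
have [g [gs gf gmin]] : exists g, [/\ (1 < size g)%N, g %| f & forall g', (1 < size g')%N -> g' %| f -> (size g <= size g')%N].
  suff H n' g : (size g < n')%N -> (1 < size g)%N -> g %| f ->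
      exists g, [/\ (1 < size g)%N, g %| f &
        forall g', (1 < size g')%N -> g' %| f -> (size g <= size g')%N].
    exact: (H (size f).+1 f).
  elim: n' g => // n' IH' g lt' sg gf.
  case: (classic (exists g', [/\ (1 < size g')%N, g' %| f & (size g' < size g)%N])) => [[g' [s1 d1 l1]]|no].
    by apply: (IH' g') => //; apply: leq_trans l1 lt'.
  by exists g; split=> // g' s' d'; rewrite leqNgt; apply/negP => l'; apply: no; exists g'.
have g0 : g != 0 by rewrite -size_poly_gt0 ltnW.
have [c [g1 [c0 eg pg1]]] := primitive_part g0.
have sg1 : size g1 = size g by rewrite eg size_scale.
have g10 : g1 != 0 by rewrite -size_poly_gt0 sg1 ltnW.
have g1f : g1 %| f by apply: dvdp_trans gf; rewrite eg dvdpZr // dvdpp.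
have g1P : prime_elt g1.
  split=> //.
    by rewrite poly_unitE sg1; case: eqP gs => // ->.
  move=> a b [t et]; have dv : g1 %| a * b by rewrite et dvdp_mull // dvdpp.
  case: (boolP (coprimep g1 a)) => [cop|].
    by right; apply: primitive_dvdp => //; rewrite -(Gauss_dvdpr b cop).
  rewrite coprimep_def => nco; left; apply: primitive_dvdp => //.
  have dg := dvdp_gcdl g1 a.
  have dn0 : gcdp g1 a != 0 by rewrite gcdp_eq0 (negPf g10).
  have s1 : (1 < size (gcdp g1 a))%N.
    by rewrite ltn_neqAle eq_sym nco size_poly_gt0.
  have le := gmin _ s1 (dvdp_trans dg g1f).
  have : size (gcdp g1 a) == size g1 by rewrite eqn_leq dvdp_leq //= sg1.
  rewrite dvdp_size_eqp // => /eqp_dvdl <-; exact: dvdp_gcdr.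
have [t et] := primitive_dvdp pg1 g1f.
have t0 : t != 0 by apply: contraNneq f0 => t0; rewrite et t0 mul0r.
have [||u [s [uu sP es]]] := IH t => //.
  rewrite -ltnS; apply: leq_trans lt; rewrite ltnS et size_mul // sg1.
  by case: (size g) gs => [|[|x]] // _; rewrite addnS /= addnS ltnS leq_addr.
exists u, (g1 :: s); split=> //.
  by move=> q; rewrite inE => /orP[/eqP->|/sP].
by rewrite big_cons et es mulrC mulrCA.
Qed.

End FactorialPoly.

Lemma factorial_iso (R R' : idomainType) (f : {rmorphism R -> R'}) (g : {rmorphism R' -> R}) :
  cancel f g -> cancel g f -> factorial R' -> factorial R.
Proof.
move=> fK gK RF a a0.
have f0 : f a != 0 by apply: contraNneq a0 => fa; rewrite -(fK a) fa rmorph0.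
have [u [s [uu sP e]]] := RF _ f0.
have dv x y : divides x (f y) -> divides (g x) y.
  by case=> c ec; exists (g c); rewrite -[y]fK ec rmorphM.
have dv' x y : divides (g x) y -> divides x (f y).
  by case=> c ->; exists (f c); rewrite rmorphM gK.
exists (g u), [seq g q | q <- s]; split.
- exact: rmorph_unit.
- move=> _ /mapP [q qs ->]; have [q0 qu pr] := sP _ qs; split.
  + by apply: contraNneq q0 => gq; rewrite -(gK q) gq rmorph0.
  + by apply: contra qu => gqu; rewrite -(gK q) rmorph_unit.
  + by move=> x y /dv'; rewrite rmorphM => /pr [/dv|/dv]; [left | right].
by rewrite big_map -rmorph_prod -rmorphM -e fK.
Qed.

Section FactorialMpoly.
Variable E : fieldType.

Definition mun (n : nat) : {poly {mpoly E[n]}} -> {mpoly E[n.+1]} :=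
  horner_morph (fun x => mulrC ('X_ord_max) (mwiden x)).
HB.instance Definition _ n := GRing.RMorphism.on (@mun n).

Lemma muniX n m : muni 'X_[E, m] =
  'X_[[multinom (m (widen_ord (leqnSn n) i)) | i < n]] *: 'X^(m ord_max).
Proof. by rewrite muniE msuppX big_seq1 mcoeffX eqxx scale1r. Qed.

Lemma mun_muni n : cancel (@muni n E) (@mun n).
Proof.
move=> q; elim/mpolyind: q => [|c m q _ _ IH]; first by rewrite !rmorph0.
rewrite muniD [LHS]rmorphD; congr (_ + _); last exact: IH.
rewrite muniZ muniX -!mul_polyC.
rewrite !rmorphM /=.
rewrite rmorphXn /= /mun /horner_morph.
rewrite !map_polyC /= map_polyX !hornerE mwidenC /= -mulrA mul_mpolyC; congr (_ *: _).
rewrite mwidenX mpolyXn -mpolyXD; congr 'X_[_]; apply/mnmP => i.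
rewrite mnmDE mulmnE mnm1E.
have [<-|ne] := eqVneq ord_max i; first by rewrite mnmwiden_ordmax mul1n.
have lt : (i < n)%N.
  rewrite ltn_neqAle -ltnS ltn_ord andbT; apply: contra ne => /eqP e.
  by apply/eqP/val_inj.
have -> : i = widen_ord (leqnSn n) (Ordinal lt) by apply: val_inj.
by rewrite mnmwiden_widen mnmE mul0n addn0.
Qed.

Lemma muni_mun n : cancel (@mun n) (@muni n E).
Proof.
move=> q; elim/poly_ind: q => [|q c IH]; first by rewrite !rmorph0.
rewrite rmorphD rmorphM /= rmorphD rmorphM /= IH; congr (_ * _ + _).
  rewrite /mun /horner_morph map_polyX hornerX muniX mnm1E eqxx expr1.
  rewrite (_ : [multinom _ | i < n] = 0%MM) ?mpolyX0 ?scale1r //.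
  apply/mnmP => i; rewrite mnmE mnm1E mnm0E; case: eqP => // /(congr1 val) /= e.
  by have := ltn_ord i; rewrite -e ltnn.
rewrite /mun /horner_morph map_polyC hornerC /=.
elim/mpolyind: c => [|c m r _ _ IHr]; first by rewrite !rmorph0.
rewrite mwidenD muniD IHr polyCD; congr (_ + _).
rewrite mwidenZ mwidenX muniZ muniX mnmwiden_ordmax expr0.
rewrite (_ : [multinom _ | i < n] = m); last by apply/mnmP => i; rewrite mnmE mnmwiden_widen.
by rewrite -mul_mpolyC polyCM -!mul_polyC mulr1.
Qed.

Lemma factorial_mpoly n : factorial {mpoly E[n]}.
Proof.
elim: n => [|n IH].
  move=> a a0; exists a, [::]; split=> //; last by rewrite big_nil mulr1.
  have e : a = (a@_0)%:MP.
    by apply/mpolyP => m; rewrite mcoeffC; have -> : m = 0%MM; [apply/mnmP => -[] | rewrite eqxx mulr1].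
  have c0 : a@_0 != 0 by apply: contraNneq a0 => c0; rewrite e c0 mpolyC0.
  by apply/unitrPr; exists (a@_0)^-1%:MP; rewrite {1}e -mpolyCM mulfV.
apply: (@factorial_iso _ _ (@muni n E) (@mun n)); [exact: mun_muni | exact: muni_mun |].
exact: factorial_poly.
Qed.

(** The family may be infinite. [S d] says that common divisors of the family divide [d], also after
    scaling. An element of least size with this property divides each member f: its [strong_gcd]
    with f again satisfies [S], so it has the same size and differs only by a constant. *)
Lemma gcd_family n (I : {mpoly E[n]} -> Prop) f0 : I f0 -> f0 != 0 ->
  exists d, [/\ d != 0, forall f, I f -> divides d f &
    forall h c, (forall f, I f -> divides h (c * f)) -> divides h (c * d)].
Proof.
move=> If0 f00.
pose S (d : {mpoly E[n]}) := d != 0 /\ forall h c, (forall f, I f -> divides h (c * f)) -> divides h (c * d).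
have Sf0 : S f0 by split=> // h c; apply.
have [d [[d0 dP] dmin]] : exists d, S d /\ forall d', S d' -> (msize d <= msize d')%N.
  have [N] := ubnP (msize f0); elim: N f0 Sf0 {If0 f00} => // N IH f Sf lt.
  case: (classic (exists2 d', S d' & (msize d' < msize f)%N)) => [[d' Sd' lt']|no].
    by apply: (IH d') => //; apply: leq_trans lt' _; rewrite -ltnS.
  by exists f; split=> // d' Sd'; rewrite leqNgt; apply/negP => l; apply: no; exists d'.
exists d; split=> // f If.
have [e [[t et] ef eP]] := strong_gcd (@factorial_mpoly n) f d0.
have e0 : e != 0 by apply: contraNneq d0 => e0; rewrite et e0 mulr0.
have t0 : t != 0 by apply: contraNneq d0 => t0; rewrite et t0 mul0r.
have Se : S e by split=> // h c hI; apply: eP; [apply: dP | apply: hI].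
have := dmin _ Se; rewrite et msizeM //.
have : (0 < msize t)%N by rewrite lt0n msize_poly_eq0.
have : (0 < msize e)%N by rewrite lt0n msize_poly_eq0.
case: (posnP (msize t).-1) => [t1 _ tg _|tg1 eg tg]; last first.
  by rewrite leqNgt -(prednK tg) addSn /= -{1}[msize e]add0n ltn_add2r tg1.
have /msize_poly1P [c c0 ->] : msize t == 1%N by rewrite -(prednK tg) t1.
case: ef => y ->; exists (y * c^-1%:MP); rewrite -!mulrA; congr (_ * _).
by rewrite mulrA -mpolyCM mulVf // mpolyC1 mul1r.
Qed.

End FactorialMpoly.

(** * Polynomial matrices and the twist [Psi] *)

Notation cmx := (map_mx (@mpolyC _ _)).

Section MpolyMatrix.
Variables (E : fieldType) (n m q : nat).
Local Notation R := {mpoly E[n]}.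

Lemma mpoly_mx_ind (P : 'M[R]_(m, q) -> Prop) :
  P 0 -> (forall a b, P a -> P b -> P (a + b)) ->
  (forall mu (a : 'M[E]_(m, q)), P ('X_[mu] *: cmx a)) -> forall b, P b.
Proof.
move=> P0 PD PX b; rewrite (matrix_sum_delta b).
elim/big_ind: _ => // i _; elim/big_ind: _ => // j _.
elim/mpolyind: (b i j) => [|c mu f _ _ Pf]; first by rewrite scale0r.
rewrite scalerDl; apply: PD => //.
have -> : (c *: 'X_[mu]) *: delta_mx i j = 'X_[mu] *: cmx (c *: delta_mx i j) :> 'M[R]_(m, q).
  apply/matrixP => x y; rewrite !mxE mpolyCM rmorph_nat mulrA; congr (_ * _).
  by rewrite -mul_mpolyC mulrC.
exact: PX.
Qed.

End MpolyMatrix.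

(* Psi (x^mu b) = x^mu r^mu b: this intertwines the operator opR below with the commutator
   with xi. *)
HB.lock Definition Psi (E : fieldType) (n m : nat) (r : 'I_n -> 'M[E]_m.+1)
    (b : 'M[{mpoly E[n]}]_m.+1) : 'M[{mpoly E[n]}]_m.+1 :=
  \sum_i \sum_j
    mmap (@scalar_mx _ m.+1 \o @mpolyC n E) (fun i => 'X_i *: cmx (r i)) (b i j) *m delta_mx i j.

Section Psi.
Variables (E : fieldType) (n m : nat).
Local Notation R := {mpoly E[n]}.
Local Notation MR := 'M[R]_m.+1.

Definition mprod (r : 'I_n -> 'M[E]_m.+1) (mu : 'X_{1..n}) := \prod_i r i ^+ mu i.

Lemma mprodD r mu nu : (forall i j, r i * r j = r j * r i) ->
  mprod r (mu + nu)%MM = mprod r mu * mprod r nu.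
Proof.
move=> comm; rewrite /mprod -prodrM_comm; last by move=> i j _ _; apply: commrX; apply/commr_sym/commrX; apply: comm.
by apply: eq_bigr => i _; rewrite mnmDE exprD.
Qed.

Lemma mprodU r i : mprod r U_(i)%MM = r i.
Proof.
exact: mmap1U.
Qed.

Lemma mprod_comm r c mu : (forall i, c * r i = r i * c) -> c * mprod r mu = mprod r mu * c.
Proof. by move=> h; apply: commr_prod => i _; apply: commrX; apply: h. Qed.

Section OnePsi.
Variable r : 'I_n -> 'M[E]_m.+1.

Definition sgma : R -> MR :=
  mmap (@scalar_mx _ m.+1 \o @mpolyC n E) (fun i => 'X_i *: cmx (r i)).

Local Notation Psi := (Psi r).

Lemma PsiE b : Psi b = \sum_i \sum_j sgma (b i j) *m delta_mx i j.
Proof. by rewrite unlock. Qed.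

Lemma sgma_is_additive : zmod_morphism sgma.
Proof. by move=> x y; rewrite /sgma raddfB. Qed.
HB.instance Definition _ := GRing.isZmodMorphism.Build R MR sgma sgma_is_additive.

Lemma Psi_is_additive : zmod_morphism Psi.
Proof.
move=> a b; rewrite !PsiE -sumrB; apply: eq_bigr => i _; rewrite -sumrB; apply: eq_bigr => j _.
by rewrite !mxE raddfB /= mulmxBl.
Qed.
HB.instance Definition _ := GRing.isZmodMorphism.Build MR MR Psi Psi_is_additive.

Lemma PsiD a b : Psi (a + b) = Psi a + Psi b.
Proof. exact: raddfD. Qed.

Lemma Psi0 : Psi 0 = 0.
Proof. exact: raddf0. Qed.

Lemma PsiX mu a : Psi ('X_[mu] *: cmx a) = 'X_[mu] *: cmx (mprod r mu *m a).
Proof.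
have h1 : mmap1 (fun i => 'X_i *: cmx (r i)) mu = 'X_[mu] *: cmx (mprod r mu) :> MR.
  rewrite /mmap1 /mprod mpolyXE_id rmorph_prod /=.
  elim/big_rec3: _ => [|i x y z _ ->]; first by rewrite scale1r.
  by rewrite exprZmx rmorphXn /= -!mulmxE -scalemxAl -scalemxAr scalerA.
rewrite PsiE map_mxM /= [X in _ *: (_ *m X)](matrix_sum_delta (cmx a)) mulmx_sumr scaler_sumr.
apply: eq_bigr => i _; rewrite mulmx_sumr scaler_sumr; apply: eq_bigr => j _.
rewrite !mxE [X in sgma X]mulrC mul_mpolyC /sgma mmapZ mmapX h1 /= -mulmxE mul_scalar_mx.
by rewrite -!scalemxAl -scalemxAr !scalerA [_ * 'X_[mu]]mulrC.
Qed.

Hypothesis rC : forall i j, r i * r j = r j * r i.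

Lemma Psi_mulr b c : Psi (b *m cmx c) = Psi b *m cmx c.
Proof.
elim/mpoly_mx_ind: b => [|a b ea eb|mu a]; first by rewrite mul0mx Psi0 mul0mx.
  by rewrite mulmxDl !PsiD ea eb mulmxDl.
by rewrite -scalemxAl -map_mxM !PsiX /= -scalemxAl -map_mxM mulmxA.
Qed.

Lemma Psi_mull b c : (forall i, c * r i = r i * c) -> Psi (cmx c *m b) = cmx c *m Psi b.
Proof.
move=> cr; elim/mpoly_mx_ind: b => [|a b ea eb|mu a]; first by rewrite mulmx0 Psi0 mulmx0.
  by rewrite mulmxDr !PsiD ea eb mulmxDr.
rewrite -scalemxAr -map_mxM !PsiX /= -scalemxAr -map_mxM; congr (_ *: cmx _).
by rewrite !mulmxA mulmxE (mprod_comm _ cr).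
Qed.

(** [Psi] is not linear over polynomials: a scalar [f] comes out as the matrix [Psi f%:M], a
    polynomial in the commuting products x_i r_i. *)
Lemma Psi_scale f b : Psi (f *: b) = Psi f%:M *m Psi b.
Proof.
elim/mpolyind: f => [|c mu f _ _ IH].
  by rewrite scale0r (raddf0 (@scalar_mx R m.+1)) Psi0 mul0mx.
rewrite scalerDl PsiD IH (raddfD (@scalar_mx R m.+1)) /= PsiD mulmxDl.
congr (_ + _); clear IH.
elim/mpoly_mx_ind: b => [|a b ea eb|nu a]; first by rewrite scaler0 Psi0 mulmx0.
  by rewrite scalerDr !PsiD ea eb mulmxDr.
have e t (d : 'M[E]_m.+1) : (c *: 'X_[t]) *: cmx d = 'X_[t] *: cmx (c *: d).
  by apply/matrixP => i j; rewrite !mxE mpolyCM mulrA -mul_mpolyC [c%:MP * _]mulrC.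
have -> : (c *: 'X_[mu])%:M = 'X_[mu] *: cmx (c *: 1%:M) :> MR.
  by rewrite -e map_mx1 scalemx1.
have gen (u v : R) (A B : MR) : (u *: A) *m (v *: B) = (u * v) *: (A *m B).
  by rewrite -scalemxAl -scalemxAr scalerA.
rewrite scalerA -scalerAl -mpolyXD e !PsiX gen -mpolyXD -map_mxM.
congr (_ *: cmx _); rewrite mprodD // -!scalemxAr -scalemxAl mulmx1 -mulmxE !mulmxA.
by [].
Qed.

Lemma Psi_scalar_comm f g : Psi f%:M *m Psi g%:M = Psi g%:M *m Psi f%:M.
Proof.
have e u v : Psi u%:M *m Psi v%:M = Psi (u * v)%:M.
  by apply: etrans (esym (Psi_scale u v%:M)) _; congr Psi; apply: scale_scalar_mx.
exact: etrans (e f g) (etrans (congr1 (fun t => Psi t%:M) (mulrC f g)) (esym (e g f))).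
Qed.

Variable p : nat.
Hypotheses (pE : p \in [pchar E]) (rp : forall i, r i ^+ p = 1).

(** A twisted scalar need not be scalar, but its p-th power is; over the fraction field it is
    therefore inverted by a multiple of its (p-1)-th power when [f] is nonzero. *)
Lemma Psi_scalar_exp f : Psi f%:M ^+ p = (f ^+ p)%:M.
Proof.
have p_pr : prime p by case/andP: pE.
have pR : p%:R = 0 :> R by rewrite -mpolyC_nat pcharf0 // mpolyC0.
have pM : p%:R = 0 :> MR by rewrite -scaler_nat pR scale0r.
elim/mpolyind: f => [|c mu f _ _ IH].
  by rewrite (raddf0 (@scalar_mx R m.+1)) Psi0 !expr0n eqn0Ngt prime_gt0 //= (raddf0 (@scalar_mx R m.+1)).
rewrite (raddfD (@scalar_mx R m.+1)) /= PsiD.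
rewrite (exprDp_comm p_pr pM (Psi_scalar_comm (c *: 'X_[mu]) f)).
rewrite IH.
have cf : GRing.comm (c *: 'X_[mu]) f by apply: mulrC.
have ef := exprDp_comm p_pr pR cf.
rewrite ef.
rewrite (raddfD (@scalar_mx R m.+1)) /=; congr (_ + _).
have e : (c *: 'X_[mu])%:M = 'X_[mu] *: cmx (c *: 1%:M) :> MR.
  by apply/matrixP => i j; rewrite !mxE mpolyCM mulrA -mul_mpolyC [c%:MP * _]mulrC rmorph_nat mulr_natr.
rewrite e PsiX -scalemxAr mulmx1.
have -> : 'X_[mu] *: cmx (c *: mprod r mu) = (c *: 'X_[mu]) *: cmx (mprod r mu) :> MR.
  by apply/matrixP => i j; rewrite !mxE mpolyCM mulrA -mul_mpolyC [c%:MP * _]mulrC.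
rewrite exprZmx -rmorphXn /=.
have -> : mprod r mu ^+ p = 1.
  rewrite /mprod; elim: (index_enum _) => [|i s IHs]; first by rewrite big_nil expr1n.
  rewrite big_cons exprMn_comm ?IHs ?mulr1.
    by rewrite -exprM mulnC exprM rp expr1n.
  by apply: commr_prod => j _; apply: commrX; apply/commr_sym/commrX; apply: rC.
by rewrite rmorph1 scalemx1.
Qed.

End OnePsi.

Lemma PsiK (r r' : 'I_n -> 'M[E]_m.+1) :
  (forall i j, r' i * r j = r j * r' i) -> (forall i, r' i * r i = 1) ->
  cancel (Psi r) (Psi r').
Proof.
move=> comm rV b; elim/mpoly_mx_ind: b => [|a b ea eb|mu a]; first by rewrite !Psi0.
  by rewrite !PsiD ea eb.
rewrite !PsiX mulmxA; congr (_ *: cmx _).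
have -> : mprod r' mu *m mprod r mu = 1%:M; last by rewrite mul1mx.
rewrite mulmxE /mprod -prodrM_comm.
  rewrite big1 // => i _; have ci : GRing.comm (r' i) (r i) := comm i i.
  by rewrite -(exprMn_comm _ ci) rV expr1n.
by move=> i j _ _; apply: commrX; apply/commr_sym/commrX; apply/commr_sym/comm.
Qed.

End Psi.

(** * The generic Brauer homomorphism over the fraction field *)

Section Fractions.
Variable R : idomainType.
Import FracField.

Lemma frac_repr (f : {fraction R}) : exists a d : R, d != 0 /\ tofrac d * f = tofrac a.
Proof.
pose r := generic_quotient.repr f; exists (\n_r), (\d_r); split; first exact: denom_ratioP.
rewrite -[f]reprK -/r; unlock tofrac; rewrite -[LHS]pi_mul.
apply/eqmodP; rewrite /= equivfE /mulf !numden_Ratio ?oner_neq0 ?mul1r ?mulr1 ?denom_ratioP //.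
Qed.

Lemma clear_denoms r q (a : 'M[{fraction R}]_(r, q)) :
  exists (d : R) (b : 'M[R]_(r, q)), d != 0 /\ tofrac d *: a = map_mx (@tofrac R) b.
Proof.
have [c cP] := fin_all_exists (fun ij : 'I_r * 'I_q => frac_repr (a ij.1 ij.2)).
have [d dP] := fin_all_exists cP.
pose D := \prod_ij d ij.
have /fin_all_exists [b bP] : forall ij : 'I_r * 'I_q, exists b, tofrac D * a ij.1 ij.2 = tofrac b.
  move=> ij; rewrite /D (bigD1 ij) //=; set e := \prod_(_ | _) _.
  by exists (e * c ij); rewrite [d ij * e]mulrC !rmorphM /= -mulrA; case: (dP ij) => _ ->.
exists D, (\matrix_(i, j) b (i, j)); split.
  by apply/prodf_neq0 => ij _; case: (dP ij).
by apply/matrixP => i j; rewrite !mxE (bP (i, j)).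
Qed.

End Fractions.

Section GenericStep.
Variables (p : nat) (gT : finGroupType) (E : fieldType) (n m : nat).
Hypothesis pE : p \in [pchar E].
Local Notation R := {mpoly E[n]}.
Local Notation F := {fraction {mpoly E[n]}}.
Local Notation tfm := (map_mx (@tofrac R)).

Definition iF : E -> F := @tofrac R \o @mpolyC n E.
HB.instance Definition _ := GRing.RMorphism.on iF.

Variables (Z : {group gT}) (zz : 'I_n -> gT) (rho : gT -> 'M[E]_m.+1) (I : finType)
  (X Y : I -> 'M[E]_m.+1).
Hypotheses (pZ : (p.-group Z)%g) (zzZ : forall i, zz i \in Z)
  (rhoE : elem_rep p Z zz rho) (XY : dual_bases X Y) (permX : perm_fam Z rho X).

Definition rhoF g := map_mx iF (rho g).
Definition XF i := map_mx iF (X i).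
Definition YF i := map_mx iF (Y i).
Definition xF (i : 'I_n) : F := tofrac ('X_i : R).

Lemma pcharF : p \in [pchar F].
Proof. exact: (rmorph_pchar iF pE). Qed.

Lemma elem_repF : elem_rep p Z zz rhoF.
Proof.
case: rhoE => -[r1 rM] rp comm surj; split.
- split=> [|y z yZ zZ]; first by rewrite /rhoF r1 map_mx1.
  by rewrite /rhoF rM // map_mxM.
- by move=> z zZ; rewrite /rhoF -rmorphXn /= rp // rmorph1.
- by move=> y z yZ zZ; rewrite /rhoF -!map_mxM comm.
by move=> z zZ; have [i e] := surj z zZ; exists i; rewrite /rhoF e.
Qed.

Lemma dual_basesF : dual_bases XF YF.
Proof.
split=> [i j|a]; first by rewrite -map_mxM trace_map_mx (proj1 XY) rmorph_nat.
pose L b := \sum_i \tr (b *m YF i) *: XF i.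
have LD b c : L (b + c) = L b + L c.
  rewrite /L -big_split; apply: eq_bigr => i _ /=.
  by rewrite mulmxDl raddfD /= scalerDl.
have LZ t b : L (t *: b) = t *: L b.
  rewrite /L scaler_sumr; apply: eq_bigr => i _.
  by rewrite -scalemxAl mxtraceZ scalerA.
have L0 : L 0 = 0 by rewrite -(scale0r 0) LZ !scale0r.
have Ld x y : L (delta_mx x y) = delta_mx x y.
  rewrite -[RHS](map_delta_mx iF) [in RHS](proj2 XY (delta_mx x y)) raddf_sum.
  apply: eq_bigr => i _ /=; rewrite map_mxZ -trace_map_mx map_mxM map_delta_mx.
  by [].
rewrite -[RHS]/(L a) {1 2}(matrix_sum_delta a) (big_morph L LD L0); apply: eq_bigr => x _.
by rewrite (big_morph L LD L0); apply: eq_bigr => y _; rewrite LZ Ld.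
Qed.

Lemma rconjF g a : rconj rhoF g (map_mx iF a) = map_mx iF (rconj rho g a).
Proof. by rewrite /rconj /rhoF !map_mxM. Qed.

Lemma perm_famF : perm_fam Z rhoF XF.
Proof.
move=> g i gZ; have [j e] := permX i gZ; exists j.
by rewrite /XF rconjF e.
Qed.

Lemma x_indepF (chi : 'I_n -> nat) : (exists i, ~~ (p %| chi i)%N) ->
  \sum_i xF i * (chi i)%:R != 0.
Proof.
case=> i0 nd.
have -> : \sum_i xF i * (chi i)%:R = tofrac (\sum_i ((chi i)%:R : E) *: 'X_i : R).
  rewrite rmorph_sum; apply: eq_bigr => i _ /=; rewrite -mul_mpolyC rmorphM mulrC /=.
  by rewrite mpolyC_nat rmorph_nat.
rewrite tofrac_eq0; apply/eqP => /(congr1 (mcoeff U_(i0)%MM)); rewrite mcoeff0 raddf_sum /=.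
rewrite (bigD1 i0) //= mcoeffZ mcoeffX eqxx mulr1 big1 ?addr0 => [/eqP|i ne].
  by rewrite -(dvdn_pcharf pE) (negPf nd).
rewrite mcoeffZ mcoeffX; case: eqP => [e|]; last by rewrite mulr0.
by move/mnmP: e => /(_ i); rewrite !mnm1E eqxx eq_sym (negPf ne).
Qed.

Definition xiR : 'M[R]_m.+1 := \sum_i 'X_i *: (cmx (rho (zz i)) - 1%:M).
Definition xi : 'M[F]_m.+1 := generic_elt xF zz rhoF.

Lemma xi_xiR : xi = tfm xiR.
Proof.
rewrite /xi /generic_elt /xiR raddf_sum; apply: eq_bigr => i _ /=.
rewrite map_mxZ map_mxB map_mx1 /rhoF; congr (_ *: (_ - _)).
by rewrite -map_mx_comp.
Qed.

Let r i := rho (zz i).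
Let rV i := rho (zz i)^-1%g.

Let rhoP : is_rep Z rho. Proof. by case: rhoE. Qed.
Let rC i j : r i * r j = r j * r i.
Proof. by case: rhoE => _ _ comm _; rewrite -!mulmxE; apply: comm. Qed.
Let rVC i j : rV i * r j = r j * rV i.
Proof. by case: rhoE => _ _ comm _; rewrite -!mulmxE; apply: comm; rewrite ?groupV. Qed.
Let rVr i : rV i * r i = 1. Proof. by rewrite -mulmxE (repV rhoP). Qed.
Let rrV i : r i * rV i = 1. Proof. by rewrite -mulmxE (rep_V rhoP). Qed.

(** The integral form of [generic_op], since [Psi] is defined on polynomial matrices only. *)
Definition opR (b : 'M[R]_m.+1) :=
  \sum_i 'X_i *: (cmx (rV i) *m b *m cmx (r i) - b).

(** The twist contributes one factor r_i for each X_i. It cancels [rV i] in the conjugate and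
    becomes the left factor of the other term. *)
Lemma Psi_opR b : Psi r (opR b) = Psi r b *m xiR - xiR *m Psi r b.
Proof.
have PsiN a : Psi r (- a) = - Psi r a by rewrite raddfN.
rewrite /opR /xiR mulmx_sumr mulmx_suml -sumrB.
rewrite (big_morph (Psi r) (@PsiD _ _ _ r) (@Psi0 _ _ _ r)); apply: eq_bigr => i _.
rewrite Psi_scale //.
have -> : Psi r ('X_i)%:M = 'X_i *: cmx (r i).
  by rewrite -scalemx1 -(map_mx1 (@mpolyC n E)) PsiX mulmx1 mprodU.
rewrite PsiD PsiN Psi_mulr Psi_mull // -scalemxAl mulmxBr !mulmxA -map_mxM (rrV i : r i *m rV i = 1%:M).
rewrite map_mx1 mul1mx; move: (Psi r b) (cmx (r i)) ('X_i) => P c t.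
rewrite -(scalemxAr t P) -(scalemxAl t _ P) -scalerBr; congr (_ *: _).
by rewrite mulmxBr mulmxBl mulmx1 mul1mx opprB addrA addrNK.
Qed.

Lemma tf_cmx r' q (a : 'M[E]_(r', q)) : tfm (cmx a) = map_mx iF a.
Proof. by apply/matrixP => i j; rewrite !mxE. Qed.

Lemma opR_op b : tfm (opR b) = generic_op xF zz rhoF (tfm b).
Proof.
rewrite /opR /generic_op raddf_sum; apply: eq_bigr => i _.
by rewrite [LHS]map_mxZ map_mxB map_mxM map_mxM !tf_cmx.
Qed.

Lemma opR_iter j b : tfm (iter j opR b) = iter j (generic_op xF zz rhoF) (tfm b).
Proof. by elim: j => // j IH; rewrite !iterS opR_op IH. Qed.

Lemma tfm_inj r' q : injective (fun b : 'M[R]_(r', q) => map_mx (@tofrac R) b).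
Proof.
move=> a b /matrixP e; apply/matrixP => i j; apply/eqP.
by rewrite -tofrac_eq; apply/eqP; have := e i j; rewrite !mxE.
Qed.

Lemma generic_opZ c b : generic_op xF zz rhoF (c *: b) = c *: generic_op xF zz rhoF b.
Proof.
rewrite /generic_op scaler_sumr; apply: eq_bigr => i _.
by rewrite rconjZ -scalerBr scalerA mulrC -scalerA.
Qed.

Lemma generic_op_iterZ j c b :
  iter j (generic_op xF zz rhoF) (c *: b) = c *: iter j (generic_op xF zz rhoF) b.
Proof. by elim: j => // j IH; rewrite !iterS IH generic_opZ. Qed.

(** Through [Psi] the centraliser of [xi] corresponds to the kernel of the conjugation operator,
    which [generic_op_kernel] describes over the fraction field. *)
Lemma generic_cent a : a *m xi = xi *m a ->
  exists a0 a1, centmx rhoF Z a0 /\ a = a0 + casimir p xi a1.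
Proof.
move=> ca; have p_pr : prime p by case/andP: pE.
have [d [A [d0 eA]]] := clear_denoms a.
have cA : A *m xiR = xiR *m A.
  by apply: tfm_inj; rewrite /= !map_mxM -xi_xiR -eA -scalemxAl -scalemxAr ca.
pose b := Psi rV A.
have eb : Psi r b = A by apply: PsiK => [i j|i]; [rewrite rVC | rewrite rrV].
have ub : opR b = 0.
  have K : cancel (Psi r) (Psi rV) by apply: PsiK.
  by rewrite -[opR b]K Psi_opR eb cA subrr Psi0.
have [b0 [b1 [cb0 e]]] := generic_op_kernel pcharF pZ zzZ x_indepF elem_repF dual_basesF perm_famF
  (b := tfm b) (etrans (esym (opR_op b)) (etrans (congr1 tfm ub) (map_mx0 _ _ _))).
have [d0' [B0 [d00 eB0]]] := clear_denoms b0.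
have [d1 [B1 [d10 eB1]]] := clear_denoms b1.
pose h := d0' * d1.
have h0 : h != 0 by rewrite mulf_neq0.
pose B0' := d1 *: B0; pose B1' := d0' *: B1.
have eh : h *: b = B0' + iter p.-1 opR B1'.
  apply: tfm_inj; rewrite /= map_mxZ map_mxD opR_iter /B0' /B1' !map_mxZ -eB0 -eB1.
  rewrite e scalerDr; congr (_ + _); first by rewrite scalerA -rmorphM mulrC.
  by rewrite scalerA -rmorphM generic_op_iterZ.
have cB0 g : g \in Z -> cmx (rho g) *m B0' = B0' *m cmx (rho g).
  move=> gZ; apply: tfm_inj; rewrite /= !map_mxM /B0' map_mxZ -eB0.
  rewrite -!scalemxAr -!scalemxAl; congr (_ *: (_ *: _)).
  by have := cb0 g gZ; rewrite /rhoF /iF map_mx_comp.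
(* Clearing the denominator [h] costs the matrix [S] on the other side of [Psi]. As [S ^+ p] is
   scalar, [V] below undoes both [S] and the denominator [d] of [a]; it commutes with [xi], so it
   moves inside the commutators. *)
pose S := Psi r h%:M.
have Sp : S ^+ p = (h ^+ p)%:M.
  by apply: (Psi_scalar_exp rC pE) => i; case: rhoE => _ zp _ _; apply: zp.
have SZ g : g \in Z -> cmx (rho g) *m S = S *m cmx (rho g).
  move=> gZ; rewrite -Psi_mull; last first.
    by case: rhoE => _ _ comm _ i; rewrite -!mulmxE; apply: comm.
  by rewrite -Psi_mulr mul_mx_scalar mul_scalar_mx.
have adPsi j c : Psi r (iter j opR c) = iter j (fun y => y *m xiR - xiR *m y) (Psi r c).
  by elim: j => // j IH; rewrite !iterS Psi_opR IH.
have main : S *m A = Psi r B0' + iter p.-1 (fun y => y *m xiR - xiR *m y) (Psi r B1').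
  by rewrite -eb -Psi_scale // eh PsiD adPsi.
pose SF := tfm S; pose c := tofrac (h ^+ p).
have c0 : c != 0 by rewrite tofrac_eq0 expf_neq0.
have SFp : SF ^+ p = c%:M by rewrite /SF -rmorphXn /= Sp map_scalar_mx.
have SFZ : centmx rhoF Z SF.
  move=> g gZ; rewrite /rhoF /iF map_mx_comp -!map_mxM /=; congr (map_mx _ _); exact: SZ.
have P0Z : centmx rhoF Z (tfm (Psi r B0')).
  move=> g gZ; rewrite /rhoF /iF map_mx_comp -!map_mxM /=; congr (map_mx _ _).
  rewrite -Psi_mull; first by rewrite cB0 // Psi_mulr.
  by case: rhoE => _ _ comm _ i; rewrite -!mulmxE; apply: comm.
pose V := (tofrac d * c)^-1 *: SF ^+ p.-1.
have VZ : centmx rhoF Z V.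
  apply: centZ => g gZ; rewrite mulmxE; apply/commr_sym/commr_sym/commrX.
  by rewrite /GRing.comm -!mulmxE; apply: SFZ.
have Vxi : V *m xi = xi *m V by apply: generic_elt_comm.
have VA : V *m tfm (S *m A) = a.
  rewrite map_mxM -/SF mulmxA /V -scalemxAl mulmx_exprSr prednK ?prime_gt0 // SFp.
  rewrite -scalemxAl mul_scalar_mx -[tfm A]eA !scalerA.
  have inv1 (K : fieldType) (u v : K) : u != 0 -> v != 0 -> (u * v)^-1 * v * u = 1.
    by move=> u0 v0; rewrite -mulrA [v * u]mulrC mulVf // mulf_neq0.
  have td0 : tofrac d != 0 by rewrite tofrac_eq0.
  by rewrite (inv1 _ _ _ td0 c0) scale1r.
have adF j y : iter j (fun y => y *m xi - xi *m y) y = (-1) ^+ j *: iter j (admx xi) y.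
  elim: j => [|j IH]; first by rewrite scale1r.
  rewrite !iterS IH exprS mulN1r scaleNr /admx scalerBr opprB -scalemxAl -scalemxAr.
  by [].
have tfad j y : tfm (iter j (fun y => y *m xiR - xiR *m y) y) = iter j (fun y => y *m xi - xi *m y) (tfm y).
  by elim: j => // j IH; rewrite !iterS map_mxB !map_mxM IH -xi_xiR.
have Vad j y : V *m iter j (admx xi) y = iter j (admx xi) (V *m y).
  elim: j => // j IH; rewrite !iterS -IH /admx mulmxBr !mulmxA Vxi. by rewrite -!mulmxA.
exists (V *m tfm (Psi r B0')), (V *m ((-1) ^+ p.-1 *: tfm (Psi r B1'))); split.
  exact: centM.
rewrite -{1}VA main map_mxD mulmxDr; congr (_ + _).
rewrite tfad adF (casimir_admx pcharF) -Vad; congr (_ *m _).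
have adZ s j y : iter j (admx xi) (s *: y) = s *: iter j (admx xi) y.
  by elim: j => // j IH; rewrite !iterS IH admxZ.
by rewrite adZ.
Qed.

Lemma generic_brauer_map : exists l (RR : 'M[F]_(l, m.+1)) P,
  tate_basis p xi RR P /\ brauer_map p Z rhoF XF (fun a => RR *m a *m P).
Proof.
have p_pr : prime p by case/andP: pE.
have rhoFE := elem_repF.
have xip : xi ^+ p = 0 := generic_elt_p pcharF xF zzZ rhoFE.
have [l [RR [P RP]]] := tate_basis_exists (prime_gt0 p_pr) xip.
exists l, RR, P; split=> //.
have rFP : is_rep Z rhoF by case: rhoFE.
apply: (step_brauer_map pZ rFP dual_basesF perm_famF pcharF xip _ _ generic_cent RP).
  by move=> a; apply: generic_elt_comm.
move=> H g a mH gZ gH ca.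
exact: (generic_trace pcharF pZ zzZ x_indepF rhoFE mH gZ gH ca).
Qed.

End GenericStep.

(** * Additive maps over finite fields *)

Section FrobeniusPowers.
Variables (p : nat) (E : finFieldType) (pE : p \in [pchar E]).

(** The proof of the characteristic is an argument so that every [fr pE i] can carry a ring morphism
    structure. *)
Definition fr of p \in [pchar E] := fun i (x : E) => x ^+ (p ^ i).

Lemma frD i : {morph fr pE i : x y / x + y}.
Proof.
move=> x y; apply: exprDn_pchar; apply/andP; split.
  by rewrite expn_gt0 prime_gt0 //; case/andP: pE.
have p_pr : prime p by case/andP: pE.
apply/allP => q; rewrite mem_primes => /and3P [q1 _].
by rewrite Euclid_dvdX // => /andP [+ _]; rewrite dvdn_prime2 // => /eqP ->.
Qed.

Lemma fr_nmod i : nmod_morphism (fr pE i).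
Proof.
split=> [|x y]; last exact: frD.
by rewrite /fr expr0n expn_eq0; have /andP [/prime_gt0 + _] := pE; case: (p).
Qed.

Lemma fr_monoid i : monoid_morphism (fr pE i).
Proof. by split=> [|x y]; rewrite /fr ?expr1n ?exprMn. Qed.

HB.instance Definition _ i := GRing.isNmodMorphism.Build E E (fr pE i) (fr_nmod i).
HB.instance Definition _ i := GRing.isMonoidMorphism.Build E E (fr pE i) (fr_monoid i).

Let s : nat := \dim (fullv : {vspace pPrimeCharType pE}).

Lemma card_pchar_field : #|E| = (p ^ s)%N.
Proof.
by rewrite -[#|E|]/#|pPrimeCharType pE| (card_pprimeChar pE) /s pprimeChar_dimf.
Qed.

Lemma fr_id x : fr pE s x = x.
Proof. by rewrite /fr -card_pchar_field expf_card. Qed.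

Lemma frob_basis : exists eps : 'I_s -> E,
  forall x, exists a : 'I_s -> nat, x = \sum_k (a k)%:R * eps k.
Proof.
exists (fun k => (vbasis (fullv : {vspace pPrimeCharType pE}))`_k) => x.
exists (fun k => coord (vbasis fullv) k (x : pPrimeCharType pE) : nat).
exact: (coord_vbasis (memvf (x : pPrimeCharType pE))).
Qed.

(* Moore matrix: an additive polynomial of degree < p^s vanishing on a basis
   vanishes on all p^s elements of E. *)
Lemma moore_inverse : exists (eps : 'I_s -> E) (N : 'M[E]_s),
  [/\ forall x, exists a : 'I_s -> nat, x = \sum_k (a k)%:R * eps k,
      forall i j : 'I_s, \sum_k N i k * fr pE j (eps k) = (i == j)%:R &
      forall k j, \sum_(i < s) fr pE i (eps k) * N i j = (k == j)%:R].
Proof.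
have [eps epsP] := frob_basis.
pose Mo := \matrix_(k < s, i < s) fr pE i (eps k).
suff u : Mo \in unitmx.
  exists eps, (invmx Mo); split=> // i j.
    have /matrixP/(_ i j) := mulVmx u; rewrite !mxE => <-.
    by apply: eq_bigr => k _; rewrite mxE.
  have /matrixP/(_ i j) := mulmxV u; rewrite !mxE => <-.
  by apply: eq_bigr => k _; rewrite mxE.
rewrite -unitmx_tr -row_free_unit -kermx_eq0; apply/eqP/row_matrixP => r; rewrite row0.
set a := row r _.
have a0 : a *m Mo^T = 0.
  by rewrite /a -row_mul mulmx_ker row0.
clearbody a.
have p_pr : prime p by case/andP: pE.
pose f : {poly E} := \sum_(i < s) a 0 i *: 'X^(p ^ i).
have fE x : f.[x] = \sum_i a 0 i * fr pE i x.
  by rewrite horner_sum; apply: eq_bigr => i _; rewrite hornerZ hornerXn.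
have f0 x : f.[x] = 0.
  have [c ->] := epsP x; rewrite fE.
  under eq_bigr do rewrite raddf_sum mulr_sumr.
  rewrite exchange_big big1 //= => k _.
  under eq_bigr do rewrite rmorphM /= rmorph_nat mulrCA.
  rewrite -mulr_sumr; have /matrixP/(_ 0 k) := a0; rewrite !mxE.
  by under eq_bigr do rewrite !mxE; move=> ->; rewrite mulr0.
have sf : (size f <= p ^ s)%N.
  apply: (leq_trans (size_sum _ _ _)); apply/bigmax_leqP => i _.
  apply: (leq_trans (size_scale_leq _ _)); rewrite size_polyXn.
  by rewrite ltn_exp2l ?prime_gt1.
have {}f0 : f = 0.
  apply/eqP; rewrite -size_poly_eq0; apply: contraTT isT => sf0.
  have : (#|E| < size f)%N.
    rewrite cardE; apply: max_poly_roots; rewrite -?size_poly_eq0 ?enum_uniq //.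
    by apply/allP => x _; apply/eqP.
  by rewrite ltnNge card_pchar_field sf.
apply/rowP => i; rewrite mxE.
have := congr1 (fun g : {poly E} => g`_(p ^ i)) f0; rewrite coef0 coef_sum.
rewrite (bigD1 i) //= coefZ coefXn eqxx mulr1 big1 ?addr0 // => j ne.
by rewrite coefZ coefXn eqn_exp2l ?prime_gt1 // eq_sym (inj_eq val_inj) (negPf ne) mulr0.
Qed.

Lemma additive_nat (M : zmodType) (g : E -> M) (eps : 'I_s -> E) :
  (forall x, exists a : 'I_s -> nat, x = \sum_k (a k)%:R * eps k) ->
  {morph g : x y / x + y} -> (forall k, g (eps k) = 0) -> forall x, g x = 0.
Proof.
move=> epsP gD g0 x; have [a ->] := epsP x.
have g00 : g 0 = 0 by apply: (addrI (g 0)); rewrite -gD !addr0.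
rewrite (big_morph g gD g00) big1 // => k _; rewrite mulr_natl.
by elim: (a k) => [|c IH]; rewrite ?mulr0n // mulrS gD IH g0 addr0.
Qed.

(** The coefficients come from inverting the Moore matrix on a basis of E over its prime field. Both
    sides are additive, so agreement on that basis is enough. *)
Lemma additive_frob r q (u : 'rV[E]_r -> 'rV[E]_q) : {morph u : x y / x + y} ->
  exists U : 'I_s -> 'M[E]_(r, q), forall v, u v = \sum_(i < s) map_mx (fr pE i) v *m U i.
Proof.
move=> uD; have [eps [N [epsP _ NP]]] := moore_inverse.
have u0 : u 0 = 0 by apply: (addrI (u 0)); rewrite -uD !addr0.
exists (fun i => \matrix_t (\sum_k N i k *: u (eps k *: 'e_t))) => v.
have step t e : u (e *: 'e_t) = \sum_(i < s) fr pE i e *: (\sum_k N i k *: u (eps k *: 'e_t)).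
  apply/eqP; rewrite -subr_eq0; apply/eqP.
  apply: (additive_nat (g := fun e => u (e *: 'e_t) - _) epsP) => [x y|j].
    rewrite scalerDl uD; under eq_bigr do rewrite frD scalerDl.
    by rewrite big_split /= opprD addrACA.
  under eq_bigr do (rewrite scaler_sumr; under eq_bigr do rewrite scalerA).
  rewrite exchange_big (bigD1 j) //= -scaler_suml NP eqxx scale1r big1 ?addr0 ?subrr // => k ne.
  by rewrite -scaler_suml NP eq_sym (negPf ne) scale0r.
rewrite {1}(row_sum_delta v) (big_morph u uD u0).
under eq_bigr do rewrite step.
rewrite exchange_big; apply: eq_bigr => i _; rewrite mulmx_sum_row; apply: eq_bigr => t _.
by rewrite rowK mxE.
Qed.

End FrobeniusPowers.

(** * Extension to the reflexive hull *)

Section HullExtension.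
Variables (R : idomainType) (S : Type) (s m l : nat).
Variables (tau taui : 'I_s -> {rmorphism R -> R}) (U : 'I_s -> 'M[R]_m).
Hypotheses (tauK : forall i, cancel (tau i) (taui i)) (tauiK : forall i, cancel (taui i) (tau i)).

Definition semilift r (v : 'M[R]_(r, m)) := \sum_i map_mx (tau i) v *m U i.

Lemma semiliftD r : {morph @semilift r : v w / v + w}.
Proof.
by move=> v w; rewrite /semilift -big_split; apply: eq_bigr => i _; rewrite map_mxD mulmxDl.
Qed.

(** [Lam] stands for ker xi. By [Lam_elem] its image under [P0] is stable under matrix units, hence
    of the form I^l, and [d1] is a gcd of I. The rows of [L0] lift the standard basis up to the
    factor d1 h0, with [h0] chosen so that all twists agree on it. *)
Variables (Lam : 'rV[R]_m -> Prop) (P0 : 'M[R]_(m, l)) (ec : S -> R) (d1 h0 t0 : R)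
  (L0 : 'M[R]_(l, m)).
Hypotheses (LamD : forall v w, Lam v -> Lam w -> Lam (v + w))
  (LamZ : forall c v, Lam v -> Lam (c *: v))
  (Lam_lift : forall v, Lam v -> Lam (semilift v))
  (lift_ker : forall v, Lam v -> v *m P0 = 0 -> semilift v *m P0 = 0)
  (Lam_elem : forall v i j, Lam v ->
     exists2 w, Lam w & w *m P0 = (v *m P0) 0 i *: 'e_j)
  (d1_neq0 : d1 != 0)
  (d1_div : forall v i, Lam v -> divides d1 ((v *m P0) 0 i))
  (d1_gcd : forall h c, (forall v i, Lam v -> divides h (c * (v *m P0) 0 i)) ->
     divides h (c * d1))
  (ec_sep : forall h (d : 'I_s -> R),
     (forall e, divides h (\sum_i tau i (ec e) * d i)) -> forall i, divides h (d i))
  (L0_Lam : forall j, Lam (row j L0)) (L0P0 : L0 *m P0 = (d1 * h0)%:M)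
  (tau_h0 : forall i, tau i h0 = t0) (t0_neq0 : t0 != 0).

Lemma LamN v : Lam v -> Lam (- v).
Proof. by rewrite -scaleN1r; apply: LamZ. Qed.

Lemma Lam_mul (y : 'rV_l) : (exists v, Lam v) -> Lam (y *m L0).
Proof.
case=> v0 Lv0; rewrite mulmx_sum_row; elim/big_ind: _ => //.
  by rewrite -(scale0r v0); apply: LamZ.
by move=> j _; apply: LamZ.
Qed.

Let C i := map_mx (tau i) L0 *m U i *m P0.

(** Modulo the kernel of [P0], h0 v equals y L0, so the lift is computed on the rows of [L0]. The
    common value of the twists at [h0] is what lets [t0] come out of the sum. *)
Lemma lift_scaled v y : Lam v -> v *m P0 = d1 *: y ->
  t0 *: (semilift v *m P0) = \sum_i map_mx (tau i) y *m C i.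
Proof.
move=> Lv vP.
have Lw : Lam (h0 *: v - y *m L0).
  by apply/LamD/LamN/Lam_mul; [apply: LamZ | exists v].
have := lift_ker Lw; rewrite mulmxBl -scalemxAl vP -mulmxA L0P0 mul_mx_scalar scalerA mulrC.
move/(_ (subrr _)) => e0.
have sN w : semilift (- w) = - semilift w.
  by apply: (addIr (semilift w)); rewrite -semiliftD !addNr /semilift big1 // => i _;
     rewrite map_mx0 mul0mx.
move: e0; rewrite semiliftD sN mulmxBl => /eqP; rewrite subr_eq0 => /eqP e0.
have -> : t0 *: (semilift v *m P0) = semilift (h0 *: v) *m P0.
  rewrite scalemxAl /semilift scaler_sumr; congr (_ *m _); apply: eq_bigr => i _.
  by rewrite map_mxZ tau_h0 -scalemxAl.
rewrite e0 /semilift mulmx_suml; apply: eq_bigr => i _.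
by rewrite map_mxM /C !mulmxA.
Qed.

(** For each f in I / d1 the lattice contains a preimage of d1 f e_j. Lifting its multiples by the
    [ec e] and separating the twists shows that t0 d1 divides tau_i(f) times the entry of [C i].
    After undoing tau_i, the factor f disappears because the gcd of I / d1 is 1. *)
Lemma hull_div i j q : divides (t0 * d1) (C i j q).
Proof.
have key v a : Lam v -> forall f, (v *m P0) 0 a = d1 * f -> divides (t0 * d1) (tau i f * C i j q).
  move=> Lv f fE; have [w Lw wP] := Lam_elem a j Lv.
  apply: (ec_sep (d := fun i => tau i f * C i j q)) => e.
  have Lew := LamZ (ec e) Lw.
  have /(lift_scaled Lew) : (ec e *: w) *m P0 = d1 *: (ec e * f *: 'e_j).
    by rewrite -scalemxAl wP fE !scalerA; congr (_ *: _); rewrite mulrCA mulrA.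
  move/rowP/(_ q); rewrite mxE summxE.
  have [c ->] := d1_div q (Lam_lift Lew); rewrite mulrCA => eq.
  exists c; rewrite eq; apply: eq_bigr => k _.
  rewrite map_mxZ map_delta_mx -scalemxAl -rowE [RHS]mxE rmorphM -mulrA; congr (_ * (_ * _)).
  by rewrite [RHS]mxE.
pose g := taui i.
have gdiv : divides (d1 * g (t0 * d1)) (g (C i j q) * d1).
  apply: d1_gcd => v a Lv; have [f fE] := d1_div a Lv; rewrite mulrC in fE.
  have [c cE] := key v a Lv f fE.
  move: (congr1 g cE); rewrite rmorphM /g tauK [RHS]rmorphM -/g => gcE.
  by exists (g c); rewrite fE [RHS]mulrCA -gcE mulrCA [f * _]mulrC.
have {gdiv} [c cE] : divides (g (t0 * d1)) (g (C i j q)).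
  by apply: (divides_mul2l d1_neq0); rewrite [X in divides _ X]mulrC.
exists (tau i c); move/(congr1 (tau i)): cE; rewrite tauiK rmorphM. by rewrite tauiK.
Qed.

Lemma hull_extension : exists D : 'I_s -> 'M[R]_l, forall v y,
  Lam v -> v *m P0 = d1 *: y ->
  semilift v *m P0 = d1 *: \sum_i map_mx (tau i) y *m D i.
Proof.
have /fin_all_exists [D DP] (x : 'I_s * ('I_l * 'I_l)) := hull_div x.1 x.2.1 x.2.2.
exists (fun i => \matrix_(j, q) D (i, (j, q))) => v y Lv vP.
suff e : t0 *: (semilift v *m P0) = t0 *: (d1 *: \sum_i map_mx (tau i) y *m \matrix_(j, q) D (i, (j, q))).
  by apply/rowP => q; apply: (mulfI t0_neq0); move/rowP/(_ q): e; rewrite mxE [RHS]mxE.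
rewrite (lift_scaled Lv vP) !scaler_sumr; apply: eq_bigr => i _.
rewrite !scalerA scalemxAr; congr (_ *m _); apply/matrixP => j q.
by rewrite [RHS]mxE (DP (i, (j, q))) [in RHS]mxE mulrC.
Qed.

End HullExtension.

(** * Frobenius twists and lifts of additive maps *)

Section FrobeniusTwists.
Variables (p : nat) (E : finFieldType) (pE : p \in [pchar E]) (n : nat).
Local Notation s := (\dim (fullv : {vspace pPrimeCharType pE})).
Local Notation R := {mpoly E[n]}.

Lemma fr_add i j x : fr pE (i + j)%N x = fr pE j (fr pE i x).
Proof. by rewrite /fr expnD exprM. Qed.

Lemma fr0 x : fr pE 0 x = x.
Proof. by rewrite /fr expn0 expr1. Qed.

Definition tau (sg : 'S_n) i : {rmorphism R -> R} := msym sg \o map_mpoly (fr pE i).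
Definition taui (sg : 'S_n) i : {rmorphism R -> R} := map_mpoly (fr pE (s - i)%N) \o msym sg^-1%g.

Arguments tau : simpl never.
Arguments taui : simpl never.

Lemma map_fr_add i j f :
  map_mpoly (fr pE (i + j)%N) f = map_mpoly (fr pE j) (map_mpoly (fr pE i) f) :> R.
Proof. by apply/mpolyP => mu; rewrite !mcoeff_map_mpoly /= fr_add. Qed.

Lemma map_fr_id f : map_mpoly (fr pE s) f = f :> R.
Proof. by apply/mpolyP => mu; rewrite !mcoeff_map_mpoly /= fr_id. Qed.

Lemma tauK sg (i : 'I_s) : cancel (tau sg i) (taui sg i).
Proof.
move=> f; rewrite /tau /taui /= -msymMm mulgV msym1m -map_fr_add subnKC ?map_fr_id //.
exact: ltnW.
Qed.

Lemma tauiK sg (i : 'I_s) : cancel (taui sg i) (tau sg i).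
Proof.
move=> f; rewrite /tau /taui /= -map_fr_add subnK; last exact: ltnW.
by rewrite map_fr_id -msymMm mulVg msym1m.
Qed.

Lemma tau_C sg i c : tau sg i c%:MP = (fr pE i c)%:MP.
Proof. by rewrite /tau /= map_mpolyC -[(fr pE i c)%:MP]mulr1 mul_mpolyC msymZ msym1. Qed.

Lemma tau_coeff0 sg i f : (tau sg i f)@_0%MM = fr pE i f@_0%MM.
Proof.
rewrite /tau /= mcoeff_sym mcoeff_map_mpoly; congr (fr pE i (mcoeff _ f)).
by apply/mnmP => j; rewrite !mnmE.
 Qed.

(* Polynomials with coefficients in the prime field. *)
Definition rational (h : R) := forall i, map_mpoly (fr pE i) h = h.

Lemma rational_tau sg i h : rational h -> tau sg i h = msym sg h.
Proof. by move=> hr; rewrite /tau /= hr. Qed.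

Lemma rational_msym sg h : rational h -> rational (msym sg h).
Proof.
move=> hr i; apply/mpolyP => mu; rewrite mcoeff_map_mpoly /= !mcoeff_sym.
by rewrite -[in RHS](hr i) mcoeff_map_mpoly.
Qed.

Lemma rational_X mu : rational 'X_[mu].
Proof. by move=> i; rewrite map_mpolyX. Qed.

Lemma fdeg_gt0 : (0 < s)%N.
Proof.
have := finNzRing_gt1 E; rewrite (card_pchar_field pE); case: (s) => // .
Qed.

(** The multiple is the product of all Frobenius conjugates of [f], which Frobenius permutes
    cyclically. Rational scalars matter because all twists act on them alike, so they pass through a
    lift. *)
Lemma rational_multiple (f : R) : f != 0 ->
  exists h, [/\ h != 0, rational h & divides f h].
Proof.
move=> f0; pose g i := map_mpoly (fr pE i) f : R.
have g0 i : g i != 0.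
  have frI : injective (fr pE i) := fmorph_inj _.
  apply: contraNneq f0 => e; apply/eqP/mpolyP => mu; apply: frI.
  by rewrite -mcoeff_map_mpoly /= -/(g i) e !mcoeff0 raddf0.
have gs : g s = g 0%N by apply/mpolyP => mu; rewrite !mcoeff_map_mpoly /= fr_id fr0.
have gf : g 0%N = f by apply/mpolyP => mu; rewrite mcoeff_map_mpoly /= fr0.
exists (\prod_(0 <= i < s) g i); split.
- by rewrite prodf_seq_neq0; apply/allP => i _; rewrite g0.
- have step : map_mpoly (fr pE 1) (\prod_(0 <= i < s) g i) = \prod_(0 <= i < s) g i.
    rewrite rmorph_prod /= (eq_bigr (fun i => g i.+1)) => [|i _]; last first.
      by rewrite /g -map_fr_add addn1.
    apply: (mulfI (g0 0%N)); rewrite -big_nat_recl //.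
    by rewrite big_nat_recr //= gs mulrC.
  elim=> [|i IH]; last by rewrite -addn1 map_fr_add IH.
  by apply/mpolyP => mu; rewrite mcoeff_map_mpoly /= fr0.
by rewrite big_ltn ?fdeg_gt0 // gf; apply/divides_mulr/divides_refl.
Qed.

(** A row of the inverse Moore matrix, applied to the relations for a basis of E, isolates a single
    [d i]. *)
Lemma twist_sep sg h (d : 'I_s -> R) :
  (forall e, divides h (\sum_(i < s) tau sg i e%:MP * d i)) -> forall i, divides h (d i).
Proof.
move=> hd i; have [eps [N [_ NP _]]] := moore_inverse pE.
have [c cP] := fin_all_exists (fun k => hd (eps k)).
have cP' k : c k * h = \sum_(j < s) (fr pE j (eps k))%:MP * d j.
  by rewrite -cP; apply: eq_bigr => j _; rewrite tau_C.
exists (\sum_k (N i k)%:MP * c k).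
rewrite mulr_suml; under eq_bigr do rewrite -mulrA cP' mulr_sumr.
rewrite exchange_big (bigD1 i) //= [X in _ + X]big1 ?addr0 => [|j ne].
  under eq_bigr do rewrite mulrA -mpolyCM.
  by rewrite -mulr_suml -rmorph_sum NP eqxx rmorph1 mul1r.
under eq_bigr do rewrite mulrA -mpolyCM.
by rewrite -mulr_suml -rmorph_sum NP eq_sym (negPf ne) rmorph0 mul0r.
Qed.

Section Lift.
Variables (m : nat).

Definition ulift sg (U : 'I_s -> 'M[E]_m) (v : 'rV[R]_m) : 'rV[R]_m :=
  semilift (fun i : 'I_s => tau sg i) (fun i => cmx (U i)) v.

Lemma uliftD sg U : {morph ulift sg U : v w / v + w}.
Proof. exact: semiliftD. Qed.

Lemma ulift0 sg U : ulift sg U 0 = 0.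
Proof. by apply: (addrI (ulift sg U 0)); rewrite -uliftD !addr0. Qed.

Lemma ulift_sum sg U (J : Type) (r : seq J) (Q : pred J) (F : J -> 'rV[R]_m) :
  ulift sg U (\sum_(j <- r | Q j) F j) = \sum_(j <- r | Q j) ulift sg U (F j).
Proof. exact: (big_morph _ (@uliftD sg U) (@ulift0 sg U)). Qed.

Lemma ulift_rational sg U h v : rational h -> ulift sg U (h *: v) = msym sg h *: ulift sg U v.
Proof.
move=> hr; rewrite /ulift /semilift scaler_sumr; apply: eq_bigr => i _.
by rewrite map_mxZ rational_tau // -scalemxAl.
Qed.

Section OneLift.
Variables (u : 'rV[E]_m -> 'rV[E]_m) (sg : 'S_n) (U : 'I_s -> 'M[E]_m).
Hypothesis uE : forall v, u v = \sum_(i < s) map_mx (fr pE i) v *m U i.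

Lemma ulift_const w : ulift sg U (cmx w) = cmx (u w).
Proof.
rewrite uE raddf_sum; apply: eq_bigr => i _ /=; rewrite map_mxM; congr (_ *m _).
by apply/matrixP => x y; rewrite !mxE tau_C.
Qed.

Lemma ulift_monomial mu w : ulift sg U ('X_[mu] *: cmx w) = msym sg 'X_[mu] *: cmx (u w).
Proof. by rewrite ulift_rational ?ulift_const //; apply: rational_X. Qed.

(** On a monomial row the i-th summand of [xi] becomes the one with index [sg i]: [u] exchanges the
    matrices and [msym sg] the indeterminates. *)
Lemma ulift_generic (r : 'I_n -> 'M[E]_m) v :
  (forall i v, u (v *m r i) = u v *m r (sg i)) ->
  ulift sg U (v *m \sum_i 'X_i *: (cmx (r i) - 1%:M)) =
  ulift sg U v *m \sum_i 'X_i *: (cmx (r i) - 1%:M).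
Proof.
move=> ur; have uD : {morph u : v w / v + w}.
  by move=> x y; rewrite !uE -big_split; apply: eq_bigr => i _; rewrite map_mxD mulmxDl.
have uN w : u (- w) = - u w.
  apply: (addIr (u w)); rewrite -uD !addNr uE big1 // => i _.
  by rewrite map_mx0 mul0mx.
elim/mpoly_mx_ind: v => [|a b IHa IHb|mu w].
- by rewrite mul0mx ulift0 mul0mx.
- by rewrite mulmxDl !uliftD IHa IHb mulmxDl.
rewrite !mulmx_sumr ulift_sum ulift_monomial [RHS](reindex_inj (@perm_inj _ sg)) /=.
apply: eq_bigr => i _.
have -> : ('X_[mu] *: cmx w) *m ('X_i *: (cmx (r i) - 1%:M)) =
    'X_[(mu + U_(i))%MM] *: cmx (w *m r i - w) :> 'rV[R]_m.
  rewrite -scalemxAl -scalemxAr scalerA -mpolyXD; congr (_ *: _).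
  by rewrite mulmxBr mulmx1 map_mxB map_mxM.
rewrite ulift_monomial uD uN ur mpolyXD msymM -scalemxAl -scalemxAr scalerA.
congr (_ * _ *: _); last by rewrite mulmxBr mulmx1 map_mxB map_mxM.
by rewrite /msym mmapX mmap1U.
Qed.

End OneLift.

(** [u2] acts first, and products of permutations are composed from left to right; hence
    [sg2 * sg1]. *)
Lemma ulift_comp (u1 u2 : 'rV[E]_m -> 'rV[E]_m) sg1 sg2 U1 U2 U v :
  (forall v, u1 v = \sum_(i < s) map_mx (fr pE i) v *m U1 i) ->
  (forall v, u2 v = \sum_(i < s) map_mx (fr pE i) v *m U2 i) ->
  (forall v, u1 (u2 v) = \sum_(i < s) map_mx (fr pE i) v *m U i) ->
  ulift (sg2 * sg1)%g U v = ulift sg1 U1 (ulift sg2 U2 v).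
Proof.
move=> u1E u2E uE; elim/mpoly_mx_ind: v => [|a b IHa IHb|mu w].
- by rewrite !ulift0.
- by rewrite !uliftD IHa IHb.
rewrite (ulift_monomial _ uE) (ulift_monomial _ u2E) ulift_rational; last first.
  exact/rational_msym/rational_X.
by rewrite (ulift_const _ u1E) msymMm.
Qed.

End Lift.
End FrobeniusTwists.

(** * Comparison of the generic and the constant Brauer quotient *)

Lemma matrix_unit_transfer (F : fieldType) l r (e : 'I_l -> 'I_l -> 'M[F]_r) i0 :
  (forall i j k q, e i j *m e k q = (j == k)%:R *: e i q) ->
  (forall M, exists c : 'I_l -> 'I_l -> F, M = \sum_i \sum_j c i j *: e i j) ->
  e i0 i0 != 0 ->
  exists G : 'M[F]_(r, l), [/\ forall i j, e i j *m G = G *m delta_mx i j,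
    forall w : 'rV_r, w *m G = 0 -> w = 0 & exists w : 'rV_r, w *m G != 0].
Proof.
move=> eM espan e0.
have [x0 [t e0t]] : exists x t, e i0 i0 x t != 0.
  have /existsP [x /existsP [t h]] : [exists x, exists t, e i0 i0 x t != 0].
    apply: contraNT e0 => /existsPn h; apply/eqP/matrixP => x t.
    by have /existsPn/(_ t) := h x; rewrite negbK mxE => /eqP.
  by exists x, t.
(* Column j of [G] is column t of [e j i0], so [G] carries the [e i j] to the standard matrix units.
   No nonzero row is killed because the [e i j] span the full, simple matrix algebra. *)
pose G := \matrix_(x < r, j < l) e j i0 x t.
have eG i j : e i j *m G = G *m delta_mx i j.
  apply/matrixP => x k; have /matrixP/(_ x t) := eM i j k i0; rewrite !mxE => h.
  under eq_bigr do rewrite mxE; rewrite h.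
  rewrite (bigD1 i) //= big1 ?addr0 => [|y ne]; last by rewrite !mxE (negPf ne) mulr0.
  by rewrite !mxE eqxx /= mulrC [k == j]eq_sym.
have G0 : G x0 i0 != 0 by rewrite mxE.
exists G; split=> // [w wG|]; last first.
  exists 'e_x0; apply: contraNneq G0 => /rowP/(_ i0).
  by rewrite -rowE mxE [RHS]mxE => ->.
apply/rowP => x; rewrite [RHS]mxE; apply/eqP; apply: contraNT G0 => wx.
have wMG M : w *m M *m G = 0.
  have [c ->] := espan M; rewrite mulmx_sumr mulmx_suml big1 // => i _.
  rewrite mulmx_sumr mulmx_suml big1 // => j _.
  by rewrite -scalemxAr -scalemxAl -mulmxA eG mulmxA wG mul0mx scaler0.
have /rowP/(_ i0) := wMG (delta_mx x x0).
rewrite -mulmxA mxE (bigD1 x) //= big1 ?addr0 => [|y ne].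
  rewrite mxE (bigD1 x0) //= big1 ?addr0 => [|y ne].
    by rewrite [delta_mx _ _ _ _]mxE !eqxx mul1r [RHS]mxE => /eqP; rewrite mulf_eq0 (negPf wx).
  by rewrite mxE (negPf ne) andbF mul0r.
rewrite mxE big1 ?mulr0 // => z _.
by rewrite mxE (negPf ne) mul0r.
Qed.

Section Kernel.
Variables (p : nat) (gT : finGroupType) (k : fieldType) (m l : nat) (G : {group gT})
  (rho : gT -> 'M[k]_m) (I : finType) (X Y : I -> 'M[k]_m) (beta : 'M[k]_m -> 'M[k]_l).
Hypotheses (pG : (p.-group G)%g) (rhoP : is_rep G rho) (XY : dual_bases X Y)
  (permX : perm_fam G rho X) (bP : brauer_map p G rho X beta).

Lemma brauer_map_ker a : centmx rho G a -> beta a = 0 ->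
  exists T : seq (gT * 'M[k]_m),
    (forall t, t \in T -> exists H : {group gT},
       [/\ maximal H G, t.1 \in G, t.1 \notin H & centmx rho H t.2]) /\
    a = \sum_(t <- T) gtr p rho t.1 t.2.
Proof.
move=> ca ba; have [T [TP aE]] := fixed_decomp pG rhoP XY permX ca.
exists T; split=> //; rewrite {1}aE big1 ?add0r // => i fi.
case: (bP) => _ _ _ btr [indep _].
have -> : \tr (a *m Y i) = 0; last by rewrite scale0r.
apply: (indep (fun i => \tr (a *m Y i))) fi.
rewrite -(brauer_map_sum _ _ _ _ bP) -[RHS]ba [in RHS]aE (beta1D bP).
have -> : beta (\sum_(t <- T) gtr p rho t.1 t.2) = 0; last by rewrite addr0.
rewrite (beta1_sum bP) big_seq big1 // => t /TP [H [mH tG tH ct]].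
exact: btr mH tG tH ct.
Qed.

Lemma brauer_map_surj b : exists2 a, centmx rho G a & beta a = b.
Proof.
case: (bP) => _ _ _ _ [_ span]; have [c ->] := span b.
exists (\sum_(i | fixb G rho X i) c i *: X i); last exact: brauer_map_sum bP.
apply: cent_sum => i /forall_inP fi; apply: centZ.
by apply/(centP rhoP) => g gG; apply/eqP/fi.
Qed.

End Kernel.

Section GenericLattice.
Variables (p : nat) (gT : finGroupType) (E : fieldType) (n m l : nat).
Hypothesis pE : p \in [pchar E].
Local Notation R := {mpoly E[n]}.
Local Notation F := {fraction {mpoly E[n]}}.
Local Notation tfm := (map_mx (@tofrac R)).
Local Notation iF := (@iF E n).
Variables (Z : {group gT}) (zz : 'I_n -> gT) (rho : gT -> 'M[E]_m.+1) (I : finType)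
  (X Y : I -> 'M[E]_m.+1) (beta : 'M[E]_m.+1 -> 'M[E]_l) (i0 : 'I_l).
Hypotheses (pZ : (p.-group Z)%g) (zzZ : forall i, zz i \in Z)
  (rhoE : elem_rep p Z zz rho) (XY : dual_bases X Y) (permX : perm_fam Z rho X)
  (bP : brauer_map p Z rho X beta).

Let rhoP : is_rep Z rho. Proof. by case: rhoE. Qed.

Lemma fixbF i : fixb Z (rhoF n rho) (XF n X) i = fixb Z rho X i.
Proof.
apply: eq_forallb => g; congr (_ ==> _); rewrite /XF rconjF.
apply/eqP/eqP => [/matrixP e|-> //]; apply/matrixP => x y; apply: (fmorph_inj iF).
by have := e x y; rewrite !mxE.
Qed.

Lemma centF a : centmx rho Z a -> centmx (rhoF n rho) Z (map_mx iF a).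
Proof. by move=> ca z zZ; rewrite /rhoF -!map_mxM ca. Qed.

(** The kernel of [beta] on A^Z consists of traces, which the generic homomorphism [bf] also kills.
    So [bf] turns lifts of matrix units into matrix units, and [matrix_unit_transfer] maps the Tate
    quotient to row vectors of length l. [P0] is this map with denominators cleared. *)
Lemma generic_lattice : exists P0 : 'M[R]_(m.+1, l),
  [/\ forall (v : 'rV[R]_m.+1) a, v *m xiR zz rho = 0 -> centmx rho Z a ->
        v *m cmx a *m P0 = v *m P0 *m cmx (beta a),
      forall v : 'rV[R]_m.+1, v *m xiR zz rho = 0 -> v *m P0 = 0 ->
        exists (h : R) v', h != 0 /\ h *: v = v' *m xiR zz rho ^+ p.-1,
      forall v : 'rV[R]_m.+1, v *m xiR zz rho ^+ p.-1 *m P0 = 0 &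
      exists v : 'rV[R]_m.+1, v *m xiR zz rho = 0 /\ v *m P0 != 0].
Proof.
have [r [RR [P [RP bF]]]] := generic_brauer_map pE pZ zzZ rhoE XY permX.
set bf := fun a => RR *m a *m P in bF.
have kerF a : centmx rho Z a -> beta a = 0 -> bf (map_mx iF a) = 0.
  move=> ca ba; have [T [TP ->]] := brauer_map_ker pZ rhoP XY permX bP ca ba.
  rewrite raddf_sum (beta1_sum bF) big_seq big1 // => t /TP [H [mH tG tH ct]] /=.
  have -> : map_mx iF (gtr p rho t.1 t.2) = gtr p (rhoF n rho) t.1 (map_mx iF t.2).
    by rewrite /gtr raddf_sum; apply: eq_bigr => j _; rewrite rconjF.
  case: bF => _ _ _ btr _; apply: (btr H) => //.
  by move=> h hH; rewrite /rhoF -!map_mxM ct.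
have /fin_all_exists2 [aa aaC aaE] (ij : 'I_l * 'I_l) := brauer_map_surj rhoP bP (delta_mx ij.1 ij.2).
pose e i j := bf (map_mx iF (aa (i, j))).
have bf_eq a a' : centmx rho Z a -> centmx rho Z a' -> beta a = beta a' ->
    bf (map_mx iF a) = bf (map_mx iF a').
  move=> ca ca' eb.
  have /kerF : centmx rho Z (-1 *: a' + a) by apply: centD ca; apply: centZ.
  case: (bP) => lin _ _ _ _; rewrite lin eb scaleN1r addNr => /(_ erefl).
  case: (bF) => linF _ _ _ _; rewrite map_mxD map_mxZ linF rmorphN1 scaleN1r addrC => /eqP.
  by rewrite subr_eq0 => /eqP.
have bfZ c a : bf (map_mx iF (c *: a)) = iF c *: bf (map_mx iF a).
  by rewrite map_mxZ /bf -scalemxAr -scalemxAl.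
have bfE a : centmx rho Z a -> bf (map_mx iF a) = \sum_i \sum_j iF (beta a i j) *: e i j.
  move=> ca; pose a' := \sum_i \sum_j beta a i j *: aa (i, j).
  have ca' : centmx rho Z a'.
    by do 2!(apply: cent_sum => ? _); apply: centZ.
  rewrite (bf_eq a a') //; last first.
    rewrite [LHS]matrix_sum_delta (beta1_sum bP); apply: eq_bigr => i _.
    rewrite (brauer_map_sum _ _ _ _ bP); apply: eq_bigr => j _; by rewrite aaE.
  rewrite /a' raddf_sum (beta1_sum bF); apply: eq_bigr => i _.
  rewrite raddf_sum (beta1_sum bF); apply: eq_bigr => j _; exact: bfZ.
have eM i j k q : e i j *m e k q = (j == k)%:R *: e i q.
  case: (bF) => _ _ bM _ _; rewrite /e -bM; try exact: centF.
  rewrite -(rmorph_nat iF) -bfZ -map_mxM; apply: bf_eq; [exact: centM | exact: centZ |].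
  case: (bP) => lin _ bM1 _ _; rewrite bM1 // !aaE mul_delta_mx_cond /=.
  have := lin (j == k)%:R (aa (i, q)) 0; rewrite !addr0 (beta1_0 bP) addr0 aaE => ->.
  by rewrite scaler_nat.
have espan M : exists c : 'I_l -> 'I_l -> F, M = \sum_i \sum_j c i j *: e i j.
  case: (bF) => _ _ _ _ [_ /(_ M) [c ->]].
  have fc i : fixb Z rho X i -> centmx rho Z (X i).
    by move=> /forall_inP fi; apply/(centP rhoP) => g gG; apply/eqP/fi.
  exists (fun x y => \sum_(i | fixb Z rho X i) c i * iF (beta (X i) x y)).
  rewrite (eq_bigl _ _ fixbF).
  under eq_bigr => i fi do rewrite [bf _](bfE _ (fc i fi)) scaler_sumr.
  rewrite exchange_big; apply: eq_bigr => x _.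
  under eq_bigr do rewrite scaler_sumr.
  rewrite exchange_big; apply: eq_bigr => y _; rewrite scaler_suml.
  by apply: eq_bigr => i _; rewrite scalerA.
(* If it vanished, all [e i j] and hence all [bf] of fixed basis elements would vanish. Independence
   would leave no fixed index, and the span for [beta] would be 0 although l is positive. *)
have e00 : e i0 i0 != 0.
  apply/eqP => e0.
  have ez i j : e i j = 0.
    have := eM i i0 i0 j; rewrite eqxx scale1r => <-.
    by have := eM i i0 i0 i0; rewrite e0 mulmx0 eqxx scale1r => <-; rewrite mul0mx.
  have nofix i : ~~ fixb Z rho X i.
    apply/negP => fi; case: (bF) => _ _ _ _ [/(_ (fun=> 1)) indep _].
    suff h : \sum_(i | fixb Z (rhoF n rho) (XF n X) i) 1 *: bf (XF n X i) = 0.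
      by have := indep h i; rewrite fixbF fi => /(_ isT)/eqP; rewrite oner_eq0.
    apply: big1 => j; rewrite fixbF => /forall_inP fj; rewrite scale1r /XF bfE.
      by do 2!(rewrite big1 // => ? _); rewrite ez scaler0.
    by apply/(centP rhoP) => g gG; apply/eqP/fj.
  case: (bP) => _ _ _ _ [_ /(_ 1%:M) [c]].
  rewrite big1 => [/matrixP/(_ i0 i0)|i fi]; last by have := nofix i; rewrite fi.
  by rewrite !mxE eqxx => /eqP; rewrite oner_eq0.
have [G [eG Ginj [w wG]]] := matrix_unit_transfer eM espan e00.
have [d [P0 [d0 dP]]] := clear_denoms (P *m G).
case: (RP) => Rxi RP1 JP vR.
have tfxi : tfm (xiR zz rho) = xi zz rho by rewrite xi_xiR.
have tfX : tfm (xiR zz rho ^+ p.-1) = xi zz rho ^+ p.-1 by rewrite -tfxi rmorphXn.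
have tfP : tfm P0 = tofrac d *: (P *m G) by rewrite dP.
have td0 : tofrac d != 0 by rewrite tofrac_eq0.
have vxiF (v : 'rV[R]_m.+1) : v *m xiR zz rho = 0 -> tfm v *m xi zz rho = 0.
  by move=> h; rewrite -tfxi -map_mxM h map_mx0.
have inj q (x y : 'M[R]_(1, q)) : tfm x = tfm y -> x = y by apply: tfm_inj.
have vP0 (v : 'rV[R]_m.+1) : tfm (v *m P0) = tofrac d *: (tfm v *m P *m G).
  by rewrite map_mxM tfP -scalemxAr mulmxA.
exists P0; split.
- move=> v a vxi ca; apply: tfm_inj; rewrite (vP0 (v *m cmx a)).
  have -> b : tfm (v *m P0 *m cmx b) = tofrac d *: (tfm v *m P *m G) *m map_mx iF b.
    by rewrite map_mxM [map_mx _ (cmx b)]tf_cmx; congr (_ *m _); apply: vP0.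
  rewrite -scalemxAl; congr (_ *: _).
  rewrite map_mxM [map_mx _ (cmx a)]tf_cmx (tate_act RP (vxiF v vxi)); last first.
    exact/generic_elt_comm/centF.
  rewrite -[LHS]mulmxA -[RHS]mulmxA; congr (_ *m _).
  rewrite -[RR *m _ *m _]/(bf (map_mx iF a)) bfE // [map_mx iF (beta a)]matrix_sum_delta.
  rewrite mulmx_suml mulmx_sumr; apply: eq_bigr => i _.
  rewrite mulmx_suml mulmx_sumr; apply: eq_bigr => j _.
  by rewrite mxE -scalemxAl -scalemxAr eG.
- move=> v vxi vP.
  have vPF : tfm v *m P = 0.
    apply: Ginj; have := vP0 v; rewrite vP map_mx0 => /esym/eqP.
    by rewrite scalemx_eq0 (negPf td0) => /eqP.
  have := vR _ _ (vxiF v vxi); rewrite vPF mul0mx subr0 => /submxP [D eD].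
  have [h [D' [h0 hD]]] := clear_denoms D; exists h, D'; split=> //.
  by apply: inj; rewrite map_mxZ map_mxM tfX -hD -scalemxAl -eD.
- move=> v; apply: inj; rewrite vP0 map_mxM tfX -(mulmxA _ _ P) JP mulmx0 mul0mx.
  by rewrite scaler0 map_mx0.
have [d' [v [d'0 dv]]] := clear_denoms (w *m RR).
exists v; split.
  apply: inj; rewrite map_mxM tfxi -dv -scalemxAl -mulmxA Rxi mulmx0 scaler0.
  by rewrite map_mx0.
apply: contraNneq wG => vP; have := vP0 v; rewrite vP map_mx0 => /esym/eqP.
rewrite scalemx_eq0 (negPf td0) -dv -!scalemxAl scalemx_eq0 tofrac_eq0 (negPf d'0) /=.
by rewrite -(mulmxA w) RP1 mulmx1.
Qed.
End GenericLattice.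

Lemma mul_sum_scaled (S : comNzRingType) n m (x : 'I_n -> S) (c : 'I_n -> 'M[S]_m) a :
  (forall i, a *m c i = c i *m a) ->
  a *m (\sum_i x i *: (c i - 1%:M)) = (\sum_i x i *: (c i - 1%:M)) *m a.
Proof.
move=> com; rewrite mulmx_sumr mulmx_suml; apply: eq_bigr => i _.
by rewrite -scalemxAr -scalemxAl mulmxBr mulmxBl com mulmx1 mul1mx.
Qed.

Lemma row_mul_delta (S : pzSemiRingType) l (y : 'rV[S]_l) i (j : 'I_l) :
  y *m delta_mx i j = y 0 i *: 'e_j.
Proof.
rewrite -(mul_delta_mx (0 : 'I_1)) mulmxA -colE.
by apply/rowP => q; rewrite !mxE big_ord1 !mxE.
Qed.

(** * The action of the normaliser on the hull *)

Section Hull.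
Variables (p : nat) (E : finFieldType) (pE : p \in [pchar E]) (n m l : nat).
Local Notation s := (\dim (fullv : {vspace pPrimeCharType pE})).
Local Notation R := {mpoly E[n]}.
Variables (r : 'I_n -> 'M[E]_m.+1) (cent : 'M[E]_m.+1 -> Prop) (beta : 'M[E]_m.+1 -> 'M[E]_l).
Local Notation xir := (\sum_i 'X_i *: (cmx (r i) - 1%:M) : 'M[R]_m.+1).
Hypothesis r_inj : injective r.

Variables (P0 : 'M[R]_(m.+1, l)) (d1 h0 : R) (L0 : 'M[R]_(l, m.+1)).
Hypotheses
  (P0_cent : forall (v : 'rV[R]_m.+1) a, v *m xir = 0 -> cent a ->
     v *m cmx a *m P0 = v *m P0 *m cmx (beta a))
  (P0_ker : forall v : 'rV[R]_m.+1, v *m xir = 0 -> v *m P0 = 0 ->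
     exists (h : R) v', [/\ h != 0, rational pE h & h *: v = v' *m xir ^+ p.-1])
  (P0_im : forall v : 'rV[R]_m.+1, v *m xir ^+ p.-1 *m P0 = 0)
  (cent_comm : forall a i, cent a -> a *m r i = r i *m a)
  (cent_delta : forall i j, exists2 a, cent a & beta a = delta_mx i j)
  (d1_neq0 : d1 != 0)
  (d1_div : forall (v : 'rV[R]_m.+1) i, v *m xir = 0 -> divides d1 ((v *m P0) 0 i))
  (d1_gcd : forall h c,
     (forall (v : 'rV[R]_m.+1) i, v *m xir = 0 -> divides h (c * (v *m P0) 0 i)) ->
     divides h (c * d1))
  (h0_neq0 : h0 != 0) (h0_rat : rational pE h0)
  (L0_xi : L0 *m xir = 0) (L0_P0 : L0 *m P0 = (d1 * h0)%:M).

Definition lifts (u : 'rV[E]_m.+1 -> 'rV[E]_m.+1) (sg : 'S_n) (U : 'I_s -> 'M[E]_m.+1) :=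
  (forall v, u v = \sum_(i < s) map_mx (fr pE i) v *m U i) /\
  (forall i v, u (v *m r i) = u v *m r (sg i)).

Local Notation coef0 := (map_mx (mcoeff 0%MM)).

(* ext is the extension to R^l of the action of u on the image of ker xi, and f is its
   value at x = 0. *)
Definition hull_rel (u : 'rV[E]_m.+1 -> 'rV[E]_m.+1) (f : 'rV[E]_l -> 'rV[E]_l) :=
  bijective u /\ exists sg U (ext : 'rV[R]_l -> 'rV[R]_l),
  [/\ lifts u sg U,
      forall (v : 'rV[R]_m.+1) y, v *m xir = 0 -> v *m P0 = d1 *: y ->
        ulift sg U v *m P0 = d1 *: ext y,
      forall h y, rational pE h -> ext (h *: y) = msym sg h *: ext y &
      forall y, coef0 (ext y) = f (coef0 y)].

Lemma msym_neq0 (sg : 'S_n) (h : R) : h != 0 -> msym sg h != 0.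
Proof. by rewrite -(inj_eq (inj_msym sg)) msym0. Qed.

Lemma scalemx_inj a b (h : R) (x y : 'M[R]_(a, b)) : h != 0 -> h *: x = h *: y -> x = y.
Proof.
move=> hn /matrixP e; apply/matrixP => i j; apply: (mulfI hn).
by have := e i j; rewrite mxE [RHS]mxE.
Qed.

Lemma cent_xi a : cent a -> cmx a *m xir = xir *m cmx a.
Proof.
by move=> ca; apply: mul_sum_scaled => i; rewrite -!map_mxM cent_comm.
Qed.

Lemma lifts_xi u sg U v : lifts u sg U -> ulift sg U (v *m xir) = ulift sg U v *m xir.
Proof. by case=> uE ur; apply: (ulift_generic uE). Qed.

Lemma lifts_stable u sg U (v : 'rV[R]_m.+1) : lifts u sg U -> v *m xir = 0 ->
  ulift sg U v *m xir = 0.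
Proof. by move=> uL vx; rewrite -(lifts_xi _ uL) vx ulift0. Qed.

Lemma lifts_exists u : {morph u : x y / x + y} -> bijective u ->
  (forall i, exists j, forall v, u (v *m r i) = u v *m r j) -> exists sg U, lifts u sg U.
Proof.
move=> uD ub ur; have [U uE] := additive_frob pE uD.
have [f fP] := fin_all_exists ur.
have fI : injective f.
  move=> i j e; apply/r_inj/row_matrixP => t; rewrite !rowE.
  by apply: (bij_inj ub); rewrite !fP e.
exists (perm fI), U; split=> // i v; by rewrite permE fP.
Qed.

Lemma hull_rel_exists u : {morph u : x y / x + y} -> bijective u ->
  (forall i, exists j, forall v, u (v *m r i) = u v *m r j) ->
  exists f, hull_rel u f /\ {morph f : x y / x + y}.
Proof.
move=> uD ub ur; have [sg [U uL]] := lifts_exists uD ub ur.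
have iter_xi v j : ulift sg U (v *m xir ^+ j) = ulift sg U v *m xir ^+ j.
  elim: j v => [|j IH] v; first by rewrite !mulmx1.
  by rewrite !exprS -!mulmxE !mulmxA IH (lifts_xi _ uL).
have [|||||||||||||D DP] := @hull_extension R E s m.+1 l (fun i => tau pE sg i) (fun i => taui pE sg i)
  (fun i => cmx (U i)) (@tauK p E pE n sg) (@tauiK p E pE n sg) (fun v => v *m xir = 0) P0
  (@mpolyC n E) d1 h0 (msym sg h0) L0.
- by move=> v w vx wx; rewrite mulmxDl vx wx addr0.
- by move=> c v vx; rewrite -scalemxAl vx scaler0.
- by move=> v; apply: (lifts_stable uL).
(* Some rational multiple of [v] lies in im xi^(p-1). Rational scalars and [xi] both pass through
   the lift, so [P0] kills the lift of [v] too. *)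
- move=> v vx vP; have [h [v' [hn hr e]]] := P0_ker vx vP.
  apply: (scalemx_inj (msym_neq0 sg hn)); rewrite scaler0 scalemxAl.
  by rewrite -[semilift _ _ _]/(ulift sg U v) -ulift_rational // e iter_xi P0_im.
- move=> v i j vx; have [a ca ba] := cent_delta i j.
  exists (v *m cmx a); first by rewrite -mulmxA cent_xi // mulmxA vx mul0mx.
  rewrite P0_cent // ba map_delta_mx; exact: row_mul_delta.
- done.
- exact: d1_div.
- exact: d1_gcd.
- by move=> h d; apply: twist_sep.
- by move=> j; rewrite -row_mul L0_xi row0.
- exact: L0_P0.
- by move=> i; apply: rational_tau.
- exact: msym_neq0.
pose f (w : 'rV[E]_l) := \sum_(i < s) map_mx (fr pE i) w *m coef0 (D i).
exists f; split; last first.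
  move=> x y; rewrite /f -big_split; apply: eq_bigr => i _.
  by rewrite map_mxD mulmxDl.
split=> //; exists sg, U, (fun y => \sum_(i < s) map_mx (tau pE sg i) y *m D i).
split=> // [h y hr|y].
  rewrite scaler_sumr; apply: eq_bigr => i _.
  by rewrite map_mxZ rational_tau // -scalemxAl.
apply/rowP => q; rewrite mxE !summxE raddf_sum; apply: eq_bigr => i _ /=.
rewrite !mxE raddf_sum; apply: eq_bigr => j _ /=.
by rewrite !mxE rmorphM /= tau_coeff0.
Qed.

(** The permutation is determined because the r_i are distinct and [u] is bijective, and the lift is
    then determined by [u]. Since the rows of [L0] lie in ker xi, the lift fixes [ext] on h0 R^l,
    and the rational factor h0 cancels. *)
Lemma hull_rel_unique u f f' : hull_rel u f -> hull_rel u f' -> f =1 f'.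
Proof.
case=> ub [sg [U [ext [[uE ur] e1 e2 e3]]]] [_ [sg' [U' [ext' [[uE' ur'] e1' e2' e3']]]]].
have sgE : sg' = sg.
  apply/permP => i; apply/r_inj/row_matrixP => t; rewrite !rowE.
  by have [v _ uv] := ub; rewrite -[delta_mx 0 t]uv -ur' ur.
subst sg'.
have lE v : ulift sg U' v = ulift sg U v.
  elim/mpoly_mx_ind: v => [|a b IHa IHb|mu w]; first by rewrite !ulift0.
    by rewrite !uliftD IHa IHb.
  by rewrite (ulift_monomial sg uE) (ulift_monomial sg uE').
move=> w; pose y : 'rV[R]_l := cmx w.
have yw : coef0 y = w by apply/rowP => q; rewrite !mxE mcoeffC eqxx mulr1.
have vx : y *m L0 *m xir = 0 by rewrite -mulmxA L0_xi mulmx0.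
have vP : y *m L0 *m P0 = d1 *: (h0 *: y).
  by rewrite -mulmxA L0_P0 mul_mx_scalar scalerA.
have := e1 _ _ vx vP; rewrite -lE (e1' _ _ vx vP) => /(scalemx_inj d1_neq0).
rewrite e2 // e2' // => /(scalemx_inj (msym_neq0 sg h0_neq0)) ee.
by rewrite -yw -e3 -e3' ee.
Qed.

Lemma hull_rel_comp u1 u2 f1 f2 : hull_rel u1 f1 -> hull_rel u2 f2 ->
  hull_rel (u1 \o u2) (f1 \o f2).
Proof.
case=> b1 [sg1 [U1 [x1 [[uE1 ur1] h1 r1 c1]]]] [b2 [sg2 [U2 [x2 [[uE2 ur2] h2 r2 c2]]]]].
split; first exact: bij_comp.
have uD (u : 'rV[E]_m.+1 -> 'rV[E]_m.+1) U :
    (forall v, u v = \sum_(i < s) map_mx (fr pE i) v *m U i) -> {morph u : x y / x + y}.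
  move=> uE x y; rewrite !uE -big_split; apply: eq_bigr => i _.
  by rewrite map_mxD mulmxDl.
have [|U uE] := @additive_frob p E pE _ _ (u1 \o u2).
  by move=> x y; rewrite /= (uD _ _ uE2) (uD _ _ uE1).
exists (sg2 * sg1)%g, U, (x1 \o x2); split.
- by split=> // i v; rewrite /= ur2 ur1 permM.
- move=> v y vx vP; rewrite (ulift_comp sg1 sg2 v uE1 uE2 uE) /=.
  apply: h1; last exact: h2.
  exact: (lifts_stable (conj uE2 ur2)).
- by move=> h y hr; rewrite /= r2 // r1 ?msymMm //; apply: rational_msym.
by move=> y; rewrite /= c1 c2.
Qed.

Lemma hull_rel_cent c : cent c -> c \in unitmx ->
  hull_rel (fun v => v *m c) (fun w => w *m beta c).
Proof.
move=> cc cu; split; first by exists (mulmxr (invmx c)) => v /=; rewrite (mulmxK, mulmxKV).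
have [|U uE] := @additive_frob p E pE _ _ (fun v => v *m c).
  by move=> x y; rewrite mulmxDl.
have lE v : ulift 1%g U v = v *m cmx c.
  elim/mpoly_mx_ind: v => [|a b IHa IHb|mu w]; first by rewrite ulift0 mul0mx.
    by rewrite uliftD IHa IHb mulmxDl.
  by rewrite (ulift_monomial 1%g uE) msym1m map_mxM scalemxAl.
exists 1%g, U, (fun y => y *m cmx (beta c)); split.
- by split=> // i v; rewrite perm1 -!mulmxA cent_comm.
- by move=> v y vx vP; rewrite lE P0_cent // vP scalemxAl.
- by move=> h y _; rewrite msym1m scalemxAl.
move=> y; apply/rowP => q; rewrite !mxE raddf_sum; apply: eq_bigr => j _ /=.
by rewrite !mxE rmorphM /= mpolyCK.
Qed.

Lemma hull_rel_ext u u' f : u =1 u' -> hull_rel u f -> hull_rel u' f.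
Proof.
move=> e [ub [sg [U [x [[uE ur] h1 h2 h3]]]]]; split; first exact: eq_bij ub _ e.
by exists sg, U, x; split=> //; split=> [v|i v]; rewrite -!e.
Qed.

End Hull.

(** * Descent along central subgroups *)

Section NormalizerRelation.
Variables (gT : finGroupType) (E : finFieldType).

(** Both inclusions of the normalising condition are recorded, which makes the passage to inverses
    immediate. *)
Definition in_norm m (G : {group gT}) (rho : gT -> 'M[E]_m) (u : 'rV[E]_m -> 'rV[E]_m) :=
  [/\ {morph u : x y / x + y}, bijective u,
      forall g, g \in G -> exists2 h, h \in G & forall v, u (v *m rho g) = u v *m rho h &
      forall h, h \in G -> exists2 g, g \in G & forall v, u (v *m rho g) = u v *m rho h].

(** A homomorphism on the normaliser given by its graph, with prescribed values on the units of A^G.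
    Functions are compared pointwise, hence the last clause. *)
Definition norm_rel m l (G : {group gT}) (rho : gT -> 'M[E]_m) (beta : 'M[E]_m -> 'M[E]_l)
    (Phi : ('rV[E]_m -> 'rV[E]_m) -> ('rV[E]_l -> 'rV[E]_l) -> Prop) :=
  [/\ forall u, in_norm G rho u -> exists f, Phi u f /\ {morph f : x y / x + y},
      forall u f f', Phi u f -> Phi u f' -> f =1 f',
      forall u u' f f', Phi u f -> Phi u' f' -> Phi (u \o u') (f \o f'),
      forall c, centmx rho G c -> c \in unitmx -> Phi (fun v => v *m c) (fun w => w *m beta c) &
      forall u u' f, u =1 u' -> Phi u f -> Phi u' f].

End NormalizerRelation.

Lemma row_scalar (S : pzSemiRingType) l (j : 'I_l) (c : S) : row j c%:M = c *: 'e_j.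
Proof.
by apply/rowP => q; rewrite !mxE /= [q == j]eq_sym mulr_natr.
Qed.

Lemma enum_rep (gT : finGroupType) (E : finFieldType) m (Z : {group gT}) (rho : gT -> 'M[E]_m) :
  exists n (zz : 'I_n -> gT), [/\ forall i, zz i \in Z, injective (fun i => rho (zz i)) &
    forall z, z \in Z -> exists i, rho z = rho (zz i)].
Proof.
pose S := [set rho z | z in Z]; exists #|S|.
have /fin_all_exists2 [zz zzZ zzE] (i : 'I_#|S|) : exists2 z, z \in Z & rho z = enum_val i.
  by have /imsetP [z zZ ->] := enum_valP i; exists z.
exists zz; split=> // [i j|z zZ]; first by rewrite !zzE => /enum_val_inj.
have zS : rho z \in S by apply: imset_f.
by exists (enum_rank_in zS (rho z)); rewrite zzE enum_rankK_in.
Qed.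

Theorem hull_step (p : nat) (gT : finGroupType) (E : finFieldType) m (Z : {group gT})
    (rho : gT -> 'M[E]_m) (I : finType) (X Y : I -> 'M[E]_m) :
  p \in [pchar E] -> (p.-group Z)%g -> is_rep Z rho ->
  (forall z, z \in Z -> rho z ^+ p = 1) ->
  {in Z &, forall y z, rho y *m rho z = rho z *m rho y} ->
  dual_bases X Y -> perm_fam Z rho X ->
  exists l (beta : 'M[E]_m -> 'M[E]_l) Phi,
    brauer_map p Z rho X beta /\ norm_rel Z rho beta Phi.
Proof.
move=> pE pZ rhoP rp rC XY permX.
have [l [beta bP]] := brauer_map_exists pE pZ rhoP XY permX.
exists l, beta; case: l beta bP => [|l] beta bP.
  exists (fun _ _ => True); split=> //; split=> // [u _|u f f' _ _ w].
    by exists id.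
  by rewrite !thinmx0.
case: m rho X Y beta rhoP rp rC XY permX bP => [|m] rho X Y beta rhoP rp rC XY permX bP.
  case: (bP) => _ b1 _ _ _; move: b1; rewrite flatmx0 -(flatmx0 0) (beta1_0 bP).
  by move/matrixP/(_ 0 0)/eqP; rewrite !mxE eq_sym oner_eq0.
have [n [zz [zzZ zz_inj zzE]]] := enum_rep Z rho.
have rhoE : elem_rep p Z zz rho by split.
have [P0 [A1 A2 A3 [v0 [v0x v0P]]]] := generic_lattice pE ord0 pZ zzZ rhoE XY permX bP.
have [i0 fi0] : exists i, (v0 *m P0) 0 i != 0.
  apply/existsP; apply: contraNT v0P => /existsPn h; apply/eqP/rowP => i.
  by have := h i; rewrite negbK [RHS]mxE => /eqP.
(* The coordinates of the image of ker xi under [P0], that is, elements of the ideal I. *)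
pose J (f : {mpoly E[n]}) := exists (v : 'rV_m.+1) i, v *m xiR zz rho = 0 /\ f = (v *m P0) 0 i.
have [|d1 [d1n d1div d1gcd]] := @gcd_family E n J ((v0 *m P0) 0 i0) _ fi0.
  by exists v0, i0.
have [f fE] : divides d1 ((v0 *m P0) 0 i0) by apply: d1div; exists v0, i0.
have fn : f != 0 by apply: contraNneq fi0 => f0; rewrite fE f0 mul0r.
have [h0 [h0n h0r [c hc]]] := rational_multiple pE fn.
have cent_delta i j : exists2 a, centmx rho Z a & beta a = delta_mx i j.
  exact: brauer_map_surj rhoP bP _.
have cent_comm a i : centmx rho Z a -> a *m rho (zz i) = rho (zz i) *m a.
  by move=> ca; rewrite ca.
have /fin_all_exists [aa aaP] j : exists a, centmx rho Z a /\ beta a = delta_mx i0 j.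
  by have [a] := cent_delta i0 j; exists a.
(* The coordinate d1 f of [v0 *m P0] at [i0] is moved to place j by a lift of the matrix unit, and
   [c] turns f into the rational [h0]. *)
pose L0 := \matrix_j (c *: (v0 *m cmx (aa j))).
have L0x : L0 *m xiR zz rho = 0.
  apply/row_matrixP => j; rewrite row_mul rowK row0 -scalemxAl -mulmxA.
  have -> : cmx (aa j) *m xiR zz rho = xiR zz rho *m cmx (aa j).
    by apply: (cent_xi cent_comm); case: (aaP j).
  by rewrite mulmxA v0x mul0mx scaler0.
have L0P : L0 *m P0 = (d1 * h0)%:M.
  apply/row_matrixP => j; rewrite row_mul rowK -scalemxAl.
  case: (aaP j) => ca ba; rewrite A1 // ba map_delta_mx row_mul_delta fE scalerA.
  by rewrite mulrA -hc row_scalar mulrC.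
exists (hull_rel pE (fun i => rho (zz i)) P0 d1); split=> //; split.
- move=> u [uD ub un _].
  apply: (@hull_rel_exists p E pE n m l.+1 (fun i => rho (zz i)) (centmx rho Z) beta zz_inj P0 d1 h0 L0) => //.
  + move=> v vx vP; have [h [v' [hn he]]] := A2 v vx vP.
    have [h' [h'n h'r [c' e']]] := rational_multiple pE hn.
    by exists h', (c' *: v'); split=> //; rewrite e' -scalerA he scalemxAl.
  + by move=> v i vx; apply: d1div; exists v, i.
  + by move=> h b hd; apply: d1gcd => g [v [i [vx ->]]]; apply: hd.
  + move=> i; have [z zZ e] := un _ (zzZ i); have [j ez] := zzE z zZ.
    by exists j => v; rewrite e ez.
- move=> u f1 f2; apply: (hull_rel_unique zz_inj d1n h0n h0r L0x L0P).
- move=> u u' f1 f2; apply: hull_rel_comp.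
- by move=> b cb ub; apply: (hull_rel_cent pE d1 A1 cent_comm cb ub).
by move=> u u' g; apply: hull_rel_ext.
Qed.

Lemma mulmx_row_ext (k : pzSemiRingType) m q (a b : 'M[k]_(m, q)) :
  (forall v : 'rV_m, v *m a = v *m b) -> a = b.
Proof. by move=> e; apply/row_matrixP => i; rewrite !rowE. Qed.

Lemma cent_invmx (gT : finGroupType) (k : fieldType) m (rho : gT -> 'M[k]_m) (H : {set gT}) c :
  c \in unitmx -> centmx rho H c -> centmx rho H (invmx c).
Proof.
move=> cu cc h hH; apply: (can_inj (mulKmx cu)); apply: (can_inj (mulmxK cu)).
by rewrite /= !mulmxA mulmxV // mul1mx mulmxKV // cc.
Qed.

Section CentralStep.
Variables (p : nat) (gT : finGroupType) (k : fieldType) (m : nat) (G : {group gT})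
  (rho : gT -> 'M[k]_m).
Hypothesis rhoP : is_rep G rho.

Definition centp_set := [set z in G |
  (rho z ^+ p == 1) && [forall g in G, rho g *m rho z == rho z *m rho g]].

Lemma centpP z : reflect [/\ z \in G, rho z ^+ p = 1 &
  forall g, g \in G -> rho g *m rho z = rho z *m rho g] (z \in centp_set).
Proof.
rewrite inE; apply: (iffP and3P) => [[zG /eqP zp /forall_inP zC]|[zG zp zC]]; split=> //.
- by move=> g gG; apply/eqP/zC.
- exact/eqP.
by apply/forall_inP => g gG; apply/eqP/zC.
Qed.

Lemma centp_group_set : group_set centp_set.
Proof.
apply/group_setP; split=> [|x y /centpP [xG xp xC] /centpP [yG yp yC]].
  apply/centpP; rewrite (proj1 rhoP); split=> // [|g gG]; first exact: expr1n.
  by rewrite mulmx1 mul1mx.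
apply/centpP; split=> [||g gG]; first exact: groupM.
  rewrite (proj2 rhoP) // mulmxE exprMn_comm ?xp ?yp ?mulr1 //.
  by rewrite /GRing.comm -!mulmxE yC.
by rewrite (proj2 rhoP) // mulmxA xC // -mulmxA yC // mulmxA.
Qed.

Canonical centp := Group centp_group_set.

Lemma centp_sub : centp \subset G.
Proof. by apply/subsetP => z /centpP []. Qed.

Lemma centp_cent g : g \in G -> centmx rho centp (rho g).
Proof. by move=> gG z /centpP [_ _ zC]; rewrite zC. Qed.

End CentralStep.

Section NormRecursion.
Variables (p : nat) (gT : finGroupType) (E : finFieldType).
Hypothesis pE : p \in [pchar E].

(** Conjugation by [u] is an automorphism of the image of G, and central elements of order dividing
    p form a characteristic subgroup. *)
Lemma in_norm_centp m (G : {group gT}) (rho : gT -> 'M[E]_m) (rhoP : is_rep G rho) u :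
  in_norm G rho u -> in_norm (centp p rhoP) rho u.
Proof.
case=> uD ub un un'; split=> // [z /centpP [zG zp zC]|h /centpP [hG hp hC]].
  have [h hG e] := un z zG; exists h => //; apply/centpP; split=> //.
    have eX j v : u (v *m rho z ^+ j) = u v *m rho h ^+ j.
      elim: j v => [|j IH] v; first by rewrite !mulmx1.
      by rewrite !exprS -!mulmxE !mulmxA IH e.
    apply: mulmx_row_ext => w; have [u' _ uK] := ub.
    by rewrite -[w]uK -eX zp !mulmx1.
  move=> g gG; have [g0 g0G e0] := un' g gG; apply: mulmx_row_ext => w.
  have [u' _ uK] := ub.
  by rewrite -[w]uK !mulmxA -e0 -!e -e0 -!mulmxA zC.
have [z zG e] := un' h hG; exists z => //; apply/centpP; split=> //.
  have eX j v : u (v *m rho z ^+ j) = u v *m rho h ^+ j.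
    elim: j v => [|j IH] v; first by rewrite !mulmx1.
    by rewrite !exprS -!mulmxE !mulmxA IH e.
  by apply: mulmx_row_ext => w; apply: (bij_inj ub); rewrite eX hp !mulmx1.
move=> g gG; have [g' g'G e'] := un g gG; apply: mulmx_row_ext => w; apply: (bij_inj ub).
by rewrite !mulmxA e e' e' e -!mulmxA hC.
Qed.

Lemma in_norm_inv m (G : {group gT}) (rho : gT -> 'M[E]_m) u u' :
  cancel u u' -> cancel u' u -> in_norm G rho u -> in_norm G rho u'.
Proof.
move=> uK u'K [uD ub un un']; split.
- by move=> x y; rewrite -{1}[x]u'K -{1}[y]u'K -uD uK.
- by exists u.
- move=> g gG; have [h hG e] := un' g gG; exists h => // v.
  by rewrite -{1}[v]u'K -e uK.
move=> g gG; have [h hG e] := un g gG; exists h => // v.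
by rewrite -{1}[v]u'K -e uK.
Qed.

Section RelImage.
Variables (m l : nat) (G Z : {group gT}) (rho : gT -> 'M[E]_m) (beta : 'M[E]_m -> 'M[E]_l)
  (Phi : ('rV[E]_m -> 'rV[E]_m) -> ('rV[E]_l -> 'rV[E]_l) -> Prop).
Hypotheses (rhoP : is_rep G rho) (ZC : forall g, g \in G -> centmx rho Z (rho g))
  (b1 : beta 1%:M = 1%:M) (PhiP : norm_rel Z rho beta Phi).

Lemma rep_unit g : g \in G -> rho g \in unitmx.
Proof. by move=> gG; have /mulmx1_unit [] := rep_V rhoP gG. Qed.

Lemma rel_cancel u u' f f' : cancel u u' -> Phi u f -> Phi u' f' -> cancel f f'.
Proof.
case: PhiP => _ R2 R3 R4 R5 uK Pu Pu' w.
have P1 := R4 1%:M (@cent1 _ _ _ _ _) (unitmx1 _ _).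
have e : u' \o u =1 (fun v => v *m 1%:M) by move=> v; rewrite /= uK mulmx1.
by have := R2 _ _ _ (R5 _ _ _ e (R3 _ _ _ _ Pu' Pu)) P1 w; rewrite /= b1 mulmx1.
Qed.

(** The [rho g] themselves centralise the image of Z, so the graph applies to them, and the relation
    between [u], [rho g] and [rho h] passes to the quotient by uniqueness. *)
Lemma rel_intertwine u f g h : g \in G -> h \in G -> Phi u f ->
  (forall v, u (v *m rho g) = u v *m rho h) ->
  forall w, f (w *m beta (rho g)) = f w *m beta (rho h).
Proof.
case: PhiP => _ R2 R3 R4 R5 gG hG Pu e.
have Pg := R4 _ (ZC gG) (rep_unit gG); have Ph := R4 _ (ZC hG) (rep_unit hG).
exact: (R2 _ _ _ (R5 _ (fun v => u v *m rho h) _ e (R3 _ _ _ _ Pu Pg)) (R3 _ _ _ _ Ph Pu)).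
Qed.

Lemma rel_in_norm u f : in_norm Z rho u -> in_norm G rho u -> Phi u f ->
  {morph f : x y / x + y} -> in_norm G (rho1 rho beta) f.
Proof.
case: (PhiP) => R1 _ _ _ _ uZ [_ [u' uK u'K] un un'] Pu fD.
have [f' [Pf' _]] := R1 _ (in_norm_inv uK u'K uZ).
split=> //.
- by exists f'; [apply: (rel_cancel uK) | apply: (rel_cancel u'K)].
- by move=> g gG; have [h hG e] := un g gG; exists h => //; apply: (rel_intertwine gG hG Pu e).
by move=> h hG; have [g gG e] := un' h hG; exists g => //; apply: (rel_intertwine gG hG Pu e).
Qed.

End RelImage.

Theorem brauer_norm_exists (G : {group gT}) m (rho : gT -> 'M[E]_m) (I : finType)
    (X Y : I -> 'M[E]_m) :
  (p.-group G)%g -> is_rep G rho -> dual_bases X Y -> perm_fam G rho X ->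
  exists l (beta : 'M[E]_m -> 'M[E]_l) Phi,
    brauer_map p G rho X beta /\ norm_rel G rho beta Phi.
Proof.
move=> pG; have [n] := ubnP (#|G| - #|rep_ker G rho|).
elim: n m rho I X Y => // n IH m rho I X Y lt rhoP XY permX.
have [kG|kG] := eqVneq (rep_ker G rho) G.
  exists m, id, (fun u f => u =1 f); split.
    by apply: (id_brauer_map pE rhoP XY) => g; rewrite -kG inE => /andP[_ /eqP].
  split=> // [u [uD _ _ _]|u f f' e e' w|u u' f f' e e' w|u u' f e e' w].
  - by exists u.
  - by rewrite -e e'.
  - by rewrite /= e' e.
  by rewrite -e e'.
have [z [zG z1 zp zC]] := central_elt pE pG rhoP kG.
pose Z := [group of centp p rhoP].
have zZ : z \in Z by apply/centpP.
have sZ : Z \subset G := centp_sub p rhoP.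
have ZC := @centp_cent p _ _ _ _ _ rhoP.
have rhoZ := rep_sub rhoP sZ.
have permZ : perm_fam Z rho X.
  by move=> g i gZ; apply: permX; apply: (subsetP sZ).
have ZX y : y \in Z -> rho y ^+ p = 1 by case/centpP.
have [|l [b1 [Phi1 [b1P P1]]]] := hull_step pE (pgroupS sZ pG) rhoZ ZX _ XY permZ.
  by move=> x y xZ yZ; case/centpP: yZ => yG _ ->//; apply: (subsetP sZ).
have [Y1 XY1] := dual_bases1 b1P.
have [||||l2 [b2 [Phi2 [b2P P2]]]] := IH _ (rho1 rho b1) _ (X1 b1) Y1.
- rewrite -ltnS; apply: leq_trans lt; rewrite ltnS ltn_sub2l //.
    rewrite ltn_neqAle subset_leq_card ?andbT; last by apply/subsetP => x; rewrite inE => /andP[].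
    apply: contra kG => /eqP e; rewrite eqEcard e leqnn andbT.
    by apply/subsetP => x; rewrite inE => /andP[].
  apply: proper_card; apply/properP; split.
    apply/subsetP => x; rewrite !inE => /andP[-> /eqP x1] /=.
    by rewrite /rho1 x1; case: b1P => _ ->.
  exists z; rewrite !inE zG ?(negPf z1) //=.
  by rewrite (rho1_trivial rhoP sZ ZC b1P).
- exact: (is_rep1 rhoP ZC b1P).
- by [].
- exact: (perm_fam1 rhoP permX sZ ZC b1P).
(* The graphs are joined through an additive bijection [f1] of the intermediate quotient, which
   normalises the image of G there by [rel_in_norm]. *)
exists l2, (b2 \o b1), (fun u f => exists2 f1, Phi1 u f1 & Phi2 f1 f); split.
  exact: (compose_brauer_map pG rhoP permX sZ ZC b1P b2P).
case: (b1P) => _ b11 bM _ _.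
case: (P1) => R1 R2 R3 R4 R5; case: P2 => S1 S2 S3 S4 S5; split.
- move=> u uN; have uZ : in_norm Z rho u by apply: in_norm_centp.
  have [f1 [Pf1 f1D]] := R1 u uZ.
  have [f [Pf fD]] := S1 f1 (rel_in_norm rhoP ZC b11 P1 uZ uN Pf1 f1D).
  by exists f; split=> //; exists f1.
- move=> u f f' [f1 a1 a2] [f1' a1' a2']; apply: S2 a2'.
  exact: S5 (R2 _ _ _ a1 a1') a2.
- move=> u u' f f' [f1 a1 a2] [f1' a1' a2']; exists (f1 \o f1'); first exact: R3.
  exact: S3.
- move=> c cG cu; exists (fun w => w *m b1 c); last apply: S4.
  + by apply: R4 => //; apply: cent_sub cG.
  + move=> g gG; rewrite /rho1 -!bM ?cG //; try exact: ZC.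
      exact: cent_sub cG.
    exact: cent_sub cG.
  have cZ : centmx rho Z c by apply: cent_sub cG.
  have : b1 c *m b1 (invmx c) = 1%:M by rewrite -bM ?mulmxV //; apply: cent_invmx.
  by case/mulmx1_unit.
by move=> u u' f e [f1 a1 a2]; exists f1 => //; apply: R5 a1.
Qed.

End NormRecursion.

(** * The theorem *)

Lemma additive_Fp_mx p a b (f : 'rV['F_p]_a -> 'rV['F_p]_b) : {morph f : x y / x + y} ->
  exists M, forall v, f v = v *m M.
Proof.
move=> fD; have f0 : f 0 = 0 by apply: (addrI (f 0)); rewrite -fD !addr0.
have fMn n x : f (x *+ n) = f x *+ n.
  by elim: n => // n IH; rewrite !mulrS fD IH.
exists (\matrix_i f 'e_i) => v.
rewrite {1}(row_sum_delta v) (big_morph f fD f0) mulmx_sum_row; apply: eq_bigr => i _.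
by rewrite rowK -[v 0 i]natr_Zp !scaler_nat fMn.
Qed.

(* [M_q(E)] has a unique simple module, so counting shows that a module of size [|E|^q]
   is the standard one. *)
Lemma standard_module p (E : finFieldType) (pE : p \in [pchar E]) q s
    (j : 'M[E]_q -> 'M['F_p]_(q * s)) :
  s = \dim (fullv : {vspace pPrimeCharType pE}) -> unitary_embedding j ->
  exists k : 'rV[E]_q -> 'rV['F_p]_(q * s),
    [/\ {morph k : x y / x + y}, bijective k & forall w a, k (w *m a) = k w *m j a].
Proof.
move=> sE [jD jM j1 jI].
have j0 : j 0 = 0 by apply: (addrI (j 0)); rewrite -jD !addr0.
have cardE : #|'rV['F_p]_(q * s)| = #|'rV[E]_q|.
  have /andP [p_pr _] := pE.
  by rewrite !card_mx !mul1n card_Fp // (card_pchar_field pE) -sE -expnM mulnC.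
have [k [kD kI kM]] : exists k : 'rV[E]_q -> 'rV['F_p]_(q * s),
   [/\ {morph k : x y / x + y}, injective k & forall w a, k (w *m a) = k w *m j a].
  case: q j jD jM j1 jI j0 {cardE} => [|q] j jD jM j1 jI j0.
    exists (fun=> 0); split=> [x y|x y _|w a]; first by rewrite addr0.
      by rewrite !thinmx0.
    by rewrite mul0mx.
  pose d : 'M[E]_q.+1 := delta_mx 0 0.
  have [v0 v0d] : exists v0 : 'rV_(q.+1 * s), v0 *m j d != 0.
    have dn : j d != 0.
      rewrite -j0; apply/eqP => /jI/matrixP/(_ 0 0)/eqP.
      by rewrite !mxE !eqxx oner_eq0.
    by have /rowV0Pn [v /submxP [D ->]] := dn; exists D.
  (* [w] becomes the first row of a matrix that is zero elsewhere. These matrices form a simple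
     right ideal, which [v0] embeds in the module. *)
  pose k (w : 'rV[E]_q.+1) := v0 *m j (delta_mx 0 0 *m w).
  have kD : {morph k : x y / x + y} by move=> x y; rewrite /k mulmxDr jD mulmxDr.
  have kM w a : k (w *m a) = k w *m j a by rewrite /k mulmxA jM mulmxA.
  have k0 w : k w = 0 -> w = 0.
    move=> kw; apply/rowP => t; rewrite [RHS]mxE; apply/eqP; apply: contraNT v0d => wt.
    suff -> : v0 *m j d = k (w *m ((w 0 t)^-1 *: delta_mx t 0)) by rewrite kM kw mul0mx.
    rewrite -scalemxAr row_mul_delta scalerA mulVf // scale1r /k; congr (_ *m j _).
    by rewrite mul_delta_mx.
  exists k; split=> // x y e; apply/eqP; rewrite -subr_eq0; apply/eqP/k0.
  by apply: (addIr (k y)); rewrite -kD subrK e add0r.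
exists k; split=> //; apply: inj_card_bij => //.
by rewrite cardE.
Qed.

Section Assembly.
Variables (p : nat) (gT : finGroupType) (D : {group gT}) (E : finFieldType) (m : nat)
  (act : gT -> 'M[E]_m -> 'M[E]_m) (rho : gT -> 'M[E]_m).
Hypotheses (pD : (p.-group D)%g)
  (rho_unit : forall d, d \in D -> rho d \in unitmx)
  (rho_morph : forall d e, d \in D -> e \in D -> rho (d * e)%g = rho d *m rho e)
  (rho_act : forall d x, d \in D -> act d x = invmx (rho d) *m x *m rho d).

Lemma rho_rep : is_rep D rho.
Proof.
split=> [|x y xD yD]; last exact: rho_morph.
have u1 := rho_unit (group1 D).
have := rho_morph (group1 D) (group1 D); rewrite mulg1.
by move=> /(congr1 (mulmx (invmx (rho 1%g)))); rewrite mulKmx // mulVmx.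
Qed.

Lemma act_rconj d x : d \in D -> act d x = rconj rho d x.
Proof.
move=> dD; rewrite rho_act // /rconj; congr (_ *m _ *m _).
by rewrite -[LHS]mul1mx -(repV rho_rep dD) mulmxK ?rho_unit.
Qed.

Lemma fixpts_cent (H : {group gT}) x : H \subset D -> (x \in fixpts act H) <-> centmx rho H x.
Proof.
move=> sHD; have HD := subsetP sHD; rewrite inE; split=> [/forall_inP fx h hH|cx].
  by apply/(rconj_fix rho_rep) => //; [apply: HD | rewrite -act_rconj ?HD //; apply/eqP/fx].
apply/forall_inP => h hH; apply/eqP; rewrite act_rconj ?HD //.
by apply/(rconj_fix rho_rep); [apply: HD | apply: cx].
Qed.

Lemma gtr_brauer_ideal (H : {group gT}) g a : maximal H D -> g \in D -> g \notin H ->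
  centmx rho H a -> gtr p rho g a \in brauer_ideal act D.
Proof.
move=> mH gD gH ca; have sH := proper_sub (maxgroupp mH).
apply: memv_span; rewrite mem_enum; apply/imset2P.
exists H a; first by rewrite inE (maxgroupp mH).
  exact: (proj2 (fixpts_cent a sH) ca).
rewrite (gtr_rcosets pD rho_rep mH gD gH ca); apply: eq_bigr => C /rcosetsP [x xD ->].
rewrite act_rconj //; apply: (subsetP _ _ (mem_repr_rcoset H x)).
by rewrite mul_subG // sub1set.
Qed.

Lemma dade_basis : is_Dade act D -> exists (I : finType) (X Y : I -> 'M[E]_m),
  dual_bases X Y /\ perm_fam D rho X.
Proof.
case=> _ [X [Xb XD _]]; exists 'I_(size X), (fun i : 'I_(size X) => X`_i).
have [span_X free_X] := andP Xb.
have [||Y XY] := @dual_exists E m _ (fun i : 'I_(size X) => X`_i).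
- by move=> c h i; have /(@freeP _ _ _ (in_tuple X))/(_ c h i) := free_X.
- move=> b; exists (fun i => coord (in_tuple X) i b).
  exact: (@coord_basis _ _ fullv _ (in_tuple X) b Xb (memvf b)).
exists Y; split=> // g i gD; have := XD g _ gD (mem_nth 0 (ltn_ord i)).
move/(nthP 0) => [j jl e]; exists (Ordinal jl); rewrite -act_rconj //.
Qed.

Section Quotient.
Variables (I : finType) (X Y : I -> 'M[E]_m) (l : nat) (beta : 'M[E]_m -> 'M[E]_l)
  (B : falgType E) (br : 'M[E]_m -> B).
Hypotheses (XY : dual_bases X Y) (permX : perm_fam D rho X)
  (bP : brauer_map p D rho X beta) (brP : is_brauer_quotient act D br).

Let fixC x : (x \in fixpts act D) <-> centmx rho D x.
Proof. exact: fixpts_cent. Qed.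

Let br_lin a x y : centmx rho D x -> centmx rho D y -> br (a *: x + y) = a *: br x + br y.
Proof. by case: brP => lin _ _ _ _ /fixC cx /fixC cy; apply: lin. Qed.

Let brM x y : centmx rho D x -> centmx rho D y -> br (x *m y) = br x * br y.
Proof. by case: brP => _ mul _ _ _ /fixC cx /fixC cy; apply: mul. Qed.

Let br0 : br 0 = 0.
Proof.
have := br_lin 1 (@cent0 _ _ _ rho D) (@cent0 _ _ _ rho D); rewrite !scale1r addr0 => h.
by apply: (addrI (br 0)); rewrite -h addr0.
Qed.

Lemma quotient_ker x : centmx rho D x -> beta x = 0 -> br x = 0.
Proof.
move=> cx bx; case: (brP) => _ _ _ _ kerP.
apply/eqP; rewrite kerP; last exact/fixC.
have [T [TP ->]] := brauer_map_ker pD rho_rep XY permX bP cx bx.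
rewrite big_seq; apply: rpred_sum => t /TP [H [mH tG tH ct]].
exact: gtr_brauer_ideal mH tG tH ct.
Qed.

Lemma quotient_eq x y : centmx rho D x -> centmx rho D y -> beta x = beta y -> br x = br y.
Proof.
move=> cx cy e; have /quotient_ker : centmx rho D (-1 *: y + x) by apply: centD; first exact: centZ.
case: (bP) => lin _ _ _ _; rewrite lin e scaleN1r addNr br_lin // scaleN1r addrC => /(_ erefl)/eqP.
by rewrite subr_eq0 => /eqP.
Qed.

(* A nonzero element of the matrix algebra generates it as a two-sided ideal. *)
Lemma quotient_inj x : centmx rho D x -> br x = 0 -> beta x = 0.
Proof.
move=> cx bx; apply/matrixP => i j; rewrite [RHS]mxE; apply/eqP; apply: contraT => bij.
have /fin_all_exists2 [aa aaC aaE] (t : 'I_l * 'I_l) := brauer_map_surj rho_rep bP (delta_mx t.1 t.2).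
pose y := \sum_k aa (k, i) *m x *m aa (j, k).
have cy k : centmx rho D (aa (k, i) *m x *m aa (j, k)) by do 2!apply: centM => //.
case: (bP) => lin b1 bM _ _.
have by1 : beta y = beta (beta x i j *: 1%:M + 0).
  rewrite lin (beta1_0 bP) addr0 b1 (beta1_sum bP) mx1_sum_delta scaler_sumr.
  apply: eq_bigr => k _; rewrite !bM ?aaE //=; last exact: centM.
  rewrite -(mul_delta_mx (0 : 'I_1) k i) -!mulmxA (mulmxA 'e_i) -rowE row_mul_delta mxE.
  by rewrite -scalemxAr mul_delta_mx.
have yC : centmx rho D y by apply: cent_sum.
have C0 : centmx rho D (beta x i j *: 1%:M + 0).
  by apply: centD; [apply/centZ/cent1 | apply: cent0].
have := quotient_eq yC C0 by1; rewrite br_lin ?br0 ?addr0; [|exact: cent1|exact: cent0].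
have -> : br y = 0.
  have brS (r : seq 'I_l) : centmx rho D (\sum_(k <- r) aa (k, i) *m x *m aa (j, k)) /\
      br (\sum_(k <- r) aa (k, i) *m x *m aa (j, k)) = 0.
    elim: r => [|k r [IHc IH]]; first by rewrite big_nil; split; [apply: cent0 | apply: br0].
    rewrite big_cons; split; first exact: centD.
    rewrite -[aa (k, i) *m x *m _]scale1r br_lin // IH addr0 scale1r.
    by rewrite !brM ?bx ?mulr0 ?mul0r //; apply: centM.
  by case: (brS (index_enum 'I_l)).
case: (brP) => _ _ -> _ _ /esym/eqP; by rewrite scaler_eq0 oner_eq0 orbF (negPf bij).
Qed.

(** [br] and [beta] are both onto and have the same kernel on the commutant of D. *)
Lemma quotient_iso : exists j : 'M[E]_l -> B,
  [/\ forall a x y, j (a *: x + y) = a *: j x + j y,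
      forall x y, j (x *m y) = j x * j y, j 1%:M = 1, bijective j &
      forall x, centmx rho D x -> j (beta x) = br x].
Proof.
have /fin_all_exists2 [sec secC secE] (M : 'M[E]_l) := brauer_map_surj rho_rep bP M.
pose j M := br (sec M).
have jE x : centmx rho D x -> j (beta x) = br x by move=> cx; apply: quotient_eq; rewrite ?secE.
case: (bP) => lin b1 bM _ _; case: (brP) => _ _ br1 brS _.
have jL a x y : j (a *: x + y) = a *: j x + j y.
  rewrite -[x in LHS]secE -[y in LHS]secE -lin jE ?br_lin //.
  by apply: centD => //; apply: centZ.
exists j; split=> //.
- by move=> x y; rewrite -[x in LHS]secE -[y in LHS]secE -bM // jE ?brM //; apply: centM.
- by rewrite -b1 jE //; apply: cent1.
have jI : injective j.
  move=> x y e; apply/eqP; rewrite -subr_eq0; apply/eqP.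
  have e0 : j (x - y) = 0 by rewrite addrC -scaleN1r jL e scaleN1r addNr.
  by rewrite -[x - y]secE; apply: quotient_inj.
have /= jS b : exists x, j x == b.
  by have [x /fixC cx xb] := brS b; exists (beta x); rewrite jE // xb.
exists (fun b => xchoose (jS b)) => [x|b].
  by apply: jI; apply/eqP/(xchooseP (jS (j x))).
exact/eqP/(xchooseP (jS b)).
Qed.

(** This identifies the size of the matrix algebra produced by the descent with the given [l]. *)
Lemma quotient_dim : \dim (fullv : {vspace B}) = (l * l)%N.
Proof.
have [j [jL _ _ [j' jK j'K] _]] := quotient_iso.
have jl : linear j by move=> a x y; apply: jL.
pose jz : {linear 'M[E]_l -> B} := HB.pack j (GRing.isLinear.Build _ _ _ _ j jl).
pose f := linfun jz.
have fE x : f x = j x by rewrite lfunE.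
have fker : lker f = 0%VS.
  by apply/eqP/lker0P => x y; rewrite !fE => /(can_inj jK).
have <- : (f @: fullv)%VS = fullv.
  apply/vspaceP => b; rewrite memvf; apply/memv_imgP; exists (j' b); first exact: memvf.
  by rewrite fE j'K.
by rewrite limg_dim_eq ?fker ?capv0 // dimvf dim_matrix.
Qed.

End Quotient.
End Assembly.

Lemma in_norm_comp (gT : finGroupType) (E : finFieldType) m (G : {group gT})
    (rho : gT -> 'M[E]_m) u u' : in_norm G rho u -> in_norm G rho u' -> in_norm G rho (u \o u').
Proof.
case=> uD ub un un' [vD vb vn vn']; split.
- by move=> x y; rewrite /= vD uD.
- exact: bij_comp.
- move=> g gG; have [h hG e] := vn g gG; have [k kG e'] := un h hG.
  by exists k => // v; rewrite /= e e'.
move=> k kG; have [h hG e] := un' k kG; have [g gG e'] := vn' h hG.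
by exists g => // v; rewrite /= e' e.
Qed.

Lemma in_norm_cent (gT : finGroupType) (E : finFieldType) m (G : {group gT})
    (rho : gT -> 'M[E]_m) c : centmx rho G c -> c \in unitmx -> in_norm G rho (fun v => v *m c).
Proof.
move=> cC cu; split.
- by move=> x y; rewrite mulmxDl.
- by exists (fun v => v *m invmx c) => v; rewrite (mulmxK, mulmxKV).
- by move=> g gG; exists g => // v; rewrite -!mulmxA cC.
by move=> g gG; exists g => // v; rewrite -!mulmxA cC.
Qed.

Lemma eq_in_norm (gT : finGroupType) (E : finFieldType) m (G : {group gT})
    (rho : gT -> 'M[E]_m) u u' : u =1 u' -> in_norm G rho u -> in_norm G rho u'.
Proof.
move=> e [uD ub un un']; split.
- by move=> x y; rewrite -!e.
- exact: eq_bij ub _ e.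
- by move=> g gG; have [h hG eh] := un g gG; exists h => // v; rewrite -!e.
by move=> g gG; have [h hG eh] := un' g gG; exists h => // v; rewrite -!e.
Qed.

Theorem mainTheorem14
  (p : nat) (gT : finGroupType) (D : {group gT}) (pD : (p.-group D)%g)
  (E : finFieldType) (pcharEp : p \in [pchar E])
  (m : nat) (act : gT -> 'M[E]_m -> 'M[E]_m) (Dade : is_Dade act D)
  (rho : gT -> 'M[E]_m)
  (rho_unit : forall d, d \in D -> rho d \in unitmx)
  (rho_morph : forall d e, d \in D -> e \in D -> rho (d * e)%g = rho d *m rho e)
  (rho_act : forall d x, d \in D -> act d x = invmx (rho d) *m x *m rho d)
  (B : falgType E) (br : 'M[E]_m -> B) (brP : is_brauer_quotient act D br)
  (l : nat) (dimB : \dim (fullv : {vspace B}) = (l * l)%N)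
  (s : nat) (degE : s = \dim (fullv : {vspace pPrimeCharType pcharEp}))
  (iota : 'M[E]_m -> 'M['F_p]_(m * s)) (iotaP : unitary_embedding iota)
  (iota' : B -> 'M['F_p]_(l * s)) (iota'P : unitary_embedding iota') :
  exists phi : 'M['F_p]_(m * s) -> 'M['F_p]_(l * s),
    let N := unit_normalizer [set iota (rho d) | d in D] in
    [/\ (forall u, u \in N -> phi u \in unitmx),
        (forall u v, u \in N -> v \in N -> phi (u *m v) = phi u *m phi v) &
        (forall c, c \in fixpts act D -> c \in unitmx -> invmx c \in fixpts act D ->
           phi (iota c) = iota' (br c))].
Proof.
have rhoP := rho_rep rho_unit rho_morph.
have [I [X [Y [XY permX]]]] := dade_basis rho_unit rho_morph rho_act Dade.
have [l' [beta [Phi [bP PhiP]]]] := brauer_norm_exists pcharEp pD rhoP XY permX.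
have dimB' := quotient_dim pD rho_unit rho_morph rho_act XY permX bP brP.
have el : l' = l.
  by apply/eqP; rewrite -(eqn_exp2r _ _ (isT : 0 < 2)%N) -!mulnn -dimB' dimB.
subst l'.
have [j [jL jM j1 jb jE]] := quotient_iso pD rho_unit rho_morph rho_act XY permX bP brP.
have [k1 [k1D [k1' k1K k1'K] k1M]] := standard_module degE iotaP.
(* Moving [iota'] to the matrix algebra along [j] lets [standard_module] apply to it as well. *)
have jU : unitary_embedding (iota' \o j).
  case: iota'P => iD iM i1 iI; split.
  - by move=> x y; have := jL 1 x y; rewrite !scale1r /= => ->; rewrite iD.
  - by move=> x y; rewrite /= jM iM.
  - by rewrite /= j1 i1.
  exact: inj_comp iI (bij_inj jb).
have [k2 [k2D [k2' k2K k2'K] k2M]] := standard_module degE jU.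
have k1'D : {morph k1' : x y / x + y}.
  by move=> x y; rewrite -{1}[x]k1'K -{1}[y]k1'K -k1D k1K.
have k2'D : {morph k2' : x y / x + y}.
  by move=> x y; rewrite -{1}[x]k2'K -{1}[y]k2'K -k2D k2K.
(* Matrices over the prime field act on E^m through [k1]. They act from the right, so a product is
   composed in reverse order. *)
pose tl (u : 'M['F_p]_(m * s)) (w : 'rV[E]_m) := k1' (k1 w *m u).
have tlM u v : tl v \o tl u =1 tl (u *m v).
  by move=> w; rewrite /tl /= k1'K mulmxA.
have tl_iota c : (fun w => w *m c) =1 tl (iota c).
  by move=> w; rewrite /tl -k1M k1K.
have tl_norm u : u \in unit_normalizer [set iota (rho d) | d in D] -> in_norm D rho (tl u).
  rewrite inE => /andP [uu /eqP uS].
  have tlrho d e w : invmx u *m iota (rho d) *m u = iota (rho e) ->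
      tl u (w *m rho d) = tl u w *m rho e.
    move=> ue; rewrite /tl; apply: (can_inj k1K); rewrite k1M !k1'K k1M -ue.
    by rewrite !mulmxA k1'K mulmxK.
  split.
  - by move=> x y; rewrite /tl k1D mulmxDl k1'D.
  - by exists (tl (invmx u)) => w; rewrite /tl k1'K (mulmxK, mulmxKV) ?k1K.
  - move=> d dD; have : invmx u *m iota (rho d) *m u \in [set iota (rho d) | d in D].
      by rewrite -uS; apply/imset_f/imset_f.
    by case/imsetP => e eD ee; exists e => // w; apply: tlrho.
  move=> e eD; have : iota (rho e) \in [set iota (rho d) | d in D] by apply/imset_f.
  rewrite -{1}uS => /imsetP [_ /imsetP [d dD ->] ee].
  by exists d => // w; apply: tlrho.
case: (PhiP) => R1 R2 R3 R4 R5; case: (bP) => _ b1 _ _ _.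
(* The choice runs over the finite set of all matrices; where [tl u] does not normalise the image of
   D the value is 0. *)
have /fin_all_exists [phi phiP] (u : 'M['F_p]_(m * s)) : exists M : 'M['F_p]_(l * s),
    in_norm D rho (tl u) -> exists2 f, Phi (tl u) f & forall w, k2 (f w) = k2 w *m M.
  case: (classic (in_norm D rho (tl u))) => [|n].
    move=> un; have [f [Pf fD]] := R1 _ un.
    have [|M ME] := @additive_Fp_mx p _ _ (k2 \o f \o k2').
      by move=> x y; rewrite /= k2'D fD k2D.
    by exists M => _; exists f => // w; rewrite -ME /= k2K.
  by exists 0.
have phi_val u f : in_norm D rho (tl u) -> Phi (tl u) f -> forall w, k2 (f w) = k2 w *m phi u.
  move=> un Pf w; have [f' Pf' <-] := phiP u un; congr k2; exact: R2 Pf Pf' w.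
have phi_ext u M : (forall w, k2 w *m phi u = k2 w *m M) -> phi u = M.
  by move=> e; apply: mulmx_row_ext => v; rewrite -[v]k2'K.
exists phi; split.
- move=> u /tl_norm un; have [f Pf fE] := phiP u un.
  case: (un) => _ [t tK tK'] _ _; have tn := in_norm_inv tK tK' un.
  have [f' [Pf' f'D]] := R1 _ tn.
  have [|M ME] := @additive_Fp_mx p _ _ (k2 \o f' \o k2').
    by move=> x y; rewrite /= k2'D f'D k2D.
  suff /mulmx1_unit [] : phi u *m M = 1%:M by [].
  apply: mulmx_row_ext => v; rewrite mulmx1 mulmxA -{1}[v]k2'K -fE -ME /= k2K.
  by rewrite (rel_cancel b1 PhiP tK Pf Pf') k2'K.
- move=> u v /tl_norm un /tl_norm vn.
  have [f Pf fE] := phiP u un; have [g Pg gE] := phiP v vn.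
  have uvn := eq_in_norm (tlM u v) (in_norm_comp vn un).
  apply: phi_ext => w; rewrite -(phi_val _ _ uvn (R5 _ _ _ (tlM u v) (R3 _ _ _ _ Pg Pf))) /=.
  by rewrite gE fE mulmxA.
move=> c cf cu _; have cC : centmx rho D c by apply/(fixpts_cent rho_unit rho_morph rho_act).
apply: phi_ext => w; rewrite -(jE c cC).
have cn := eq_in_norm (tl_iota c) (in_norm_cent cC cu).
rewrite -(phi_val _ _ cn (R5 _ _ _ (tl_iota c) (R4 c cC cu))).
exact: k2M.
Qed.
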